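(* Let $V$ be an $\mathbb{R}$-reflexive Banach module and let $T\in\mathcal{K}(V)$ be injective and bisectorial of angle $\omega\in(0,\frac{\pi}{2})$. Let $\theta\in(\omega,\frac{\pi}{2})$ and $f\in\mathcal{N}^{\mathrm{poly}}(D_\theta)$, with $|f(s)|\le C(|s|^\alpha+|s|^{-\alpha})$ on $D_\theta$ for some $C,\alpha\ge0$, and let $e(s)=\frac{s^m}{(1+s^2)^m}$ with $m\in\mathbb{N}$, $m>\alpha$. Then the operator $(fe)(T)e(T)^{-1}$ is closable, and the left $H^\infty$-functional calculus $f(T)=e(T)^{-1}(ef)(T)$ can be written as $$f(T)=\overline{(fe)(T)e(T)^{-1}}.$$
   Context: Clifford algebra. Fix $n\ge 1$; $\mathbb{N}=\{1,2,\dots\}$. $\mathbb{R}_n$ is the real Clifford algebra with units $e_1,\dots,e_n$, $e_i^2=-1$, $e_ie_j=-e_je_i$ for $i\ne j$, with basis $e_A=e_{i_1}\cdots e_{i_r}$, $A=(i_1<\dots<i_r)\in\mathcal{A}$, and $|s|^2=\sum_A s_A^2$. Paravectors: $\mathbb{R}^{n+1}=\{s_0+s_1e_1+\dots+s_ne_n\}\subseteq\mathbb{R}_n$, with $\overline{s}=s_0-s_1e_1-\dots-s_ne_n$. $\mathbb{S}=\{J\in\mathbb{R}^{n+1}: J_0=0,|J|=1\}$ and $\mathbb{C}_J=\{x+Jy:x,y\in\mathbb{R}\}$ for $J\in\mathbb{S}$. Modules and operators. For a real Banach space $V_\mathbb{R}$, the Banach module is $V=\{\sum_A v_A\otimes e_A: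 v_A\in V_\mathbb{R}\}$ with $\|v\|^2=\sum_A\|v_A\|_\mathbb{R}^2$ and the left and right multiplications by $\mathbb{R}_n$ induced by the product of $\mathbb{R}_n$. $V$ is $\mathbb{R}$-reflexive if it is reflexive with respect to its $\mathbb{R}$-linear dual (equivalently $V_\mathbb{R}$ is reflexive). $\mathcal{B}(V)$ is the set of bounded everywhere defined right linear operators; $\mathcal{K}(V)$ is the set of closed right linear operators $T:\operatorname{dom}(T)\subseteq V\to V$. A Clifford number $a$ is also regarded as the operator $v\mapsto av$; products of operators and Clifford numbers are compositions. An operator is closable if it has a closed operator extension; its closure $\overline{T}$ is the smallest such extension. Bisectorial operators. $Q_s[T]=T^2-2s_0T+|s|^2$ with domain $\operatorname{dom}(T^2)$; $\rho_S(T)=\{s\in\mathbb{R}^{n+1}:Q_s[T]^{-1}\in\mathcal{B}(V)\}$, $\sigma_S(T)=\mathbb{R}^{n+1}\setminus\rho_S(T)$; $S_L^{-1}(s,T)=Q_s[T]^{-1}\overline{s}-TQ_s[T]^{-1}$ and $S_R^{-1}(s,T)=(\overline{s}-T)Q_s[T]^{-1}$ for $s\in\rho_S(T)$. For $\omega\in(0,\frac{\pi}{2})$, $I_\omega=(-\omega,\omega)\cup(\pi-\omega,\pi+\omega)$ and $D_\omega=\{re^{J\phi}:r>0,J\in\mathbb{S},\phi\in I_\omega\}$. $T\in\mathcal{K}(V)$ is bisectorial of angle $\omega$ if $\sigma_S(T)\subseteq\overline{D_\omega}$ and for every $\varphi\in(\omega,\frac{\pi}{2})$ there is $C_\varphi\ge0$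 with $\|S_L^{-1}(s,T)\|\le C_\varphi/|s|$ for all $s\in\mathbb{R}^{n+1}\setminus(D_\varphi\cup\{0\})$. Functions. For open axially symmetric $U\subseteq\mathbb{R}^{n+1}$ and $\mathcal{U}=\{(x,y)\in\mathbb{R}^2: x+\mathbb{S}y\subseteq U\}$, $f:U\to\mathbb{R}_n$ is left (resp. right) slice hyperholomorphic, $f\in\mathcal{SH}_L(U)$ (resp. $\mathcal{SH}_R(U)$), if there are $C^1$ functions $f_0,f_1:\mathcal{U}\to\mathbb{R}_n$ with $f(x+Jy)=f_0(x,y)+Jf_1(x,y)$ (resp. $f_0(x,y)+f_1(x,y)J$) for all $J\in\mathbb{S}$, $f_0(x,-y)=f_0(x,y)$, $f_1(x,-y)=-f_1(x,y)$, $\partial_xf_0=\partial_yf_1$, $\partial_yf_0=-\partial_xf_1$. It is intrinsic, $f\in\mathcal{N}(U)$, if $f_0,f_1$ are real valued. For $\theta\in(0,\frac\pi2)$, $\mathcal{SH}_L^0(D_\theta)$ and $\mathcal{SH}_R^0(D_\theta)$ consist of the bounded $f$ in $\mathcal{SH}_L(D_\theta)$, resp. $\mathcal{SH}_R(D_\theta)$, with $\int_0^\infty|f(re^{J\phi})|\frac{dr}{r}<\infty$ for all $J\in\mathbb{S},\phi\in I_\theta$. $\mathcal{N}^{\mathrm{poly}}(D_\theta)$ consists of the $f\in\mathcal{N}(D_\theta)$ for which there are $C,\alpha\ge0$ with $|f(s)|\le C(|s|^\alpha+|s|^{-\alpha})$ on $D_\theta$. $\omega$-functional calculus. Let $T$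 be bisectorial of angle $\omega$, $\theta\in(\omega,\frac\pi2)$. For $f\in\mathcal{SH}_L^0(D_\theta)$: $f(T)=\frac{1}{2\pi}\int_{\partial D_\varphi\cap\mathbb{C}_J}S_L^{-1}(s,T)\,ds_J\,f(s)$; for $f\in\mathcal{SH}_R^0(D_\theta)$: $f(T)=\frac{1}{2\pi}\int_{\partial D_\varphi\cap\mathbb{C}_J}f(s)\,ds_J\,S_R^{-1}(s,T)$. Here $ds_J=ds/J$, the boundary is positively oriented ($D_\varphi\cap\mathbb{C}_J$ lies to the left), and $\varphi\in(\omega,\theta)$, $J\in\mathbb{S}$ are arbitrary (the integrals do not depend on the choice). Both give operators in $\mathcal{B}(V)$, and they agree for intrinsic functions. In the claim, $e(T)$ and $(ef)(T)=(fe)(T)$ are given by the $\omega$-functional calculus; $e(T)$ is injective, and $(fe)(T)e(T)^{-1}$ has domain $\operatorname{ran}(e(T))$. The left $H^\infty$-functional calculus $f(T)=e(T)^{-1}(ef)(T)$ is known not to depend on the choice of $m$. *)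

(* Defs.v *)
From HB Require Import structures.
From mathcomp Require Import all_boot all_order all_algebra.
From mathcomp Require Import all_classical all_reals all_analysis.
From mathcomp Require Import ring.

Set Implicit Arguments.
Unset Strict Implicit.
Unset Printing Implicit Defensive.

Import Order.TTheory GRing.Theory Num.Theory.
Import numFieldNormedType.Exports.

Local Open Scope classical_set_scope.
Local Open Scope ring_scope.

Section sqrt_sum.
Variables (R : realType) (I : finType).
Implicit Types a b : I -> R.

Lemma sum_CauchySchwarz a b :
  (\sum_i a i * b i) ^+ 2 <= (\sum_i a i ^+ 2) * (\sum_i b i ^+ 2).
Proof.
have : 0 <= \sum_i \sum_j (a i * b j - a j * b i) ^+ 2.
  by do 2!(apply: sumr_ge0 => ? _); rewrite sqr_ge0.
have -> : \sum_i \sum_j (a i * b j - a j * b i) ^+ 2 =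
    ((\sum_i a i ^+ 2) * (\sum_i b i ^+ 2) - (\sum_i a i * b i) ^+ 2) *+ 2.
  transitivity (\sum_i \sum_j (a i ^+ 2 * b j ^+ 2) +
      \sum_i \sum_j (a j ^+ 2 * b i ^+ 2) -
      (\sum_i \sum_j (a i * b i * (a j * b j))) *+ 2).
    rewrite -sumrMnl -big_split -sumrB /=; apply: eq_bigr => i _.
    rewrite -sumrMnl -big_split -sumrB /=; apply: eq_bigr => j _.
    by ring.
  rewrite [X in _ + X - _]exchange_big /= mulrnBl mulr2n.
  by rewrite expr2 !mulr_suml; congr (_ + _ - _ *+ 2);
     apply: eq_bigr => i _; rewrite mulr_sumr.
by rewrite pmulrn_lge0// subr_ge0.
Qed.

Lemma sqrt_sum_triangle a b c : (forall i, 0 <= a i) -> (forall i, 0 <= b i) ->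
  (forall i, 0 <= c i) -> (forall i, c i <= a i + b i) ->
  Num.sqrt (\sum_i c i ^+ 2) <=
  Num.sqrt (\sum_i a i ^+ 2) + Num.sqrt (\sum_i b i ^+ 2).
Proof.
move=> a0 b0 c0 cab.
have s0 (d : I -> R) : 0 <= \sum_i d i ^+ 2.
  by apply: sumr_ge0 => i _; rewrite sqr_ge0.
rewrite -(ger0_norm (addr_ge0 (sqrtr_ge0 _) (sqrtr_ge0 _))) -sqrtr_sqr.
rewrite ler_wsqrtr// sqrrD !sqr_sqrtr//.
apply: (@le_trans _ _ (\sum_i (a i + b i) ^+ 2)).
  by apply: ler_sum => i _; rewrite lerXn2r ?nnegrE ?addr_ge0.
under eq_bigr do rewrite sqrrD.
rewrite !big_split /= lerD2r lerD2l -mulr2n lerMn2r /=.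
rewrite -sqrtrM// -[leLHS]ger0_norm ?sumr_ge0// => [|i _]; last first.
  by rewrite mulr_ge0.
by rewrite -sqrtr_sqr ler_wsqrtr// sum_CauchySchwarz.
Qed.

End sqrt_sum.

(* The Banach module [V = {sum_A v_A (x) e_A}] over a real space [E]; the      *)
(* multi-indices i_1 < ... < i_r are the subsets of 'I_n.                      *)
Definition cliff_mod (R : realType) (n : nat) (E : normedModType R) : Type :=
  {ffun {set 'I_n} -> E}.

Section cliff_mod_normed.
Variables (R : realType) (n : nat) (E : normedModType R).

HB.instance Definition _ := GRing.Lmodule.copy (cliff_mod n E)
  {ffun {set 'I_n} -> E}.

Definition cliff_norm (v : cliff_mod n E) : R :=
  Num.sqrt (\sum_A `|v A| ^+ 2).

Let cliff_normD (u v : cliff_mod n E) :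
  cliff_norm (u + v) <= cliff_norm u + cliff_norm v.
Proof.
apply: sqrt_sum_triangle => // A.
by rewrite ffunE ler_normD.
Qed.

Let cliff_normZ (r : R) (v : cliff_mod n E) :
  cliff_norm (r *: v) = `|r| * cliff_norm v.
Proof.
rewrite /cliff_norm -[in RHS](ger0_norm (normr_ge0 r)) -sqrtr_sqr.
rewrite -sqrtrM ?sqr_ge0// mulr_sumr; congr Num.sqrt.
by apply: eq_bigr => A _; rewrite ffunE normrZ exprMn.
Qed.

Let cliff_norm0_eq0 (v : cliff_mod n E) : cliff_norm v = 0 -> v = 0.
Proof.
move=> /eqP; rewrite /cliff_norm sqrtr_eq0 => v0.
have /eqP : \sum_A `|v A| ^+ 2 = 0.
  by apply/le_anti; rewrite v0 sumr_ge0// => A _; rewrite sqr_ge0.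
rewrite psumr_eq0 => [/allP vA|A _]; last by rewrite sqr_ge0.
apply/ffunP => A; rewrite ffunE.
by have := vA A (mem_index_enum _); rewrite sqrf_eq0 normr_eq0 => /eqP.
Qed.

HB.instance Definition _ := Lmodule_isNormed.Build R (cliff_mod n E)
  cliff_normD cliff_normZ cliff_norm0_eq0.

End cliff_mod_normed.

(* The Clifford algebra R_n, with its basis e_A; its norm is the one of        *)
(* [cliff_mod n R].                                                            *)
Definition clifford (R : realType) (n : nat) : Type := cliff_mod n R^o.

HB.instance Definition _ (R : realType) (n : nat) :=
  NormedModule.copy (clifford R n) (cliff_mod n R^o).

Section symmetric_difference.
Variable n : nat.
Implicit Types A B K : {set 'I_n}.

Definition symd A B : {set 'I_n} :=
  [set i | (i \in A) (+) (i \in B)]%SET.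

Lemma symdC A B : symd A B = symd B A.
Proof. by apply/setP => i; rewrite !inE addbC. Qed.

Lemma symdA A B K : symd A (symd B K) = symd (symd A B) K.
Proof. by apply/setP => i; rewrite !inE addbA. Qed.

Lemma sym0d A : symd finset.set0 A = A.
Proof. by apply/setP => i; rewrite !inE. Qed.

Lemma symdd A : symd A A = finset.set0.
Proof. by apply/setP => i; rewrite !inE addbb. Qed.

Lemma symdK A : involutive (symd A).
Proof. by move=> B; rewrite symdA symdd sym0d. Qed.

End symmetric_difference.

Section clifford_product.
Variables (R : realType) (n : nat).
Implicit Types A B K : {set 'I_n}.

(* e_A e_B = csign A B * e_(symd A B): sorting e_A e_B gives one sign for each *)
(* i in A and j in B with j < i (a transposition) or j = i (e_i^2 = -1).       *)
Definition csign A B : R :=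
  \prod_(i in A) \prod_(j in B) (if (j <= i)%N then -1 else 1).

Definition cbasis A : clifford R n := [ffun B => (B == A)%:R].

Definition lmul (E : normedModType R) (a : clifford R n) (v : cliff_mod n E) :
    cliff_mod n E :=
  [ffun K => \sum_A (a A * csign A (symd A K)) *: v (symd A K)].

Definition rmul (E : normedModType R) (v : cliff_mod n E) (a : clifford R n) :
    cliff_mod n E :=
  [ffun K => \sum_A (csign A (symd A K) * a (symd A K)) *: v A].

Let prod_symd (g : 'I_n -> R) A B : (forall i, g i * g i = 1) ->
  \prod_(i in symd A B) g i = (\prod_(i in A) g i) * (\prod_(i in B) g i).
Proof.
move=> gg; rewrite [LHS]big_mkcond [X in X * _]big_mkcond.
rewrite [X in _ * X]big_mkcond -big_split; apply: eq_bigr => i _ /=.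
by rewrite inE; case: (i \in A) => /=; case: (i \in B); rewrite /= ?gg ?mulr1 ?mul1r.
Qed.

Let prod_sqr1 (P : pred 'I_n) (g : 'I_n -> R) : (forall i, g i * g i = 1) ->
  (\prod_(i | P i) g i) * (\prod_(i | P i) g i) = 1.
Proof. by move=> gg; rewrite -big_split big1// => i _; rewrite /= gg. Qed.

Let sign_sqr1 (b : bool) : (if b then -1 else 1) * (if b then -1 else 1) = 1 :> R.
Proof. by case: b; rewrite ?mulrNN mulr1. Qed.

Lemma csignDl A B K : csign (symd A B) K = csign A K * csign B K.
Proof. by apply: prod_symd => i; apply: prod_sqr1 => j; apply: sign_sqr1. Qed.

Lemma csignDr A B K : csign K (symd A B) = csign K A * csign K B.
Proof.
rewrite /csign -big_split; apply: eq_bigr => i _ /=.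
by apply: prod_symd => j; apply: sign_sqr1.
Qed.

Lemma csign0l A : csign finset.set0 A = 1.
Proof. by rewrite /csign big_set0. Qed.

Lemma csign0r A : csign A finset.set0 = 1.
Proof. by rewrite /csign big1// => i _; rewrite big_set0. Qed.

Lemma csign_sqr A B : csign A B * csign A B = 1.
Proof. by rewrite -csignDl symdd csign0l. Qed.

Variable E : normedModType R.
Implicit Types (a b : clifford R n) (v w : cliff_mod n E).

Lemma lmulDl a b v : lmul (a + b) v = lmul a v + lmul b v.
Proof.
apply/ffunP => K; rewrite !ffunE -big_split; apply: eq_bigr => A _ /=.
by rewrite ffunE mulrDl scalerDl.
Qed.

Lemma lmulDr a v w : lmul a (v + w) = lmul a v + lmul a w.
Proof.
apply/ffunP => K; rewrite !ffunE -big_split; apply: eq_bigr => A _ /=.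
by rewrite ffunE scalerDr.
Qed.

Lemma lmulZl r a v : lmul (r *: a) v = r *: lmul a v.
Proof.
apply/ffunP => K; rewrite !ffunE scaler_sumr; apply: eq_bigr => A _ /=.
by rewrite ffunE scalerA mulrA.
Qed.

Lemma lmulZr r a v : lmul a (r *: v) = r *: lmul a v.
Proof.
apply/ffunP => K; rewrite !ffunE scaler_sumr; apply: eq_bigr => A _ /=.
by rewrite ffunE !scalerA mulrC.
Qed.

Lemma lmul1l v : lmul (cbasis finset.set0) v = v.
Proof.
apply/ffunP => K; rewrite ffunE (bigD1 finset.set0)//= big1 ?addr0 => [|A A0].
  by rewrite ffunE eqxx csign0l mul1r sym0d scale1r.
by rewrite ffunE (negbTE A0) mul0r scale0r.
Qed.

Lemma lmulA a b v :
  lmul a (lmul b v) = lmul (lmul a (b : cliff_mod n R^o) : clifford R n) v.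
Proof.
apply/ffunP => K; rewrite !ffunE.
under eq_bigr do rewrite ffunE scaler_sumr.
under [RHS]eq_bigr do rewrite ffunE mulr_suml scaler_suml.
rewrite [RHS]exchange_big; apply: eq_bigr => A _ /=.
rewrite [RHS](reindex_inj (inv_inj (symdK A))); apply: eq_bigr => B _ /=.
rewrite symdK scalerA; congr (_ *: _); last first.
  by congr (v _); rewrite !symdA (symdC B A).
rewrite [_ *: b B]/GRing.scale /= (symdC A B) -symdA csignDl.
rewrite -(symdK B (symd A K)) csignDr symdK.
by rewrite -!mulrA; congr (_ * _); rewrite mulrCA mulrC -!mulrA; congr (_ * _);
   rewrite mulrCA.
Qed.

End clifford_product.

Section clifford_ring.
Variables (R : realType) (n : nat).
Implicit Types a b c : clifford R n.

Definition cliff_mul a b : clifford R n := lmul a (b : cliff_mod n R^o).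

Let cmulA : associative cliff_mul.
Proof. by move=> a b c; exact: lmulA. Qed.

Let cmul1l : left_id (cbasis R finset.set0) cliff_mul.
Proof. by move=> a; exact: lmul1l. Qed.

Let cmul1r : right_id (cbasis R finset.set0) cliff_mul.
Proof.
move=> a; apply/ffunP => K; rewrite ffunE (bigD1 K)//= big1 ?addr0 => [|A AK].
  by rewrite symdd csign0r ffunE eqxx mulr1 /GRing.scale /= mulr1.
rewrite ffunE; case: eqP => [AK0|_]; last by rewrite scaler0.
by move: AK; rewrite -[K](symdK A) AK0 symdC sym0d eqxx.
Qed.

Let cmulDl : left_distributive cliff_mul +%R.
Proof. by move=> a b c; exact: lmulDl. Qed.

Let cmulDr : right_distributive cliff_mul +%R.
Proof. by move=> a b c; exact: lmulDr. Qed.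

Let cone_neq0 : cbasis R finset.set0 != 0 :> clifford R n.
Proof.
by apply/eqP => /ffunP/(_ finset.set0); rewrite !ffunE eqxx => /eqP; rewrite oner_eq0.
Qed.

HB.instance Definition _ := GRing.Zmodule_isNzRing.Build (clifford R n)
  cmulA cmul1l cmul1r cmulDl cmulDr cone_neq0.

HB.instance Definition _ := GRing.Lmodule_isLalgebra.Build R (clifford R n)
  (fun r a b => esym (lmulZl r a (b : cliff_mod n R^o))).

HB.instance Definition _ := GRing.Lalgebra_isAlgebra.Build R (clifford R n)
  (fun r a b => esym (lmulZr r a (b : cliff_mod n R^o))).

Lemma cliff_mulE a b : a * b = rmul (a : cliff_mod n R^o) b.
Proof.
apply/ffunP => K; rewrite [LHS]ffunE [RHS]ffunE; apply: eq_bigr => A _.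
by rewrite /GRing.scale /= -mulrA mulrC.
Qed.

Definition cunit (i : 'I_n) : clifford R n := cbasis R [set i]%SET.

Lemma cbasisM (A B : {set 'I_n}) :
  cbasis R A * cbasis R B = csign R A B *: cbasis R (symd A B).
Proof.
apply/ffunP => K; rewrite ffunE (bigD1 A)//= big1 ?addr0 => [|A' A'A]; last first.
  by rewrite ffunE (negbTE A'A) mul0r scale0r.
rewrite !ffunE eqxx mul1r (inv_eq (symdK A)) /GRing.scale /=.
by case: eqP => [->|_]; rewrite ?mulr0// symdK.
Qed.

Lemma cunit_sqr i : cunit i * cunit i = -1.
Proof. by rewrite cbasisM /csign !big_set1 leqnn symdd scaleN1r. Qed.

Lemma cunit_anticomm i j : i != j -> cunit i * cunit j = - (cunit j * cunit i).
Proof.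
move=> ij; rewrite !cbasisM /csign !big_set1 (symdC [set j]%SET) -scaleNr.
congr (_ *: _); case: ltngtP => //; rewrite ?opprK// => /val_inj ji.
by rewrite ji eqxx in ij.
Qed.

Lemma cbasis_prod (A : {set 'I_n}) : cbasis R A = \prod_(i <- enum A) cunit i.
Proof.
rewrite -[in LHS](set_enum A).
have : sorted (fun i j : 'I_n => (i < j)%N) (enum A).
  have <- : [seq i <- enum 'I_n | i \in A] = enum A.
    by rewrite {2}/enum_mem -enumT.
  apply: sorted_filter => [i j k|]; first exact: ltn_trans.
  by rewrite -(sorted_map (f := @nat_of_ord n) (e' := ltn)) val_enum_ord iota_ltn_sorted.
elim: (enum A) => [_|i s IHs] /=.
  by rewrite big_nil; congr (cbasis R _); apply/setP => j; rewrite !inE.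
rewrite path_sortedE => [/andP[/allP is_s s_sorted]|j k l]; last exact: ltn_trans.
rewrite big_cons -IHs// cbasisM /csign big_set1 big1 => [|j]; last first.
  by rewrite inE => /is_s; rewrite ltnNge => /negbTE ->.
rewrite scale1r; congr (cbasis R _); apply/setP => j; rewrite !inE.
case: eqP => [->|//]; case: (boolP (i \in s)) => // /is_s.
by rewrite ltnn.
Qed.

End clifford_ring.

Section paravectors.
Variables (R : realType) (n : nat).
Implicit Types (s J : clifford R n).

Definition paravector : set (clifford R n) :=
  [set s | forall A : {set 'I_n}, (1 < #|A|)%N -> s A = 0].

Definition scalar_part s : R := s finset.set0.

Definition pconj s : clifford R n :=
  [ffun A => if A == finset.set0 then s A else - s A].

(* [s * pconj s = |s|^2] when s is a paravector *)
Definition pinv s : clifford R n := (`|s| ^+ 2)^-1 *: pconj s.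

Definition unit_sphere : set (clifford R n) :=
  [set J | [/\ paravector J, scalar_part J = 0 & `|J| = 1]].

(* x + J y *)
Definition slice_point J (x y : R) : clifford R n := x%:A + y *: J.

(* e^(J phi) *)
Definition cexp J (phi : R) : clifford R n := slice_point J (cos phi) (sin phi).

Definition double_sector (omega : R) : set (clifford R n) :=
  [set s | exists r J phi,
    [/\ 0 < r, unit_sphere J,
        (- omega < phi < omega) || (pi - omega < phi < pi + omega) &
        s = r *: cexp J phi]].

End paravectors.

Section intrinsic_functions.
Variables (R : realType) (n : nat).
Implicit Types (U : set (clifford R n)) (f : clifford R n -> clifford R n).

Definition slice_domain U : set (R * R) :=
  [set p | forall J, unit_sphere J -> U (slice_point J p.1 p.2)].

Definition dx (g : R * R -> R) (p : R * R) : R := 'D_(1, 0) g p.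

Definition dy (g : R * R -> R) (p : R * R) : R := 'D_(0, 1) g p.

(* for open subsets of R^2 *)
Definition continuously_differentiable (O : set (R * R)) (g : R * R -> R) :=
  forall p, O p ->
    [/\ derivable g p (1, 0), derivable g p (0, 1),
        {for p, continuous (dx g)} & {for p, continuous (dy g)}].

(* The class N(U), for U open in R^(n+1) and axially symmetric. *)
Definition intrinsic U f : Prop :=
  exists f0 f1 : R * R -> R,
    [/\ continuously_differentiable (slice_domain U) f0,
        continuously_differentiable (slice_domain U) f1,
        forall x y J, slice_domain U (x, y) -> unit_sphere J ->
          f (slice_point J x y) = (f0 (x, y))%:A + J * (f1 (x, y))%:A,
        forall x y, slice_domain U (x, y) ->
          f0 (x, - y) = f0 (x, y) /\ f1 (x, - y) = - f1 (x, y) &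
        forall p, slice_domain U p ->
          dx f0 p = dy f1 p /\ dy f0 p = - dx f1 p].

(* f belongs to N^poly(D_theta), with growth constants C and alpha. *)
Definition intrinsic_poly (theta C alpha : R) f : Prop :=
  [/\ intrinsic (@double_sector R n theta) f, 0 <= C, 0 <= alpha &
      forall s, double_sector theta s ->
        `|f s| <= C * (`|s| `^ alpha + `|s| `^ (- alpha))].

Definition regularizer (m : nat) : clifford R n -> clifford R n :=
  fun s => s ^+ m * pinv ((1 + s ^+ 2) ^+ m).

End intrinsic_functions.

Section reflexivity.
Variables (R : realType) (E : normedModType R).

Definition normed_dual : set (E -> R) :=
  [set phi | scalar phi /\ exists c, forall v, `|phi v| <= c * `|v|].

Definition dual_norm (phi : E -> R) : R :=
  sup [set `|phi v| | v in [set v | `|v| <= 1]].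

(* Only the values of Phi on [normed_dual] matter. *)
Definition normed_bidual : set ((E -> R) -> R) :=
  [set Phi |
    (forall a phi psi, normed_dual phi -> normed_dual psi ->
       Phi (fun v => a * phi v + psi v) = a * Phi phi + Phi psi) /\
    (exists c, forall phi, normed_dual phi -> `|Phi phi| <= c * dual_norm phi)].

Definition reflexive_space : Prop :=
  forall Phi, normed_bidual Phi -> exists v, forall phi, normed_dual phi -> Phi phi = phi v.

End reflexivity.

(* Unbounded operators are given by their graphs. Sums and products have their *)
(* natural domains.                                                            *)
Section operators.
Variables (R : realType) (n : nat) (E : normedModType R).
Local Notation V := (cliff_mod n E).
Implicit Types (S T : set (V * V)) (B : V -> V).

Definition graph_of B : set (V * V) := [set p | p.2 = B p.1].

Definition op_comp S T : set (V * V) :=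
  [set p | exists2 u, T (p.1, u) & S (u, p.2)].

Definition op_inv T : set (V * V) := [set p | T (p.2, p.1)].

Definition op_sub S T : set (V * V) :=
  [set p | exists a b, [/\ S (p.1, a), T (p.1, b) & p.2 = a - b]].

(* The value at v of an operator defined at v. *)
Definition op_app T (v : V) : V := xget 0 [set w | T (v, w)].

Definition single_valued T : Prop :=
  forall v w w', T (v, w) -> T (v, w') -> w = w'.

Definition op_injective T : Prop :=
  forall v v' w, T (v, w) -> T (v', w) -> v = v'.

Definition right_linear T : Prop :=
  [/\ T (0, 0),
      forall v w v' w', T (v, w) -> T (v', w') -> T (v + v', w + w') &
      forall v w a, T (v, w) -> T (rmul v a, rmul w a)].

(* The class K(V). *)
Definition closed_operator T : Prop :=
  [/\ single_valued T, right_linear T & closed T].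

Definition closable T : Prop :=
  exists2 S, closed_operator S & T `<=` S.

(* S is the closure of T. *)
Definition is_op_closure T S : Prop :=
  [/\ closed_operator S, T `<=` S &
      forall S', closed_operator S' -> T `<=` S' -> S `<=` S'].

(* ||B|| <= c *)
Definition opnorm_le B (c : R) : Prop := forall v, `|B v| <= c * `|v|.

(* The class B(V). *)
Definition bounded_operator B : Prop :=
  right_linear (graph_of B) /\ exists c, opnorm_le B c.

(* T^2 - 2 s_0 T + |s|^2, with domain dom(T^2) *)
Definition Qop (s : clifford R n) T : set (V * V) :=
  [set p | exists u w, [/\ T (p.1, u), T (u, w) &
    p.2 = w - (2 * scalar_part s) *: u + (`|s| ^+ 2) *: p.1]].

Definition S_resolvent T : set (clifford R n) :=
  [set s | paravector s /\
    exists2 B, bounded_operator B & op_inv (Qop s T) = graph_of B].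

Definition S_spectrum T : set (clifford R n) := @paravector R n `\` S_resolvent T.

(* S_L^{-1}(s, T), for s in the S-resolvent set *)
Definition SL_inv (s : clifford R n) T : V -> V :=
  op_app (op_sub (op_comp (op_inv (Qop s T)) (graph_of (lmul (pconj s))))
                 (op_comp T (op_inv (Qop s T)))).

Definition bisectorial (omega : R) T : Prop :=
  [/\ closed_operator T,
      S_spectrum T `<=` closure (@double_sector R n omega) &
      forall phi, omega < phi < pi / 2 -> exists2 C, 0 <= C &
        forall s, paravector s -> ~ double_sector phi s -> s <> 0 ->
          opnorm_le (SL_inv s T) (C / `|s|)].

End operators.

(* Operator-valued Riemann integrals, convergent in the operator norm. *)
Section operator_integral.
Variables (R : realType) (n : nat) (E : normedModType R).
Local Notation V := (cliff_mod n E).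
Implicit Types (F : R -> V -> V) (B : V -> V).

Definition riemann_sum F (a : R) (t : seq R) (xi : nat -> R) : V -> V :=
  fun v => \sum_(i < size t) (nth 0 t i - nth 0 (a :: t) i) *: F (xi i) v.

(* a :: t is a partition of [a, b] of mesh < delta, with tags xi *)
Definition tagged_partition (a b delta : R) (t : seq R) (xi : nat -> R) : Prop :=
  itv_partition a b t /\
  forall i, (i < size t)%N ->
    nth 0 (a :: t) i <= xi i <= nth 0 t i /\
    nth 0 t i - nth 0 (a :: t) i < delta.

Definition is_integral F (a b : R) B : Prop :=
  forall eps, 0 < eps -> exists2 delta, 0 < delta &
    forall t xi, tagged_partition a b delta t xi ->
      opnorm_le (riemann_sum F a t xi \- B) eps.

Definition is_improper_integral F B : Prop :=
  forall eps, 0 < eps -> \forall a \near (0 : R)^'+ & b \near +oo,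
    exists2 I, is_integral F a b I & opnorm_le (I \- B) eps.

(* the integral over ]0, +oo[, if it converges *)
Definition improper_integral F : V -> V :=
  xget (fun=> 0) [set B | is_improper_integral F B].

End operator_integral.

Section omega_calculus.
Variables (R : realType) (n : nat) (E : normedModType R).
Local Notation V := (cliff_mod n E).
Variables (T : set (V * V)) (J : clifford R n) (phi : R).
Implicit Type f : clifford R n -> clifford R n.

(* Integral of S_L^{-1}(s,T) ds_J f(s) along the outgoing ray s = r e^(J psi), *)
(* r > 0; there ds_J = (e^(J psi) / J) dr.                                     *)
Definition ray_integral f (psi : R) : V -> V :=
  improper_integral (fun r v =>
    SL_inv (r *: cexp J psi) T
      (lmul (cexp J psi * pinv J * f (r *: cexp J psi)) v)).

(* The positively oriented boundary of D_phi in C_J runs outwards along the    *)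
(* angles - phi and pi - phi, and inwards along phi and pi + phi.              *)
Definition omega_calculus f : V -> V := fun v =>
  (2 * pi)^-1 *:
    (ray_integral f (- phi) v - ray_integral f phi v
     + ray_integral f (pi - phi) v - ray_integral f (pi + phi) v).

End omega_calculus.

(* Main.v *)
From HB Require Import structures.
Require Import Defs.
From mathcomp Require Import all_boot all_order all_algebra.
From mathcomp Require Import all_classical all_reals all_analysis.
From mathcomp Require Import ring lra zify.

(* With K = T (1 + T^2)^{-1}, deforming the rays of the integration path gives  *)
(* e(T) = K^m =: E, and F := (ef)(T) = (fe)(T) is a bounded operator commuting *)
(* with E and with the resolvents of T. Hence f(T) = {(v, w) | F v = E w} and   *)
(* (fe)(T) e(T)^{-1} = {(E u, F u)}, which is contained in f(T). Conversely,    *)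
(* let Y_k = T^2 (T^2 + k^{-2})^{-1} k^2 (T^2 + k^2)^{-1}; then Y_k^m = E B_k   *)
(* with B_k bounded, is uniformly bounded and E (Y_k^m - 1) tends to 0. As V is *)
(* reflexive and E is injective, Y_k^m v tends weakly to v, along ultrafilters. *)
(* If F v = E w then (Y_k^m v, Y_k^m w) = (E (B_k v), F (B_k v)), so that (v, w) *)
(* is a weak limit, hence by Hahn-Banach a norm limit, of points of the graph   *)
(* of (fe)(T) e(T)^{-1}. The integrals of the functional calculus are obtained  *)
(* as weak limits as well, from the same reflexivity.                           *)

Set Implicit Arguments.
Unset Strict Implicit.
Unset Printing Implicit Defensive.

Import Order.TTheory GRing.Theory Num.Theory.
Import numFieldNormedType.Exports.

Local Open Scope classical_set_scope.
Local Open Scope ring_scope.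

(** * Functional analysis *)

(** The operator [T] need not commute with left multiplication by [J], so the resolvent is studied
    over an auxiliary imaginary unit. Off the double sector, [Q_z^{-1}] and [T Q_z^{-1}] lie in a
    commutative algebra ([balg], a bicommutant), and in its complexification
    [Rz z = (conj z - T) Q_z^{-1}] is a genuine resolvent [(z - T)^{-1}]: it satisfies the resolvent
    identity ([Rz_resolvent]) and decays like [1 / |z|] ([polar_resolvent_bounds]). When the
    integrals over two conjugate rays are subtracted, the terms containing [J] cancel ([ray_pair]).
    Hence [pi] times the functional calculus of [h] is the difference, between the angles [pi - phi]
    and [phi], of the integrals of [Im (e^(i psi) h R) dr] ([omega_calculus_total]). Such an
    operator is linear, bounded, commutes with the commutant of the resolvents, and depends only on
    the values of [h] on the rays; in particular [(ef)(T) = (fe)(T)].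

    For [e] the integral is evaluated: with [K = T (1 + T^2)^{-1}] it gives [e(T) = K^m]
    ([power_integral]). Turning the ray from [phi] to [pi - phi] contributes through boundary terms
    only ([ray_deformation]), and a recurrence in [m] leaves scalar integrals that are computed
    explicitly.

    Let [E = e(T)] and [F = (ef)(T)]. These are commuting bounded operators and [E] is injective
    because [T] is. Then [f(T)] is the closed set of pairs with [F v = E w], and it contains the
    graph of all [(E u, F u)]. Density of the latter is [right_quotient_dense]. There are bounded
    [B_k], commuting with [E] and [F], such that [E B_k] is uniformly bounded and [E (E B_k v - v)]
    tends to 0 ([unit_approx_pow_cvg]). By reflexivity [E B_k v] has a weak limit along an
    ultrafilter, and injectivity of [E] identifies it as [v]. If [F v = E w], then
    [(E B_k v, E B_k w) = (E B_k v, F B_k v)] lies in the graph, so [(v, w)] is a weak limit of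
    points of a subspace and Hahn-Banach makes it a norm limit.

    Integrals are handled through antiderivatives ([antider], [op_antider]), whose increments are
    unique. Their existence also comes from reflexivity: Riemann sums converge weakly along an
    ultrafilter, and weak lower semicontinuity of the norm turns this into estimates in the operator
    norm ([op_antider_ex], [op_total_incr_ex]). *)

Section hahn_banach.
Variables (R : realType) (X : lmodType R).
Implicit Types (p q : X -> R).

Definition sublinear p : Prop :=
  (forall x y, p (x + y) <= p x + p y) /\
  (forall t x, 0 <= t -> p (t *: x) <= t * p x).

Lemma sublinear0 p : sublinear p -> p 0 = 0.
Proof.
move=> [pD pZ]; apply/le_anti/andP; split.
  by have := pZ 0 0 (lexx _); rewrite scale0r mul0r.
by have := pD 0 0; rewrite addr0 lerDl.
Qed.

Lemma sublinear_ge p x : sublinear p -> - p (- x) <= p x.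
Proof.
by move=> pS; have := pS.1 x (- x); rewrite subrr sublinear0// -subr_ge0 subr0 -lerBlDr sub0r.
Qed.

(** Zorn's lemma for the reversed pointwise order. A chain is bounded by its pointwise infimum,
    which is finite because every sublinear minorant of [p] is at least [- p (- x)], and subadditive
    because two members of a chain are comparable. *)
Lemma minimal_sublinear p : sublinear p ->
  exists q, [/\ sublinear q, forall x, q x <= p x &
    forall q', sublinear q' -> (forall x, q' x <= q x) -> forall x, q x <= q' x].
Proof.
move=> pS; pose Y := {q : X -> R | sublinear q /\ forall x, q x <= p x}.
pose r (a b : Y) := `[< forall x, sval b x <= sval a x >].
have py : sublinear p /\ (forall x, p x <= p x) by [].
have [|a b c /asboolP ab /asboolP bc||[q [qS qp]] qmax] :=
    @ZL_preorder Y (exist _ p py) r.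
- by move=> a; apply/asboolP.
- by apply/asboolP => x; apply: le_trans (bc x) (ab x).
- move=> A Atot; have [[a0 Aa0]|A0] := pselect (A !=set0); last first.
    exists (exist _ p py) => s As; exfalso; apply: A0; by exists s.
  pose B x := [set sval a x | a in A].
  have Blb x : lbound (B x) (- p (- x)).
    move=> _ [a Aa <-]; have [aS ap] := svalP a.
    by apply: le_trans (sublinear_ge x aS); rewrite lerN2.
  have Bi x : has_inf (B x).
    split; first by exists (sval a0 x), a0.
    by exists (- p (- x)).
  have Ble x a : A a -> inf (B x) <= sval a x.
    by move=> Aa; apply: ge_inf; [exact: (Bi x).2 | exists a].
  have tS : sublinear (fun x => inf (B x)).
    split.
      move=> x y; apply/ler_addgt0Pr => e e0; have e20 : 0 < e / 2 by rewrite divr_gt0.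
      have [_ [a Aa <-] ax] := inf_adherent e20 (Bi x).
      have [_ [b Ab <-] bx] := inf_adherent e20 (Bi y).
      have [c [Ac ca cb]] : exists c, [/\ A c, sval c x <= sval a x &
          sval c y <= sval b y].
        have [/asboolP ab|/asboolP ba] := Atot _ _ Aa Ab; first by exists b.
        by exists a.
      have [[cD _] _] := svalP c.
      have := le_trans (Ble (x + y) _ Ac) (cD x y); lra.
    move=> t x; rewrite le_eqVlt => /predU1P[<-|t0].
      rewrite mul0r scale0r; apply: (le_trans (Ble 0 _ Aa0)).
      by rewrite sublinear0//; have [] := svalP a0.
    rewrite mulrC -ler_pdivrMr//; apply: lb_le_inf; first exact: (Bi x).1.
    move=> _ [a Aa <-]; rewrite ler_pdivrMr// mulrC.
    apply: (le_trans (Ble _ _ Aa)).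
    by have [[_ aZ] _] := svalP a; apply: aZ; exact: ltW.
  have tp : forall x, inf (B x) <= p x.
    by move=> x; apply: (le_trans (Ble _ _ Aa0)); have [_] := svalP a0.
  exists (exist _ (fun x => inf (B x)) (conj tS tp)) => s As.
  by apply/asboolP => x; exact: Ble.
- exists q; split=> // q' q'S q'q.
  have q'p : forall x, q' x <= p x by move=> x; apply: le_trans (q'q x) (qp x).
  have /(_ _)/asboolP := qmax (exist _ q' (conj q'S q'p)).
  by apply; apply/asboolP.
Qed.

(** A sublinear minorant of [q] (take [t = 0]) with value at most [- q y] at [- y] (take [t = 1]). A
    minimal [q] lies below its shifts, which forces [q (x + y) = q x + q y]. *)
Definition sublinear_shift q (y x : X) : R :=
  inf [set q (x + t *: y) - t * q y | t in [set t | 0 <= t]].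

Section shift.
Variables (q : X -> R) (y : X).
Hypothesis qS : sublinear q.

Let shift_has_inf x : has_inf [set q (x + t *: y) - t * q y | t in [set t | 0 <= t]].
Proof.
split; first by exists (q (x + 0 *: y) - 0 * q y), 0 => /=.
exists (- q (- x)) => _ [t /= t0 <-].
have := qS.1 (x + t *: y) (- x); rewrite addrAC subrr add0r.
suff : t * q y <= q (t *: y) by lra.
move: t0; rewrite le_eqVlt => /predU1P[<-|t0].
  by rewrite mul0r scale0r sublinear0.
have := qS.2 t^-1 (t *: y); rewrite scalerA mulVf ?gt_eqF// scale1r.
by rewrite invr_ge0 ltW// mulrC => /(_ isT); rewrite ler_pdivlMr// mulrC.
Qed.

Lemma sublinear_shift_le t x : 0 <= t -> sublinear_shift q y x <= q (x + t *: y) - t * q y.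
Proof. by move=> t0; apply: ge_inf; [exact: (shift_has_inf x).2|exists t]. Qed.

Lemma sublinear_shiftP : sublinear (sublinear_shift q y).
Proof.
split=> [x1 x2|s x].
  apply/ler_addgt0Pr => e e0; have e20 : 0 < e / 2 by rewrite divr_gt0.
  have [_ [t1 /= t10 <-] h1] := inf_adherent e20 (shift_has_inf x1).
  have [_ [t2 /= t20 <-] h2] := inf_adherent e20 (shift_has_inf x2).
  have := sublinear_shift_le (x1 + x2) (addr_ge0 t10 t20).
  have := qS.1 (x1 + t1 *: y) (x2 + t2 *: y).
  rewrite addrACA -scalerDl -/(sublinear_shift q y x1) -/(sublinear_shift q y x2) in h1 h2 *.
  lra.
rewrite le_eqVlt => /predU1P[<-|s0].
  have := sublinear_shift_le 0 (lexx 0).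
  by rewrite !scale0r !mul0r addr0 subr0 (sublinear0 qS).
rewrite mulrC -ler_pdivrMr//; apply: lb_le_inf; first exact: (shift_has_inf x).1.
move=> _ [t /= t0 <-]; rewrite ler_pdivrMr//.
apply: (le_trans (sublinear_shift_le (s *: x) (mulr_ge0 (ltW s0) t0))).
rewrite -scalerA -scalerDr; have := qS.2 s (x + t *: y) (ltW s0); lra.
Qed.

End shift.

(** Minimal sublinear functionals are linear. Minimizing below the shift of [p] along [x0] instead
    of below [p] forces [f (- x0) <= - p x0], hence equality at [x0]. *)
Lemma hahn_banach p x0 : sublinear p ->
  exists f : X -> R, [/\ scalar f, forall x, f x <= p x & f x0 = p x0].
Proof.
move=> pS; have p1S := sublinear_shiftP x0 pS.
have [q [qS qp1 qmin]] := minimal_sublinear p1S.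
have p1p x : sublinear_shift p x0 x <= p x.
  by have := sublinear_shift_le x0 pS x (lexx 0); rewrite scale0r mul0r subr0 addr0.
have qD x y : q (x + y) = q x + q y.
  apply/le_anti; rewrite qS.1/=.
  have := qmin _ (sublinear_shiftP y qS) _ x => /(_ _)/le_trans H.
  have := H _ _ (sublinear_shift_le y qS x ler01); rewrite scale1r mul1r.
  rewrite lerBrDr; apply=> z.
  by have := sublinear_shift_le y qS z (lexx 0); rewrite scale0r mul0r subr0 addr0.
have q0 := sublinear0 qS.
have qN x : q (- x) = - q x.
  by apply/eqP; rewrite -addr_eq0 -qD addNr q0.
have qZ0 t x : 0 <= t -> q (t *: x) = t * q x.
  move=> t0; apply/le_anti; rewrite qS.2//=.
  by have := qS.2 t (- x) t0; rewrite scalerN !qN mulrN lerN2.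
have qZ t x : q (t *: x) = t * q x.
  have [t0|t0] := leP 0 t; first exact: qZ0.
  by rewrite -[t]opprK scaleNr qN qZ0 ?mulNr// oppr_ge0 ltW.
exists q; split=> [t x y|x|].
- by rewrite qD qZ.
- exact: le_trans (qp1 x) (p1p x).
apply/le_anti; rewrite (le_trans (qp1 _) (p1p _))/=.
have := le_trans (qp1 (- x0)) (sublinear_shift_le x0 pS (- x0) ler01).
by rewrite scale1r addNr sublinear0// mul1r sub0r qN lerN2.
Qed.

End hahn_banach.

(** * Duality and weak limits along ultrafilters *)

Section weak_limits.
Variables (R : realType) (E : normedModType R).

Lemma norming_functional (x : E) : exists f : E -> R,
  [/\ normed_dual f, forall v, `|f v| <= `|v| & f x = `|x|].
Proof.
have nS : sublinear (fun v : E => `|v|).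
  by split=> [|t v t0]; [exact: ler_normD|rewrite normrZ ger0_norm].
have [f [fL fle fx]] := hahn_banach x nS.
have fN v : f (- v) = - f v.
  by have := fL (-1) v 0; rewrite scaleN1r addr0 => ->; have := fL (-1) 0 0;
     rewrite scaler0 addr0 => f0; rewrite mulN1r; lra.
have fb v : `|f v| <= `|v|.
  by rewrite ler_norml fle andbT lerNl -fN; apply: le_trans (fle _) _; rewrite normrN.
exists f; split=> //; split=> //.
by exists 1 => v; rewrite mul1r.
Qed.

Lemma norm_le_dual (x : E) c :
  (forall f, normed_dual f -> (forall v, `|f v| <= `|v|) -> f x <= c) -> `|x| <= c.
Proof. by move=> H; have [f [fd fb <-]] := norming_functional x; exact: H. Qed.

Lemma normed_dualB (f : E -> R) v w : normed_dual f -> f (v - w) = f v - f w.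
Proof. by move=> [fL _]; rewrite addrC -scaleN1r fL mulN1r addrC. Qed.

Lemma dual_norm_ge0 (f : E -> R) : normed_dual f -> 0 <= dual_norm f.
Proof.
move=> [_ [k fk]]; apply: le_trans (normr_ge0 (f 0)) _; apply: ub_le_sup.
  exists `|k| => _ [w /= w1 <-]; apply: (le_trans (fk w)).
  apply: (le_trans (ler_norm _)); rewrite normrM normr_id.
  by rewrite ler_piMr.
by exists 0 => //=; rewrite normr0.
Qed.

(** The image ultrafilter clusters in the compact segment [[- k, k]], and a cluster point of an
    ultrafilter is a limit. *)
Lemma ultra_bounded_cvg (G : set_system nat) (u : nat -> R) k : UltraFilter G ->
  (forall i, `|u i| <= k) -> cvg (u i @[i --> G]).
Proof.
move=> GU uk; have GP := @ultra_proper _ _ GU.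
have /segment_compact : (u @ G) `[- k, k]%classic.
  by apply: (@filterE _ G) => i /=; rewrite in_itv/= -ler_norml; exact: uk.
move=> [p [_ pc]]; apply/cvg_ex; exists p => U Up.
have [//|GnU] := in_ultra_setVsetC (u @^-1` U) GU.
by have [z [zU zV]] := pc (~` U) U GnU Up.
Qed.

Definition weak_cvg (G : set_system nat) (x : nat -> E) (z : E) : Prop :=
  forall f, normed_dual f -> f (x i) @[i --> G] --> f z.

Lemma dual_norm_le (f : E -> R) (v : E) : normed_dual f ->
  `|f v| <= dual_norm f * `|v|.
Proof.
move=> [fL [c fc]].
have f0 : f 0 = 0 by have := fL (-1) 0 0; rewrite scaler0 addr0 => ?; lra.
have fZ a w : f (a *: w) = a * f w by have := fL a w 0; rewrite !addr0 f0 addr0.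
have [->|v0] := eqVneq v 0; first by rewrite f0 !normr0 mulr0.
rewrite -ler_pdivrMr ?normr_gt0//; apply: ub_le_sup.
  exists `|c| => _ [w /= w1 <-]; apply: (le_trans (fc w)).
  apply: (le_trans (ler_norm _)); rewrite normrM normr_id.
  by rewrite ler_piMr.
exists (`|v|^-1 *: v) => /=.
  by rewrite normrZ normfV normr_id mulVf// normr_eq0.
by rewrite fZ normrM normfV normr_id mulrC.
Qed.

(** Weak compactness without subsequences: the limits of [f (x i)] along [G] define a bounded
    functional on the dual, which is evaluation at a point by reflexivity. *)
Lemma weak_cvg_bounded (G : set_system nat) (x : nat -> E) c : UltraFilter G ->
  reflexive_space E -> (forall i, `|x i| <= c) -> exists z, weak_cvg G x z.
Proof.
move=> GU ER xc; have GP := @ultra_proper _ _ GU.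
have fx_cvg f : normed_dual f -> cvg (f (x i) @[i --> G]).
  move=> fd; apply: (@ultra_bounded_cvg _ _ (dual_norm f * c)) => // i.
  apply: (le_trans (dual_norm_le _ fd)); apply: ler_wpM2l => //.
  exact: dual_norm_ge0.
pose Phi (f : E -> R) : R := lim (f (x i) @[i --> G]).
have PhiB : normed_bidual Phi.
  split=> [a f g fd gd|].
    apply/cvg_lim => //; apply: cvgD; last exact: (fx_cvg g gd).
    by apply: cvgMr; exact: (fx_cvg f fd).
  exists c => f fd.
  have dn0 := dual_norm_ge0 fd.
  have H : \forall i \near G, `|f (x i)| <= c * dual_norm f.
    apply: filterE => i; apply: (le_trans (dual_norm_le _ fd)).
    by rewrite mulrC ler_wpM2r.
  have := fx_cvg f fd => /(cvg_norm) /cvgr_to_le; exact.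
have [z zP] := ER _ PhiB; exists z => f fd.
by rewrite -zP//; exact: fx_cvg.
Qed.

(** Weak lower semicontinuity of the norm, through a norming functional; this is what turns weak
    limits into norm estimates. *)
Lemma weak_cvg_norm_le (G : set_system nat) (x : nat -> E) z y d :
  ProperFilter G -> weak_cvg G x z ->
  (\forall i \near G, `|x i - y| <= d) -> `|z - y| <= d.
Proof.
move=> GP xz xd; apply: norm_le_dual => f fd f1.
have fB v w := normed_dualB v w fd.
have : f (x i - y) @[i --> G] --> f (z - y).
  by rewrite fB; under eq_cvg do rewrite fB; apply: cvgB; [exact: xz|exact: cvg_cst].
move=> /cvgr_to_le; apply; apply: filterS xd => i.
by apply: le_trans; apply: le_trans (f1 _); exact: ler_norm.
Qed.

Lemma weak_cvgB (G : set_system nat) (x y : nat -> E) a b :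
  ProperFilter G -> weak_cvg G x a -> weak_cvg G y b ->
  weak_cvg G (fun i => x i - y i) (a - b).
Proof.
move=> GP xa yb f fd.
have fB v w := normed_dualB v w fd.
by rewrite fB; under eq_cvg do rewrite fB; apply: cvgB; [exact: xa|exact: yb].
Qed.

End weak_limits.

(** * Antiderivatives of vector valued functions *)

(** An antiderivative in the form suited to Riemann sums: on short subintervals the increment is the
    length times the value at any tag, uniformly on [[a, b]]. The notion is preserved by bounded
    linear maps. *)
Definition antider (R : realType) (V : normedModType R) (u U : R -> V) : Prop :=
  forall a b eps : R, 0 < a -> 0 < eps ->
  exists2 delta, 0 < delta & forall t xi t', a <= t -> t <= xi -> xi <= t' ->
    t' <= b -> t' - t < delta ->
    `|U t' - U t - (t' - t) *: u xi| <= eps * (t' - t).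

Definition total_incr (R : realType) (V : normedModType R) (U : R -> V) (z : V) : Prop :=
  forall eps : R, 0 < eps ->
  exists a0 b0 : R, [/\ 0 < a0, 0 < b0 & forall a b : R, 0 < a -> a <= a0 -> b0 <= b ->
    `|U b - U a - z| <= eps].

Section antiderivatives.
Variables (R : realType) (V : normedModType R).
Implicit Types (u w U W : R -> V) (a b c r k : R) (z : V).

Lemma antider_ext u w U : (forall r : R, 0 < r -> u r = w r) -> antider u U -> antider w U.
Proof.
move=> uw uU a b eps a0 e0; have [d d0 H] := uU a b eps a0 e0.
exists d => // t xi t' at_ txi *; rewrite -uw; first exact: H.
by rewrite (lt_le_trans a0)// (le_trans at_).
Qed.

Lemma antiderD u w U W : antider u U -> antider w W ->
  antider (fun r => u r + w r) (fun r => U r + W r).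
Proof.
move=> uU wW a b eps a0 e0; have e20 : 0 < eps / 2 by rewrite divr_gt0.
have [d d0 H] := uU a b _ a0 e20; have [d' d'0 H'] := wW a b _ a0 e20.
exists (Num.min d d'); first by rewrite lt_min d0.
move=> t xi t' h1 h2 h3 h4; rewrite lt_min => /andP[h5 h6].
rewrite scalerDr !opprD (addrACA (U t')) (addrACA (U t' - U t)).
apply: (le_trans (ler_normD _ _)); rewrite [X in _ <= X * _]splitr mulrDl.
by apply: lerD; [exact: H|exact: H'].
Qed.

Lemma antider_comp (V' : normedModType R) (L : V -> V') c u U :
  linear L -> (forall v, `|L v| <= c * `|v|) ->
  antider u U -> antider (fun r => L (u r)) (fun r => L (U r)).
Proof.
move=> Ll Lc uU a b eps a0 e0.
have LB x y : L (x - y) = L x - L y by rewrite addrC -scaleN1r Ll scaleN1r addrC.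
have L0 : L 0 = 0 by rewrite -(subrr 0) LB subrr.
have LZ k x : L (k *: x) = k *: L x by rewrite -[k *: x]addr0 Ll L0 addr0.
have c0 : 0 < `|c| + 1 by rewrite ltr_wpDl.
have [d d0 H] := uU a b _ a0 (divr_gt0 e0 c0); exists d => // t xi t' h1 h2 h3 h4 h5.
rewrite -LZ -!LB; apply: (le_trans (Lc _)).
have := H _ _ _ h1 h2 h3 h4 h5; set N := `|_| => NH.
apply: (@le_trans _ _ ((`|c| + 1) * N)).
  by apply: ler_wpM2r; [exact: normr_ge0|rewrite (le_trans (ler_norm c))// lerDl].
rewrite mulrC -ler_pdivlMr//; apply: (le_trans NH).
by rewrite le_eqVlt; apply/orP; left; apply/eqP; ring.
Qed.

Lemma antiderZ k u U : antider u U -> antider (fun r => k *: u r) (fun r => k *: U r).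
Proof.
move=> uU; apply: (@antider_comp V (fun v => k *: v) `|k|) uU => [x y z|v].
  by rewrite scalerDr !scalerA mulrC.
by rewrite normrZ.
Qed.

Lemma antiderN u U : antider u U -> antider (fun r => - u r) (fun r => - U r).
Proof.
move=> /(antiderZ (-1)) H a b e a0 e0; have [d d0 Hd] := H a b e a0 e0.
by exists d => // t xi t' h1 h2 h3 h4 h5; have := Hd t xi t' h1 h2 h3 h4 h5; rewrite !scaleN1r.
Qed.

Lemma antiderB u w U W : antider u U -> antider w W ->
  antider (fun r => u r - w r) (fun r => U r - W r).
Proof. by move=> uU wW; apply: antiderD => //; exact: antiderN. Qed.

(* On a fine subdivision the mean value theorem provides tags [xi] at which   *)
(* the increment of [p] is [p' xi (t' - t)].                                  *)
Lemma antider_mean_value u U (p p' : R -> R) (a b : R) : antider u U ->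
  0 < a -> a <= b -> (forall r : R, 0 < r -> is_derive r 1 p (p' r)) ->
  (forall r : R, a <= r <= b -> `|u r| <= p' r) ->
  `|U b - U a| <= p b - p a.
Proof.
move=> uU a0; rewrite le_eqVlt => /predU1P[<- _ _|ab pD up].
  by rewrite !subrr normr0.
suff H (eps : R) : 0 < eps -> `|U b - U a| <= eps * (b - a) + (p b - p a).
  apply/ler_addgt0Pr => e e0; have ba : 0 < b - a by rewrite subr_gt0.
  have := H (e / (b - a)) (divr_gt0 e0 ba); rewrite divfK ?gt_eqF//; lra.
move=> e0; have [d d0 H] := uU a b eps a0 e0.
pose n := (Num.truncn ((b - a) / d)).+1.
have n0 : (0 < n%:R :> R) by rewrite ltr0n.
pose h := (b - a) / n%:R.
have h0 : 0 < h by rewrite divr_gt0// subr_gt0.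
have hd : h < d.
  rewrite ltr_pdivrMr// mulrC -ltr_pdivrMr//; exact: truncnS_gt.
have nh : n%:R * h = b - a by rewrite mulrC divfK// gt_eqF.
pose tt i : R := a + i%:R * h.
have tta i : a <= tt i by rewrite lerDl mulr_ge0// ltW.
have ttS i : tt i.+1 = tt i + h by rewrite /tt -natr1; ring.
have ttb i : (i <= n)%N -> tt i <= b.
  move=> in_; rewrite /tt -lerBrDl -nh ler_wpM2r ?ler_nat//; exact: ltW.
have main i : (i <= n)%N -> `|U (tt i) - U a| <= eps * (tt i - a) + (p (tt i) - p a).
  elim: i => [_|i IH i1]; first by rewrite /tt mul0r addr0 !subrr normr0 mulr0 addr0.
  have {}IH := IH (ltnW i1).
  have lt : tt i < tt i.+1 by rewrite ttS ltrDl.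
  have [xi] : exists2 c, c \in `[tt i, tt i.+1]%R &
      p (tt i.+1) - p (tt i) = p' c * (tt i.+1 - tt i).
    have posI c : c \in `[tt i, tt i.+1]%R -> 0 < c.
      by rewrite in_itv/= => /andP[+ _]; apply: lt_le_trans; rewrite (lt_le_trans a0).
    apply: MVT_segment; first exact: ltW.
      by move=> c /subset_itv_oo_cc cI; apply: pD; exact: posI.
    apply: derivable_within_continuous => c cI.
    by have [] := pD c (posI c cI).
  rewrite in_itv/= => /andP[x1 x2] pxi.
  have Hi := H (tt i) xi (tt i.+1) (tta i) x1 x2 (ttb _ i1).
  rewrite ttS addrAC subrr add0r in Hi; have {}Hi := Hi hd.
  rewrite -ttS in Hi; rewrite [X in _ = _ * (X - _)]ttS (addrAC (tt i)) subrr add0r in pxi.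
  have -> : U (tt i.+1) - U a = (U (tt i.+1) - U (tt i) - h *: u xi) + h *: u xi + (U (tt i) - U a).
    by rewrite subrK addrA subrK.
  apply: (le_trans (ler_normD _ _)).
  apply: (@le_trans _ _ (eps * h + p' xi * h + (eps * (tt i - a) + (p (tt i) - p a)))).
    apply: lerD => //; apply: (le_trans (ler_normD _ _)); apply: lerD => //.
    rewrite normrZ gtr0_norm// mulrC; apply: ler_wpM2r; first exact: ltW.
    by rewrite up// (le_trans (tta i) x1) (le_trans x2)// ttb.
  by rewrite -pxi ttS; lra.
have := main n (leqnn n); have -> // : tt n = b.
by rewrite /tt nh addrC subrK.
Qed.

Lemma antider_lip u U (c a b : R) : antider u U -> 0 < a -> a <= b ->
  (forall r : R, a <= r <= b -> `|u r| <= c) -> `|U b - U a| <= c * (b - a).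
Proof.
move=> uU a0 ab uc; rewrite mulrBr.
apply: (@antider_mean_value u U (fun r => c * r) (fun=> c)) => // r _.
by rewrite -[X in is_derive _ _ _ X]mulr1; exact: is_deriveZ.
Qed.

Lemma antider_unique u U W (a b : R) : antider u U -> antider u W -> 0 < a -> 0 < b ->
  U b - U a = W b - W a.
Proof.
wlog ab : a b / a <= b => [H uU uW a0 b0|uU uW a0 _].
  have [ab|/ltW ba] := leP a b; first exact: H.
  by rewrite -[LHS]opprB -[RHS]opprB; congr (- _); exact: H.
have := @antider_lip _ _ 0 a b (antiderB uU uW) a0 ab.
rewrite mul0r normr_le0 subr_eq0 => H.
have /eqP e : U b - W b == U a - W a by apply: H => r _; rewrite subrr normr0.
by rewrite -[U b](subrK (W b)) e addrAC [U a - W a]addrC addrK addrC.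
Qed.

(** The improper integral depends on the integrand alone. Linearity, commutation and equality of the
    operators of the calculus are all deduced from this. *)
Lemma total_incr_unique u U W z (w : V) : antider u U -> antider u W ->
  total_incr U z -> total_incr W w -> z = w.
Proof.
move=> uU uW Uz Ww; apply/eqP; rewrite -subr_eq0 -normr_le0.
apply/ler_addgt0Pr => e e0; rewrite add0r; have e20 : 0 < e / 2 by rewrite divr_gt0.
have [a1 [b1 [a10 b10 H1]]] := Uz _ e20; have [a2 [b2 [a20 b20 H2]]] := Ww _ e20.
have a0 : 0 < Num.min a1 a2 by rewrite lt_min a10.
have b0 : 0 < Num.max b1 b2 by rewrite lt_max b10.
have h1 := H1 (Num.min a1 a2) (Num.max b1 b2) a0.
have h2 := H2 (Num.min a1 a2) (Num.max b1 b2) a0.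
rewrite !ge_min !le_max !lexx ?orbT in h1 h2.
have {}h1 := h1 isT isT; have {}h2 := h2 isT isT.
rewrite -(antider_unique uU uW a0 b0) in h2.
rewrite distrC in h1; apply: (le_trans (ler_distD (U (Num.max b1 b2) - U (Num.min a1 a2)) _ _)).
by rewrite [leRHS]splitr lerD.
Qed.

Lemma total_incrD U W z (w : V) : total_incr U z -> total_incr W w ->
  total_incr (fun r => U r + W r) (z + w).
Proof.
move=> Uz Ww e e0; have e20 : 0 < e / 2 by rewrite divr_gt0.
have [a1 [b1 [a10 b10 H1]]] := Uz _ e20; have [a2 [b2 [a20 b20 H2]]] := Ww _ e20.
exists (Num.min a1 a2), (Num.max b1 b2); split; rewrite ?lt_min ?lt_max ?a10 ?b10//.
move=> a b a0; rewrite le_min ge_max => /andP[aa1 aa2] /andP[bb1 bb2].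
rewrite !opprD (addrACA (U b)) (addrACA (U b - U a)) [leRHS]splitr.
by apply: (le_trans (ler_normD _ _)); apply: lerD; [exact: H1|exact: H2].
Qed.

Lemma total_incr_comp (V' : normedModType R) (L : V -> V') c U z :
  linear L -> (forall v, `|L v| <= c * `|v|) -> total_incr U z ->
  total_incr (fun r => L (U r)) (L z).
Proof.
move=> Ll Lc Uz e e0.
have LB x y : L (x - y) = L x - L y by rewrite addrC -scaleN1r Ll scaleN1r addrC.
have c0 : 0 < `|c| + 1 by rewrite ltr_wpDl.
have [a1 [b1 [a10 b10 H1]]] := Uz _ (divr_gt0 e0 c0).
exists a1, b1; split=> // a b a0 aa1 bb1; rewrite -!LB; apply: (le_trans (Lc _)).
have := H1 a b a0 aa1 bb1; rewrite ler_pdivlMr// => h; apply: le_trans h.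
rewrite mulrC; apply: ler_wpM2l => //.
by rewrite (le_trans (ler_norm c))// lerDl.
Qed.

Lemma total_incrZ k U z : total_incr U z -> total_incr (fun r => k *: U r) (k *: z).
Proof.
apply: (@total_incr_comp V (fun v => k *: v) `|k|) => [x y w|v].
  by rewrite scalerDr !scalerA mulrC.
by rewrite normrZ.
Qed.

Lemma total_incrN U z : total_incr U z -> total_incr (fun r => - U r) (- z).
Proof.
move=> /(total_incrZ (-1)) H e e0; have [a1 [b1 [? ? H1]]] := H _ e0.
exists a1, b1; split=> // a b a0 aa1 bb1; have := H1 a b a0 aa1 bb1.
by rewrite !scaleN1r.
Qed.

Lemma total_incrB U W z (w : V) : total_incr U z -> total_incr W w ->
  total_incr (fun r => U r - W r) (z - w).
Proof. by move=> Uz Ww; apply: total_incrD => //; exact: total_incrN. Qed.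

End antiderivatives.

(** Ensures that the condition in [is_integral] is tested by some partition, whence the uniqueness
    of integrals. *)
Lemma fine_partition_ex (R : realType) (d : R) : 0 < d -> forall (a b : R), a < b ->
  exists2 t, itv_partition a b t &
    forall i, (i < size t)%N -> nth 0 t i - nth 0 (a :: t) i < d.
Proof.
move=> d0 a b ab; have d20 : 0 < d / 2 by rewrite divr_gt0.
have [N] : exists N : nat, b - a < N%:R * (d / 2).
  exists (Num.truncn ((b - a) / (d / 2))).+1.
  by rewrite -ltr_pdivrMr//; exact: truncnS_gt.
elim: N a ab => [a ab|N IH a ab bN].
  by rewrite mul0r subr_lt0 ltNge (ltW ab).
have [bad|bad] := ltP (b - a) d.
  exists [:: b]; first by split; rewrite /= ?ab//.
  by case.
have ab' : a + d / 2 < b by lra.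
have [|t [tp tl] td] := IH (a + d / 2) ab'.
  by move: bN; rewrite -natr1; lra.
exists (a + d / 2 :: t).
  by split=> //=; rewrite ltrDl d20.
move=> [|i] /=; first by move=> _; lra.
by rewrite ltnS; exact: td.
Qed.

Lemma addr_chain (V : zmodType) (c x l a s : V) :
  (x - c - a) + (l - x - s) = l - c - (a + s).
Proof.
rewrite opprD [LHS]addrACA; congr (_ + _).
by rewrite [LHS]addrC [LHS]addrA subrK.
Qed.

Section operator_antiderivatives.
Variables (R : realType) (n : nat) (E : normedModType R).
Local Notation V := (cliff_mod n E).
Implicit Types (F U : R -> V -> V) (B I : V -> V).

(** Here [delta] is uniform in the vector, as the operator norm convergence in [is_integral]
    demands. *)
Definition op_antider F U : Prop := forall a b eps : R, 0 < a -> 0 < eps ->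
  exists2 delta, 0 < delta & forall t xi t', a <= t -> t <= xi -> xi <= t' ->
    t' <= b -> t' - t < delta ->
    opnorm_le (fun v => U t' v - U t v - (t' - t) *: F xi v) (eps * (t' - t)).

Definition op_total_incr U B : Prop := forall eps : R, 0 < eps ->
  exists a0 b0 : R, [/\ 0 < a0, 0 < b0 & forall a b : R, 0 < a -> a <= a0 ->
    b0 <= b -> opnorm_le (fun v => U b v - U a v - B v) eps].

Lemma op_antider_at F U v : op_antider F U -> antider (F^~ v) (U^~ v).
Proof.
move=> FU a b eps a0 e0; have v0 : 0 < `|v| + 1 by rewrite ltr_wpDl.
have [d d0 H] := FU a b _ a0 (divr_gt0 e0 v0); exists d => //.
move=> t xi t' h1 h2 h3 h4 h5; apply: (le_trans (H t xi t' h1 h2 h3 h4 h5 v)).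
rewrite mulrAC; apply: ler_wpM2r; first by rewrite subr_ge0 (le_trans h2).
by rewrite mulrAC ler_pdivrMr// ler_wpM2l ?lerDl// ltW.
Qed.

Lemma op_total_incr_at U B v : op_total_incr U B -> total_incr (U^~ v) (B v).
Proof.
move=> UB e e0; have v0 : 0 < `|v| + 1 by rewrite ltr_wpDl.
have [a0 [b0 [a00 b00 H]]] := UB _ (divr_gt0 e0 v0); exists a0, b0; split=> //.
move=> a b ap aa bb; apply: (le_trans (H a b ap aa bb v)).
by rewrite mulrAC ler_pdivrMr// ler_wpM2l ?lerDl// ltW.
Qed.

Lemma opnorm_leD B I c c' : opnorm_le B c -> opnorm_le I c' ->
  opnorm_le (fun v => B v + I v) (c + c').
Proof. by move=> Bc Ic v; rewrite mulrDl; apply: le_trans (ler_normD _ _) (lerD (Bc v) (Ic v)). Qed.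

Lemma opnorm_leW B (c c' : R) : c <= c' -> opnorm_le B c -> opnorm_le B c'.
Proof. by move=> cc Bc v; apply: (le_trans (Bc v)); rewrite ler_wpM2r. Qed.

Lemma op_antider_integral F U (a b : R) : op_antider F U -> 0 < a -> a < b ->
  is_integral F a b (fun v => U b v - U a v).
Proof.
move=> FU a0 ab eps eps0; have ba : 0 < b - a by rewrite subr_gt0.
have [d d0 H] := FU a b _ a0 (divr_gt0 eps0 ba); exists d => // t xi [[tp /eqP tl] tx].
(* Partitions starting at any [c >= a] are allowed, for the induction on the list of nodes; the
   errors of the cells add up proportionally to their lengths. *)
suff main : forall (s : seq R) c (y : nat -> R), a <= c -> path <%R c s ->
    last c s <= b ->
    (forall i, (i < size s)%N -> nth 0 (c :: s) i <= y i <= nth 0 s i /\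
      nth 0 s i - nth 0 (c :: s) i < d) ->
    opnorm_le (fun v => U (last c s) v - U c v - riemann_sum F c s y v)
      (eps / (b - a) * (last c s - c)).
  have := main t a xi (lexx _) tp; rewrite tl => /(_ (lexx _) tx).
  by rewrite divfK ?gt_eqF// => h v; rewrite /= distrC.
elim=> [c y ac _ _ _ v|x s IH c y ac /= /andP[cx sp] sb Hs v].
  by rewrite /riemann_sum /= big_ord0 !subrr normr0 mulr0 mul0r.
have xb : x <= b.
  apply: le_trans sb; move: sp; rewrite lt_path_sortedE => /andP[/allP xs _].
  have := mem_last x s; rewrite inE => /predU1P[->//|/xs]; exact: ltW.
have [/andP[y1 y2] y3] := Hs 0%N isT.
have h1 := H c (y 0%N) x ac y1 y2 xb y3.
have h2 := IH x (fun i => y i.+1) (le_trans ac (ltW cx)) sp sb (fun i => Hs i.+1).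
have := opnorm_leD h1 h2 => /(_ v).
rewrite /= /riemann_sum /= big_ord_recl /= -mulrDr addr_chain.
by rewrite [X in _ * X * _](_ : _ = last x s - c)//; ring.
Qed.

Lemma is_integral_unique F (a b : R) B I : a < b ->
  is_integral F a b B -> is_integral F a b I -> B = I.
Proof.
move=> ab FB FI; apply/funext => v; apply/eqP; rewrite -subr_eq0 -normr_le0.
apply/ler_addgt0Pr => e e0; rewrite add0r.
have v0 : 0 < 2 * (`|v| + 1) by rewrite mulr_gt0// ltr_wpDl.
have ev := divr_gt0 e0 v0.
have [d1 d10 H1] := FB _ ev; have [d2 d20 H2] := FI _ ev.
have d0 : 0 < Num.min d1 d2 by rewrite lt_min d10.
have [t [tp tl] td] := fine_partition_ex d0 ab.
have tag d : Num.min d1 d2 <= d -> tagged_partition a b d t (nth 0 t).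
  move=> dd; split=> // i it; split; last exact: lt_le_trans (td i it) dd.
  by rewrite lexx andbT ltW//; have /(pathP 0) := tp; exact.
have h1 := H1 _ _ (tag d1 _) v; have h2 := H2 _ _ (tag d2 _) v.
rewrite !ge_min !lexx orbT in h1 h2; have {}h1 := h1 isT; have {}h2 := h2 isT.
rewrite /= in h1 h2.
rewrite distrC in h1.
apply: (le_trans (ler_distD (riemann_sum F a t (nth 0 t) v) _ _)).
apply: (le_trans (lerD h1 h2)); rewrite -mulrDl -mulr2n -[_ *+ 2]mulr_natl.
have -> : 2 * (e / (2 * (`|v| + 1))) * `|v| = e * (`|v| / (`|v| + 1)).
  by field; rewrite gt_eqF// ltr_wpDl.
rewrite ger_pMr// ler_pdivrMr ?ltr_wpDl// mul1r lerDl//.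
Qed.

Lemma is_improper_integral_total F U B : op_antider F U -> op_total_incr U B ->
  is_improper_integral F B.
Proof.
move=> FU UB eps e0; have [a0 [b0 [a00 b00 H]]] := UB _ e0.
have Ha : \forall a \near (0 : R)^'+, 0 < a /\ a <= Num.min a0 1.
  by near=> a; split=> //; near: a; apply: nbhs_right_le; rewrite lt_min a00/=.
have Hb : \forall b \near (+oo : set_system R), b0 <= b /\ 1 < b.
  by near=> b; split; near: b; [apply: nbhs_pinfty_ge|apply: nbhs_pinfty_gt];
    rewrite num_real.
exists ([set a | 0 < a /\ a <= Num.min a0 1], [set b | b0 <= b /\ 1 < b]).
  by split.
move=> [a b] [/= [ap]]; rewrite le_min => /andP[aa a1] [bb b1].
exists (fun v => U b v - U a v).
  by apply: op_antider_integral => //; exact: le_lt_trans b1.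
exact: H.
Unshelve. all: by end_near. Qed.

(** [improper_integral] chooses some limit. Two limits agree because on a common [[a, b]] both are
    close to the same integral. *)
Lemma improper_integral_total F U B : op_antider F U -> op_total_incr U B ->
  improper_integral F = B.
Proof.
move=> FU UB; rewrite /improper_integral.
have FB := is_improper_integral_total FU UB.
case: xgetP => [B' _ FB'|/(_ B)//].
apply/funext => v; apply/eqP; rewrite -subr_eq0 -normr_le0.
apply/ler_addgt0Pr => e e0; rewrite add0r.
have v0 : 0 < 2 * (`|v| + 1) by rewrite mulr_gt0// ltr_wpDl.
have ev := divr_gt0 e0 v0.
have [[A1 A2] /= [A1n A2n] HA] := filterI (FB _ ev) (FB' _ ev).
have [a [b [a0 ab A1a A2b]]] : exists a b : R, [/\ 0 < a, a < b, A1 a & A2 b].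
  near (0 : R)^'+ => a; near (+oo : set_system R) => b.
  exists a, b; split; [by []|near: b|near: a|near: b] => //.
  by apply: nbhs_pinfty_gt; rewrite num_real.
have /= [[I FI IB] [I' FI' IB']] := HA (a, b) (conj A1a A2b).
have II := is_integral_unique ab FI' FI; rewrite {}II in IB'.
have h1 := IB v; have h2 := IB' v; rewrite /= in h1 h2.
rewrite distrC in h2.
apply: (le_trans (ler_distD (I v) _ _)).
apply: (le_trans (lerD h2 h1)); rewrite -mulrDl -mulr2n -[_ *+ 2]mulr_natl.
have -> : 2 * (e / (2 * (`|v| + 1))) * `|v| = e * (`|v| / (`|v| + 1)).
  by field; rewrite gt_eqF// ltr_wpDl.
rewrite ger_pMr// ler_pdivrMr ?ltr_wpDl// mul1r lerDl//.
Unshelve. all: by end_near. Qed.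

Lemma op_antider_mean_value F U (p p' : R -> R) a b : op_antider F U ->
  0 < a -> a <= b -> (forall r : R, 0 < r -> is_derive r 1 p (p' r)) ->
  (forall r, a <= r <= b -> opnorm_le (F r) (p' r)) ->
  opnorm_le (fun v => U b v - U a v) (p b - p a).
Proof.
move=> FU a0 ab pD Fp v; rewrite mulrC mulrBr.
apply: (antider_mean_value (p := fun r => `|v| * p r) (p' := fun r => `|v| * p' r)
   (op_antider_at v FU)) => // [r r0|r /Fp Fr]; last by rewrite mulrC.
have := pD r r0 => pd; exact: is_deriveZ.
Qed.

End operator_antiderivatives.

(** * Existence of integrals in a reflexive space *)

Section existence.
Variables (R : realType) (n : nat) (E : normedModType R).
Local Notation V := (cliff_mod n E).
Hypothesis V_reflexive : reflexive_space V.
Implicit Types (F U : R -> V -> V) (B I : V -> V).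

Definition op_continuous F : Prop := forall a b eps : R, 0 < a -> 0 < eps ->
  exists2 delta, 0 < delta & forall r r', a <= r <= b -> a <= r' <= b ->
    `|r - r'| < delta -> opnorm_le (fun v => F r v - F r' v) eps.

Definition op_bounded F : Prop := forall a b : R, 0 < a ->
  exists M : R, forall r, a <= r <= b -> opnorm_le (F r) M.

Definition grid_sum F (N k : nat) (v : V) : V :=
  \sum_(0 <= i < k) (N.+1%:R^-1 : R) *: F (i.+1%:R / N.+1%:R) v.

(** Both sums start at 0, so the common terms cancel and the difference approximates the integral
    from 1 to [t], with the right sign also when [t < 1]. *)
Definition grid_integral F (N : nat) (t : R) (v : V) : V :=
  grid_sum F N (Num.truncn (N.+1%:R * t)) v - grid_sum F N N.+1 v.

Lemma grid_integral1 F N v : grid_integral F N 1 v = 0.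
Proof. by rewrite /grid_integral mulr1 natrK subrr. Qed.

(** Each grid node between [t] and [t'] contributes an error of at most [e] times the step, and the
    number of nodes misses [t' - t] by at most one step; hence the term in [1 / (N + 1)]. *)
Lemma grid_integral_le F N (t t' e : R) (v c : V) : 0 < t -> t <= t' -> 0 <= e ->
  (forall r, t <= r <= t' -> `|F r v - c| <= e) ->
  `|grid_integral F N t' v - grid_integral F N t v - (t' - t) *: c| <=
    e * (t' - t) + (e + `|c|) / N.+1%:R.
Proof.
move=> t0 tt' e0 Fe; have t'0 := lt_le_trans t0 tt'.
have N0 : (0 < N.+1%:R :> R) by rewrite ltr0n.
set k := Num.truncn (N.+1%:R * t); set k' := Num.truncn (N.+1%:R * t').
have kk' : (k <= k')%N.
  by apply: le_truncn; rewrite ler_wpM2l// ltW.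
have /andP[k1 k2] := truncn_itv (mulr_ge0 (ltW N0) (ltW t0)).
have /andP[k'1 k'2] := truncn_itv (mulr_ge0 (ltW N0) (ltW t'0)).
rewrite -/k in k1 k2; rewrite -/k' in k'1 k'2.
have dk : (k' - k)%N%:R = k'%:R - k%:R :> R by rewrite natrB.
rewrite /grid_integral -/k -/k' opprB addrA subrK.
have -> : grid_sum F N k' v - grid_sum F N k v =
    \sum_(k <= i < k') (N.+1%:R^-1 : R) *: F (i.+1%:R / N.+1%:R) v.
  by rewrite /grid_sum (big_cat_nat (leq0n k) kk')/= addrAC subrr add0r.
have -> : \sum_(k <= i < k') (N.+1%:R^-1 : R) *: F (i.+1%:R / N.+1%:R) v
    - (t' - t) *: c =
  \sum_(k <= i < k') (N.+1%:R^-1 : R) *: (F (i.+1%:R / N.+1%:R) v - c) +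
  ((k'%:R - k%:R) / N.+1%:R - (t' - t)) *: c.
  under [in RHS]eq_bigr do rewrite scalerBr.
  rewrite sumrB sumr_const_nat -(scaler_nat (k' - k) (_ *: c)) scalerA dk -addrA; congr (_ + _).
  by rewrite [in RHS]scalerBl addrA addNr add0r.
apply: (le_trans (ler_normD _ _)).
have h1 : `|(k'%:R - k%:R) / N.+1%:R - (t' - t)| <= N.+1%:R^-1.
  rewrite -[t' - t](mulfK (lt0r_neq0 N0)) -mulrBl normrM normfV (gtr0_norm N0).
  apply: ler_piMl; [by rewrite invr_ge0 ltW|rewrite ler_norml].
  have -> : (t' - t) * N.+1%:R = N.+1%:R * t' - N.+1%:R * t by ring.
  move: k2 k'2; rewrite -!natr1; lra.
have h2 : `|\sum_(k <= i < k') (N.+1%:R^-1 : R) *: (F (i.+1%:R / N.+1%:R) v - c)| <=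
    (k'%:R - k%:R) / N.+1%:R * e.
  apply: (le_trans (ler_norm_sum _ _ _)).
  have -> : (k'%:R - k%:R) / N.+1%:R * e = \sum_(k <= i < k') (N.+1%:R^-1 * e).
    by rewrite sumr_const_nat -(mulr_natl (_ * e)) dk mulrA.
  rewrite big_nat [leRHS]big_nat; apply: ler_sum => i /andP[ki ik'].
  rewrite normrZ gtr0_norm ?invr_gt0//; apply: ler_wpM2l; first by rewrite invr_ge0 ltW.
  apply: Fe; rewrite ler_pdivlMr// ler_pdivrMr// ![_ * N.+1%:R]mulrC.
  apply/andP; split; first by rewrite (le_trans (ltW k2))// ler_nat.
  by apply: le_trans k'1; rewrite ler_nat.
have h3 : (k'%:R - k%:R) / N.+1%:R <= t' - t + N.+1%:R^-1.
  by rewrite -lerBlDl; exact: le_trans (ler_norm _) h1.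
have h4 := ler_wpM2r e0 h3.
rewrite normrZ; have h5 := ler_wpM2r (normr_ge0 c) h1.
apply: (le_trans (lerD (le_trans h2 h4) h5)).
by rewrite le_eqVlt; apply/orP; left; apply/eqP; ring.
Qed.

(** Comparison with [c = 0] bounds the grid integrals in [N], so they have weak limits along an
    ultrafilter. Comparison with [c = F xi v] passes to the limit and gives the antiderivative
    estimate. *)
Lemma op_antider_ex F : op_continuous F -> op_bounded F -> exists U, op_antider F U.
Proof.
move=> Fc Fb; have [G [GU Goo]] := @ultraFilterLemma nat \oo _.
have GP := @ultra_proper _ _ GU.
have bnd t v : 0 < t -> exists c, forall N, `|grid_integral F N t v| <= c.
  move=> t0; have [|M HM] := Fb (Num.min t 1) (Num.max t 1).
    by rewrite lt_min t0 ltr01.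
  have {}HM : exists M' : R, 0 <= M' /\ forall r, Num.min t 1 <= r <= Num.max t 1 ->
      `|F r v - 0| <= M'.
    exists (`|M| * `|v|); split; first by rewrite mulr_ge0.
    move=> r rI; rewrite subr0; apply: (le_trans (HM r rI v)).
    by rewrite ler_wpM2r// ler_norm.
  have [M' [M'0 H]] := HM; exists (M' * (`|t - 1| + 1)) => N.
  have N1 : (N.+1%:R^-1 <= 1 :> R) by rewrite invf_le1 ?ltr0n// ler1n.
  have [t1|/ltW t1] := leP t 1.
    rewrite (min_idPl t1) (max_idPr t1) in H.
    have := grid_integral_le N t0 t1 M'0 H.
    rewrite grid_integral1 sub0r scaler0 subr0 normrN normr0 addr0 => /le_trans; apply.
    rewrite [leRHS]mulrDr mulr1; apply: lerD; last by rewrite ler_piMr.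
    by rewrite ler_wpM2l// distrC ler_norm.
  rewrite (min_idPr t1) (max_idPl t1) in H.
  have := grid_integral_le N ltr01 t1 M'0 H.
  rewrite grid_integral1 subr0 scaler0 subr0 normr0 addr0 => /le_trans; apply.
  rewrite [leRHS]mulrDr mulr1; apply: lerD; last by rewrite ler_piMr.
  by rewrite ler_wpM2l// ler_norm.
have /choice[W HW] : forall p : R * V, exists z, 0 < p.1 ->
    weak_cvg G (fun N => grid_integral F N p.1 p.2) z.
  move=> [t v] /=; have [t0|t0] := ltP 0 t; last by exists 0.
  have [c Hc] := bnd t v t0.
  by have [z Hz] := weak_cvg_bounded GU V_reflexive Hc; exists z.
exists (fun t v => W (t, v)) => a b eps a0 e0.
have [d d0 Hd] := Fc a b eps a0 e0; exists d => // t xi t' at_ txi xit t'b tt'd v.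
have t0 := lt_le_trans a0 at_; have tt' := le_trans txi xit.
have t'0 := lt_le_trans t0 tt'.
apply/ler_addgt0Pr => eta eta0.
pose K := eps * `|v| + `|F xi v|.
have K0 : 0 <= K by rewrite addr_ge0// mulr_ge0// ltW.
apply: (weak_cvg_norm_le (G := G)); first exact: weak_cvgB (HW (t', v) t'0) (HW (t, v) t0).
have : G [set N | (Num.truncn (K / eta) <= N)%N] by apply: Goo; exact: nbhs_infty_ge.
apply: filterS => N /= KN.
apply: (@le_trans _ _ (eps * `|v| * (t' - t) + K / N.+1%:R)).
  apply: grid_integral_le => //; first by rewrite mulr_ge0// ltW.
  move=> r /andP[tr rt']; apply: Hd.
  - by rewrite (le_trans at_ tr) (le_trans rt').
  - by rewrite (le_trans at_ txi) (le_trans xit).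
  by apply: le_lt_trans tt'd; rewrite ler_norml; lra.
apply: lerD; first by rewrite mulrAC.
rewrite ler_pdivrMr ?ltr0n// mulrC -ler_pdivrMr//.
by apply: ltW; apply: (lt_le_trans (truncnS_gt _)); rewrite ler_nat.
Qed.

(** The increments of [p] dominate those of [U] in operator norm. The increments over
    [[1 / (N + 1), N + 1]] are thus bounded and have a weak limit [B]; the small tails of [p] make
    the convergence uniform on the unit ball. *)
Lemma op_total_incr_ex F U (p p' : R -> R) c : op_antider F U ->
  (forall r : R, 0 < r -> is_derive r 1 p (p' r)) ->
  (forall r, 0 < r -> opnorm_le (F r) (p' r)) ->
  (forall r, 0 < r -> `|p r| <= c) ->
  (forall eps : R, 0 < eps -> exists a0 b0 : R, [/\ 0 < a0, 0 < b0,
    forall a a', 0 < a -> a <= a' -> a' <= a0 -> p a' - p a <= eps &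
    forall b b', b0 <= b -> b <= b' -> p b' - p b <= eps]) ->
  exists B, op_total_incr U B.
Proof.
move=> FU pD Fp pc plim; have [G [GU Goo]] := @ultraFilterLemma nat \oo _.
have GP := @ultra_proper _ _ GU.
have mv a b v : 0 < a -> a <= b -> `|U b v - U a v| <= (p b - p a) * `|v|.
  move=> a0 ab; apply: (op_antider_mean_value FU a0 ab pD _ v).
  by move=> r /andP[ar _]; apply: Fp; exact: lt_le_trans ar.
have c0 : 0 <= c by apply: le_trans (pc 1 ltr01).
pose x N v : V := U N.+1%:R v - U N.+1%:R^-1 v.
have N1 N : (N.+1%:R^-1 <= N.+1%:R :> R).
  by rewrite (@le_trans _ _ 1)// ?ler1n// invf_le1 ?ltr0n// ler1n.
have xb v N : `|x N v| <= (c + c) * `|v|.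
  apply: (le_trans (mv _ _ v _ (N1 N))); first by rewrite invr_gt0 ltr0n.
  rewrite ler_wpM2r//.
  have /ler_normlP[_ h1] := pc N.+1%:R (ltr0n _ _).
  have /ler_normlP[h2 _] : `|p N.+1%:R^-1| <= c by apply: pc; rewrite invr_gt0 ltr0n.
  exact: lerD.
have /choice[B HB] : forall v, exists z, weak_cvg G (x^~ v) z.
  by move=> v; exact: weak_cvg_bounded GU V_reflexive (xb v).
exists B => e e0; have e20 : 0 < e / 2 by rewrite divr_gt0.
have [a0 [b0 [a00 b00 Ha Hb]]] := plim _ e20; exists a0, b0; split=> //.
move=> a b ap aa bb v; rewrite distrC.
apply: (weak_cvg_norm_le GP (HB v)).
have b0' := lt_le_trans b00 bb.
have : G [set N | (Num.truncn b <= N)%N /\ (Num.truncn a^-1 <= N)%N].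
  by apply: filterI; apply: Goo; exact: nbhs_infty_ge.
apply: filterS => N /= [bN aN].
have bN' : b <= N.+1%:R.
  by apply: ltW; apply: (lt_le_trans (truncnS_gt _)); rewrite ler_nat.
have aN' : N.+1%:R^-1 <= a.
  rewrite invf_ple ?posrE ?ltr0n//.
  by apply: ltW; apply: (lt_le_trans (truncnS_gt _)); rewrite ler_nat.
have -> : x N v - (U b v - U a v) = (U N.+1%:R v - U b v) + (U a v - U N.+1%:R^-1 v).
  by rewrite /x opprB addrACA [RHS]addrACA; congr (_ + _); rewrite addrC.
apply: (le_trans (ler_normD _ _)); rewrite [leRHS](_ : _ = e / 2 * `|v| + e / 2 * `|v|); last first.
  by rewrite -mulrDl -splitr.
have Ni0 : 0 < N.+1%:R^-1 :> R by rewrite invr_gt0 ltr0n.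
apply: lerD; (apply: (le_trans (mv _ _ v _ _)) => //; rewrite ler_wpM2r//).
  exact: Hb.
exact: Ha.
Qed.

End existence.

(** * Commutative algebra of the resolvents *)

(* The square-zero extension of R by a module V is a commutative ring: this    *)
(* lets [ring] decide identities in V.                                         *)
Section square_zero_extension.
Variables (R : comPzRingType) (V : lmodType R).

Definition sqz : Type := (R * V)%type.
HB.instance Definition _ := GRing.Zmodule.copy sqz (R * V)%type.
Implicit Types z w : sqz.

Definition sqz_mul z w : sqz := (z.1 * w.1, z.1 *: w.2 + w.1 *: z.2).

Let sqz_mulA : associative sqz_mul.
Proof.
move=> [a u] [b v] [c w]; congr pair => /=; first exact: mulrA.
by rewrite !scalerDr !scalerA addrA mulrC (mulrC c b) (mulrC c a) (mulrC b a).
Qed.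

Let sqz_mulC : commutative sqz_mul.
Proof. by move=> [a u] [b v]; congr pair => /=; [exact: mulrC|exact: addrC]. Qed.

Let sqz_mul1 : left_id (1, 0) sqz_mul.
Proof.
by move=> [a u]; congr pair => /=; rewrite ?mul1r// scale1r scaler0 addr0.
Qed.

Let sqz_mulDl : left_distributive sqz_mul +%R.
Proof.
move=> [a u] [b v] [c w]; congr pair => /=; first exact: mulrDl.
by rewrite scalerDl scalerDr addrACA.
Qed.

HB.instance Definition _ := GRing.Zmodule_isComPzRing.Build sqz
  sqz_mulA sqz_mulC sqz_mul1 sqz_mulDl.

Definition sqz_vec (v : V) : sqz := (0, v).
Definition sqz_cst (k : R) : sqz := (k, 0).

Let sqz_vec_additive : zmod_morphism sqz_vec.
Proof. by move=> u v; congr pair; rewrite subr0. Qed.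
HB.instance Definition _ := GRing.isZmodMorphism.Build V sqz sqz_vec sqz_vec_additive.

Let sqz_cst_additive : zmod_morphism sqz_cst.
Proof. by move=> u v; congr pair; rewrite subr0. Qed.
Let sqz_cst_multiplicative : monoid_morphism sqz_cst.
Proof. by split=> // u v; congr pair => /=; rewrite !scaler0 addr0. Qed.
HB.instance Definition _ := GRing.isZmodMorphism.Build R sqz sqz_cst sqz_cst_additive.
HB.instance Definition _ := GRing.isMonoidMorphism.Build R sqz sqz_cst sqz_cst_multiplicative.

Lemma sqz_vec_inj : injective sqz_vec. Proof. by move=> u v []. Qed.
Lemma sqz_vecZ k v : sqz_vec (k *: v) = sqz_cst k * sqz_vec v.
Proof. by congr pair => /=; rewrite ?mulr0// scale0r addr0. Qed.
Lemma sqz_vecD u v : sqz_vec (u + v) = sqz_vec u + sqz_vec v. Proof. exact: raddfD. Qed.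
Lemma sqz_vecN u : sqz_vec (- u) = - sqz_vec u. Proof. exact: raddfN. Qed.
Definition sqz_vecE := (sqz_vecZ, sqz_vecD, sqz_vecN).

End square_zero_extension.

Ltac module := apply: sqz_vec_inj; rewrite ?sqz_vecE; ring.

(** [A[i]] with [i^2 = -1]. Over the reals it models every plane C_J; over an algebra of operators
    it holds the resolvents, with a unit [i] that commutes with them, as left multiplication by [J]
    need not do. *)
Definition cplx (A : comPzRingType) : Type := (A * A)%type.

Section cplx_ring.
Variable A : comPzRingType.
Implicit Types z w : cplx A.

HB.instance Definition _ := GRing.Zmodule.copy (cplx A) (A * A)%type.

Definition re z : A := z.1.
Definition im z : A := z.2.
Definition cmul z w : cplx A := (re z * re w - im z * im w, re z * im w + im z * re w).

Let cmulA : associative cmul.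
Proof. by move=> [a b] [c d] [e f]; congr pair; rewrite /re /im /=; ring. Qed.

Let cmulC : commutative cmul.
Proof. by move=> [a b] [c d]; congr pair; rewrite /re /im /=; ring. Qed.

Let cmul1 : left_id (1, 0) cmul.
Proof. by move=> [a b]; congr pair; rewrite /re /im /=; ring. Qed.

Let cmulDl : left_distributive cmul +%R.
Proof. by move=> [a b] [c d] [e f]; congr pair; rewrite /re /im /=; ring. Qed.

HB.instance Definition _ := GRing.Zmodule_isComPzRing.Build (cplx A)
  cmulA cmulC cmul1 cmulDl.

Definition conjc z : cplx A := (re z, - im z).
Definition creal (a : A) : cplx A := (a, 0).

Lemma cplx_eq z w : re z = re w -> im z = im w -> z = w.
Proof. by case: z w => [a b] [c d] /= -> ->. Qed.

Lemma reD z w : re (z + w) = re z + re w. Proof. by []. Qed.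
Lemma imD z w : im (z + w) = im z + im w. Proof. by []. Qed.
Lemma reN z : re (- z) = - re z. Proof. by []. Qed.
Lemma imN z : im (- z) = - im z. Proof. by []. Qed.
Lemma reM z w : re (z * w) = re z * re w - im z * im w. Proof. by []. Qed.
Lemma imM z w : im (z * w) = re z * im w + im z * re w. Proof. by []. Qed.
Lemma re1 : re 1 = 1. Proof. by []. Qed.
Lemma im1 : im 1 = 0. Proof. by []. Qed.
Definition cplxE := (reD, imD, reN, imN, reM, imM, re1, im1).

Lemma conjcM z w : conjc (z * w) = conjc z * conjc w.
Proof. by move: z w => [a b] [c d]; congr pair; rewrite /re /im /=; ring. Qed.

Lemma conjcD z w : conjc (z + w) = conjc z + conjc w.
Proof. by move: z w => [a b] [c d]; congr pair; rewrite /re /im /=; ring. Qed.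

End cplx_ring.

Section cplx_map.
Variables (A B : comPzRingType) (f : {rmorphism A -> B}).

Definition cplx_map (z : cplx A) : cplx B := (f (re z), f (im z)).

Let cplx_map_additive : zmod_morphism cplx_map.
Proof. by move=> z w; congr pair; rewrite rmorphB. Qed.

Let cplx_map_multiplicative : monoid_morphism cplx_map.
Proof.
split; first by congr pair; rewrite ?rmorph1 ?rmorph0.
by move=> z w; congr pair; rewrite /re /im /= ?rmorphB ?rmorphD !rmorphM.
Qed.

HB.instance Definition _ := GRing.isZmodMorphism.Build (cplx A) (cplx B) cplx_map
  cplx_map_additive.
HB.instance Definition _ := GRing.isMonoidMorphism.Build (cplx A) (cplx B) cplx_map
  cplx_map_multiplicative.

End cplx_map.

(** * A commutative algebra of operators *)

Section commutant_algebra.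
Variables (R : realType) (V : lmodType R) (D : set (V -> V)).
Implicit Types (B C : V -> V).

Definition commutant C : Prop :=
  linear C /\ forall B, D B -> linear B -> forall v, C (B v) = B (C v).

(** Members lie in the commutant and commute with all of it, hence with each other. So [balg] is a
    commutative ring and [ring] decides identities between resolvents; norm bounds are tracked
    separately by [opnorm_le]. *)
Definition bicommutant B : Prop :=
  commutant B /\ forall C, commutant C -> forall v, B (C v) = C (B v).

Record balg := Balg { bfun :> V -> V; bfunP : bicommutant bfun }.

Lemma balgP (a b : balg) : (forall v, a v = b v) -> a = b.
Proof.
case: a b => [a aP] [b bP] /= /funext ab; case: _ / ab bP => bP.
by congr Balg; exact: Prop_irrelevance.
Qed.

HB.instance Definition _ := gen_eqMixin balg.
HB.instance Definition _ := gen_choiceMixin balg.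

Lemma linear_addE C : linear C -> forall v w, C (v + w) = C v + C w.
Proof. by move=> CL v w; rewrite -[v]scale1r CL !scale1r. Qed.

Lemma linear_0E C : linear C -> C 0 = 0.
Proof. by move=> CL; apply: (addrI (C 0)); rewrite -linear_addE// !addr0. Qed.

Lemma linear_scaleE C : linear C -> forall k v, C (k *: v) = k *: C v.
Proof. by move=> CL k v; rewrite -[k *: v]addr0 CL linear_0E// addr0. Qed.

Lemma linear_oppE C : linear C -> forall v, C (- v) = - C v.
Proof. by move=> CL v; rewrite -scaleN1r linear_scaleE// scaleN1r. Qed.

Lemma balg_linear (a : balg) : linear a. Proof. by have [[]] := bfunP a. Qed.

Lemma balg_comm (a : balg) C : commutant C -> forall v, a (C v) = C (a v).
Proof. by have [_] := bfunP a; exact. Qed.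

Lemma balg_commD (a : balg) B : D B -> linear B -> forall v, a (B v) = B (a v).
Proof. by have [[_ H] _] := bfunP a; exact: H. Qed.

Lemma balg_commutant (a : balg) : commutant a. Proof. by have [] := bfunP a. Qed.

Let badd_subproof (a b : balg) : bicommutant (fun v => a v + b v).
Proof.
have aL := balg_linear a; have bL := balg_linear b.
split; [split|] => [k v w|B DB BL v|C CP v] /=.
- by rewrite aL bL scalerDr addrACA.
- by rewrite !(balg_commD _ DB BL) (linear_addE BL).
- by rewrite !(balg_comm _ CP) (linear_addE CP.1).
Qed.

Let bopp_subproof (a : balg) : bicommutant (fun v => - a v).
Proof.
have aL := balg_linear a.
split; [split|] => [k v w|B DB BL v|C CP v] /=.
- by rewrite aL scalerN opprD.
- by rewrite (balg_commD _ DB BL) (linear_oppE BL).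
- by rewrite (balg_comm _ CP) (linear_oppE CP.1).
Qed.

Let bmul_subproof (a b : balg) : bicommutant (fun v => a (b v)).
Proof.
have aL := balg_linear a; have bL := balg_linear b.
split; [split|] => [k v w|B DB BL v|C CP v] /=.
- by rewrite bL aL.
- by rewrite !(balg_commD _ DB BL).
- by rewrite !(balg_comm _ CP).
Qed.

Let bscale_subproof (k : R) : bicommutant (fun v => k *: v).
Proof.
split; [split|] => [l v w|B DB BL v|C CP v].
- by rewrite scalerDr !scalerA mulrC.
- by rewrite (linear_scaleE BL).
- by rewrite (linear_scaleE CP.1).
Qed.

Definition badd a b := Balg (badd_subproof a b).
Definition bopp a := Balg (bopp_subproof a).
Definition bmul a b := Balg (bmul_subproof a b).
Definition bscale k := Balg (bscale_subproof k).

Let baddA : associative badd.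
Proof. by move=> a b c; apply: balgP => v /=; rewrite addrA. Qed.
Let baddC : commutative badd.
Proof. by move=> a b; apply: balgP => v /=; rewrite addrC. Qed.
Let badd0 : left_id (bscale 0) badd.
Proof. by move=> a; apply: balgP => v /=; rewrite scale0r add0r. Qed.
Let baddN : left_inverse (bscale 0) bopp badd.
Proof. by move=> a; apply: balgP => v /=; rewrite scale0r addNr. Qed.

HB.instance Definition _ := GRing.isZmodule.Build balg baddA baddC badd0 baddN.

Let bmulA : associative bmul. Proof. by move=> a b c; apply: balgP. Qed.
Let bmulC : commutative bmul.
Proof. by move=> a b; apply: balgP => v /=; rewrite (balg_comm a (balg_commutant b)). Qed.
Let bmul1 : left_id (bscale 1) bmul.
Proof. by move=> a; apply: balgP => v /=; rewrite scale1r. Qed.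
Let bmulDl : left_distributive bmul +%R.
Proof. by move=> a b c; apply: balgP. Qed.

HB.instance Definition _ := GRing.Zmodule_isComPzRing.Build balg bmulA bmulC bmul1 bmulDl.

Lemma balgDE (a b : balg) v : (a + b) v = a v + b v. Proof. by []. Qed.
Lemma balgNE (a : balg) v : (- a) v = - a v. Proof. by []. Qed.
Lemma balgME (a b : balg) v : (a * b) v = a (b v). Proof. by []. Qed.
Lemma balg0E v : (0 : balg) v = 0. Proof. by rewrite /= scale0r. Qed.
Lemma balg1E v : (1 : balg) v = v. Proof. by rewrite /= scale1r. Qed.
Lemma bscaleE k v : bscale k v = k *: v. Proof. by []. Qed.

Let bscale_additive : zmod_morphism bscale.
Proof. by move=> k l; apply: balgP => v /=; rewrite scalerBl. Qed.
Let bscale_multiplicative : monoid_morphism bscale.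
Proof. by split=> [|k l]; apply: balgP => v //=; rewrite scalerA. Qed.

HB.instance Definition _ := GRing.isZmodMorphism.Build R balg bscale bscale_additive.
HB.instance Definition _ := GRing.isMonoidMorphism.Build R balg bscale bscale_multiplicative.


End commutant_algebra.

(** * Resolvents of the unbounded operator *)

Section resolvents.
Variables (R : realType) (n : nat) (E : normedModType R).
Local Notation V := (cliff_mod n E).
Variable T : set (V * V).
Hypothesis T_fun : single_valued T.
Hypothesis T_lin : forall (k : R) u v u' v', T (u, v) -> T (u', v') ->
  T (k *: u + u', k *: v + v').
Hypothesis T_00 : T (0, 0).
Implicit Types z : cplx R.

Definition sqmod z : R := re z ^+ 2 + im z ^+ 2.

(* v = Q_z u, for z in place of the paravector re z + J im z *)
Definition Qrel z (u v : V) : Prop := exists p w,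
  [/\ T (u, p), T (p, w) & v = w - (2 * re z) *: p + sqmod z *: u].

Definition regular z : Prop :=
  (forall v, exists u, Qrel z u v) /\
  (forall u u' v, Qrel z u v -> Qrel z u' v -> u = u').

Definition Qinv z (v : V) : V := xget 0 [set u | Qrel z u v].
Definition TQinv z (v : V) : V := op_app T (Qinv z v).

Definition resolvent_ops : set (V -> V) :=
  [set B | exists2 z, regular z & B = Qinv z \/ B = TQinv z].

Let T_add u v u' v' : T (u, v) -> T (u', v') -> T (u + u', v + v').
Proof. by move=> h h'; rewrite -[u]scale1r -[v]scale1r; exact: T_lin. Qed.

Let T_scale k u v : T (u, v) -> T (k *: u, k *: v).
Proof. by move=> h; rewrite -[k *: u]addr0 -[k *: v]addr0; exact: T_lin. Qed.

Let T_opp u v : T (u, v) -> T (- u, - v).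
Proof. by move=> h; rewrite -[- u]scaleN1r -[- v]scaleN1r; exact: T_scale. Qed.

Lemma op_app_eq u v : T (u, v) -> op_app T u = v.
Proof. by move=> uv; apply: xget_unique => // y uy; exact: (T_fun uy uv). Qed.

Section regular_point.
Variables (z : cplx R) (zreg : regular z).

Lemma Qinv_rel v : Qrel z (Qinv z v) v.
Proof. by have [u uv] := zreg.1 v; exact: (xgetPex (P := fun u => Qrel z u v) 0 (ex_intro _ u uv)). Qed.

Lemma Qinv_eq u v : Qrel z u v -> Qinv z v = u.
Proof. by move=> uv; exact: (zreg.2 _ _ _ (Qinv_rel v) uv). Qed.

Lemma Qinv_T v : T (Qinv z v, TQinv z v).
Proof. by have [p [w [h1 h2 _]]] := Qinv_rel v; rewrite /TQinv (op_app_eq h1). Qed.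

Lemma TQinv_T v :
  T (TQinv z v, v + (2 * re z) *: TQinv z v - sqmod z *: Qinv z v).
Proof.
have [p [w [h1 h2 e]]] := Qinv_rel v; rewrite /TQinv (op_app_eq h1).
by rewrite {1}e addrAC addrK subrK.
Qed.

Lemma Qrel_lin k u v u' v' : Qrel z u v -> Qrel z u' v' ->
  Qrel z (k *: u + u') (k *: v + v').
Proof.
move=> [p [w [h1 h2 ->]]] [p' [w' [h1' h2' ->]]].
exists (k *: p + p'), (k *: w + w'); split; [exact: T_lin|exact: T_lin|].
module.
Qed.


Lemma Qinv_linear : linear (Qinv z).
Proof. by move=> k u v; apply: Qinv_eq; apply: Qrel_lin; exact: Qinv_rel. Qed.

Lemma TQinv_linear : linear (TQinv z).
Proof.
move=> k u v; rewrite {1}/TQinv Qinv_linear; apply: op_app_eq.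
by apply: T_lin; exact: Qinv_T.
Qed.

Lemma Qinv_comm C v : linear C -> (forall u w, T (u, w) -> T (C u, C w)) ->
  C (Qinv z v) = Qinv z (C v).
Proof.
move=> CL CT; symmetry; apply: Qinv_eq; have [p [w [h1 h2 {2}->]]] := Qinv_rel v.
exists (C p), (C w); split; [exact: CT|exact: CT|].
by rewrite !(linear_addE CL, linear_oppE CL, linear_scaleE CL).
Qed.

Lemma TQinv_comm C v : linear C -> (forall u w, T (u, w) -> T (C u, C w)) ->
  C (TQinv z v) = TQinv z (C v).
Proof.
move=> CL CT; symmetry; rewrite {1}/TQinv -(Qinv_comm _ CL CT).
by apply: op_app_eq; apply: CT; exact: Qinv_T.
Qed.

(** [T Q^{-1} u] solves [Q x = T u]. This commutation of [T] with [Q^{-1}] on the domain is the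
    source of all commutations between resolvents. *)
Lemma TQinv_TE u v : T (u, v) -> TQinv z u = Qinv z v.
Proof.
move=> uv; symmetry; apply: Qinv_eq.
set p := TQinv z u; pose p' := u + (2 * re z) *: p - sqmod z *: Qinv z u.
have h1 : T (p, p') by exact: TQinv_T.
exists p', (v + (2 * re z) *: p' - sqmod z *: p); split=> //; last by module.
exact: T_add (T_add uv (T_scale _ h1)) (T_opp (T_scale _ (Qinv_T u))).
Qed.

Lemma Qinv_inv u v : T (u, v) -> T (Qinv z u, Qinv z v).
Proof. by move=> uv; rewrite -(TQinv_TE uv); exact: Qinv_T. Qed.

Lemma TQinv_inv u v : T (u, v) -> T (TQinv z u, TQinv z v).
Proof. by move=> uv; rewrite (TQinv_TE uv); exact: Qinv_T. Qed.

End regular_point.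

Lemma commutant_inv C : linear C -> (forall u w, T (u, w) -> T (C u, C w)) ->
  commutant resolvent_ops C.
Proof.
move=> CL CT; split=> // B [z zr [->|->]] _ v; first exact: Qinv_comm.
exact: TQinv_comm.
Qed.

Lemma Qinv_bicommutant z : regular z -> bicommutant resolvent_ops (Qinv z).
Proof.
move=> zr; split.
  by apply: commutant_inv; [exact: Qinv_linear|exact: Qinv_inv].
move=> C [CL CD] v; rewrite -CD//; last exact: Qinv_linear.
by exists z; [|left].
Qed.

Lemma TQinv_bicommutant z : regular z -> bicommutant resolvent_ops (TQinv z).
Proof.
move=> zr; split.
  by apply: commutant_inv; [exact: TQinv_linear|exact: TQinv_inv].
move=> C [CL CD] v; rewrite -CD//; last exact: TQinv_linear.
by exists z; [|right].
Qed.

Local Notation alg := (balg resolvent_ops).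
Local Notation bscale := (@bscale R V resolvent_ops).
Local Notation iota := (cplx_map bscale).

(** The value 0 off the regular points is a default. *)
Definition qb z : alg := if pselect (regular z) is left zr then Balg (Qinv_bicommutant zr) else 0.
Definition pb z : alg := if pselect (regular z) is left zr then Balg (TQinv_bicommutant zr) else 0.

Lemma qbE z v : regular z -> qb z v = Qinv z v.
Proof. by rewrite /qb; case: pselect. Qed.

Lemma pbE z v : regular z -> pb z v = TQinv z v.
Proof. by rewrite /pb; case: pselect. Qed.

(** The equation [T X = Y] as a relation, since [T] itself is not in the algebra. It determines [Y]
    and is stable under sums, opposites and products with elements of the algebra. *)
Definition Tmul (X Y : alg) : Prop := forall v, T (X v, Y v).

Lemma TmulD X Y X' Y' : Tmul X Y -> Tmul X' Y' -> Tmul (X + X') (Y + Y').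
Proof. by move=> h h' v; exact: T_add. Qed.
Lemma TmulN X Y : Tmul X Y -> Tmul (- X) (- Y).
Proof. by move=> h v; exact: T_opp. Qed.
Lemma TmulM X Y Z : Tmul X Y -> Tmul (X * Z) (Y * Z).
Proof. by move=> h v; exact: h. Qed.
Lemma Tmul_unique X Y Y' : Tmul X Y -> Tmul X Y' -> Y = Y'.
Proof. by move=> h h'; apply: balgP => v; exact: T_fun (h v) (h' v). Qed.
Lemma TmulMl X Y Z : Tmul X Y -> Tmul (Z * X) (Z * Y).
Proof. by rewrite ![Z * _]mulrC; exact: TmulM. Qed.

Lemma Tmul_qp z : regular z -> Tmul (qb z) (pb z).
Proof. by move=> zr v; rewrite qbE// pbE//; exact: Qinv_T. Qed.

Lemma Tmul_p z : regular z ->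
  Tmul (pb z) (1 + bscale (2 * re z) * pb z - bscale (sqmod z) * qb z).
Proof.
move=> zr v; rewrite pbE// !(balgDE, balgNE, balgME, bscaleE) scale1r qbE// pbE//.
exact: TQinv_T.
Qed.

Definition TmulC (X Y : cplx alg) : Prop := Tmul (re X) (re Y) /\ Tmul (im X) (im Y).

Lemma TmulC_unique X Y Y' : TmulC X Y -> TmulC X Y' -> Y = Y'.
Proof. by move=> [h1 h2] [h1' h2']; apply: cplx_eq; apply: Tmul_unique; eassumption. Qed.

Lemma TmulCMl X Y Z : TmulC X Y -> TmulC (Z * X) (Z * Y).
Proof.
move=> [h1 h2]; split; rewrite !cplxE; apply: TmulD; try exact: TmulMl.
by apply: TmulN; exact: TmulMl.
Qed.

Lemma TmulCM X Y Z : TmulC X Y -> TmulC (X * Z) (Y * Z).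
Proof. by rewrite ![_ * Z]mulrC; exact: TmulCMl. Qed.

(** This is [(conj z - T) Q_z^{-1}], that is [(z - T)^{-1}], because
    [Q_z = (z - T) (conj z - T)]. *)
Definition Rz z : cplx alg := (bscale (re z) * qb z - pb z, - (bscale (im z) * qb z)).

Lemma TmulC_Rz z : regular z -> TmulC (Rz z) (iota z * Rz z - 1).
Proof.
move=> zr; have qp := Tmul_qp zr; have p' := Tmul_p zr; split.
  have := TmulD (TmulMl (bscale (re z)) qp) (TmulN p'); congr (Tmul _ _).
  rewrite !cplxE /Rz /cplx_map /sqmod /re /im /=; ring.
have := TmulN (TmulMl (bscale (im z)) qp); congr (Tmul _ _).
rewrite !cplxE /Rz /cplx_map /re /im /=; ring.
Qed.

(** [T] applied to [Rz z * Rz w] is computed twice, letting it act on either factor. *)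
Lemma Rz_resolvent z w : regular z -> regular w ->
  Rz w - Rz z = iota (z - w) * Rz z * Rz w.
Proof.
move=> zr wr; have := TmulC_unique (TmulCM (Rz w) (TmulC_Rz zr)) (TmulCMl (Rz z) (TmulC_Rz wr)).
move=> h; apply/eqP; rewrite -subr_eq0; apply/eqP.
transitivity ((Rz z * (iota w * Rz w - 1)) - (iota z * Rz z - 1) * Rz w); first ring.
by rewrite h subrr.
Qed.

Section unit_imaginary.
Hypothesis i_regular : regular (0, 1).
Let S := qb (0, 1).
Let K := pb (0, 1).

Lemma Tmul_SK : Tmul S K. Proof. exact: Tmul_qp. Qed.

Lemma Tmul_K : Tmul K (1 - S).
Proof.
have := Tmul_p i_regular; congr Tmul; rewrite /sqmod /re /im /=.
by rewrite mulr0 rmorph0 mul0r addr0 expr0n add0r expr1n rmorph1 mul1r.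
Qed.

Let TmulC_S : TmulC (creal S) (creal K).
Proof. by split; [exact: Tmul_SK|move=> v; rewrite !balg0E]. Qed.

Let TmulC_K : TmulC (creal K) (1 - (creal S)).
Proof.
split; [exact: Tmul_K|].
have -> : im (1 - creal S) = 0 by exact: subrr.
by move=> v; rewrite !balg0E.
Qed.

(** Both sides are [T] applied to [S * Rz z], as [T S = K]. In [SRz] both sides are [T] applied to
    [K * Rz z], as [T K = 1 - S]. *)
Lemma KRz z : regular z -> (creal K) * Rz z = (creal S) * (iota z * Rz z - 1).
Proof.
by move=> zr; exact: TmulC_unique (TmulCM (Rz z) TmulC_S) (TmulCMl (creal S) (TmulC_Rz zr)).
Qed.

Lemma SRz z : regular z -> (1 - (creal S)) * Rz z = (creal K) * (iota z * Rz z - 1).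
Proof.
by move=> zr; exact: TmulC_unique (TmulCM (Rz z) TmulC_K) (TmulCMl (creal K) (TmulC_Rz zr)).
Qed.

(* For z = i t, the operators t^2 Q_z^{-1} and T^2 Q_z^{-1} are the two bounded *)
(* approximations of the identity at infinity and at zero.                     *)
Lemma Tmul_pt t : regular (0, t) -> Tmul (pb (0, t)) (1 - bscale (t ^+ 2) * qb (0, t)).
Proof.
move=> tr; have := Tmul_p tr; congr Tmul; rewrite /sqmod /re /im /=.
by rewrite mulr0 rmorph0 mul0r addr0 expr0n add0r.
Qed.

(** [T] is applied to [q = S (1 + (1 - t^2) q)], the resolvent identity between [t] and 1. This
    splits off the factor [K] from which [e(T)] is built. *)
Lemma pb_factor t : regular (0, t) ->
  pb (0, t) = K * (1 + (1 - bscale (t ^+ 2)) * qb (0, t)).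
Proof.
move=> tr; set q := qb _; set p := pb _; set b := bscale _.
have h1 : Tmul q p by exact: Tmul_qp.
have h2 : Tmul p (1 - b * q) by exact: Tmul_pt.
have e1 : S * p = K * q := Tmul_unique (TmulMl S h1) (TmulM q Tmul_SK).
have e2 : S * (1 - b * q) = (1 - S) * q.
  have h3 := TmulMl S h2; rewrite e1 in h3; exact: Tmul_unique h3 (TmulM q Tmul_K).
have e3 : q = S * (1 + (1 - b) * q).
  apply/eqP; rewrite -subr_eq0; apply/eqP.
  by transitivity ((1 - S) * q - S * (1 - b * q)); [ring|rewrite e2 subrr].
apply: Tmul_unique h1 _; rewrite {1}e3; exact: TmulM Tmul_SK.
Qed.

(** With [K_high]: multiplied by [K], the errors of the two approximations of the identity become
    [t^2 S T Q^{-1}] and [(1 - S) T Q^{-1}], of order [t] and [1 / t]. *)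
Lemma K_low t : regular (0, t) -> K * (bscale (t ^+ 2) * qb (0, t)) = bscale (t ^+ 2) * (S * pb (0, t)).
Proof.
move=> tr; rewrite mulrCA; congr (_ * _).
exact: Tmul_unique (TmulM _ Tmul_SK) (TmulMl S (Tmul_qp tr)).
Qed.

Lemma K_high t : regular (0, t) -> K * (1 - bscale (t ^+ 2) * qb (0, t)) = (1 - S) * pb (0, t).
Proof. by move=> tr; exact: Tmul_unique (TmulMl K (Tmul_pt tr)) (TmulM _ Tmul_K). Qed.

End unit_imaginary.

End resolvents.

(** * Estimates for functions of a positive variable *)

Section real_functions.
Variable R : realType.
Implicit Types (g : R -> R) (a b : R).

Definition pos_continuous g : Prop := forall r : R, 0 < r -> {for r, continuous g}.

Lemma pos_uniform_continuous g a b eps : pos_continuous g -> 0 < a -> 0 < eps ->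
  exists2 delta, 0 < delta & forall r r', a <= r <= b -> a <= r' <= b ->
    `|r - r'| < delta -> `|g r - g r'| <= eps.
Proof.
move=> gc a0 e0; have := @segment_compact R a b => /compact_near_coveringP.
move=> /(_ R ((0 : R)^'+) (fun d x => forall y, a <= y <= b -> `|x - y| < d -> `|g x - g y| <= eps)).
case=> [x|d /= d0 H].
- have := gc x; rewrite /= in_itv/= => gx /andP[ax xb].
  have /(gc x) : 0 < x by exact: lt_le_trans ax.
  move=> /cvgr_dist_le /(_ (eps / 2)); rewrite divr_gt0// => /(_ isT) [eta /= eta0 Heta].
  exists ([set x' | `|x - x'| < eta / 2], [set d | d < eta / 2]).
    split=> /=; last by apply: nbhs_right_lt; rewrite divr_gt0.
    by exists (eta / 2) => //=; rewrite divr_gt0.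
  move=> [x' d] /= [xx' de] y _ xy.
  have h1 := Heta x' => /=; have {h1} h1 : `|g x - g x'| <= eps / 2.
    by apply: h1 => /=; rewrite (lt_le_trans xx')// ler_pdivrMr// ler_pMr// ler1n.
  have h2 : `|g x - g y| <= eps / 2.
    apply: Heta => /=; apply: (le_lt_trans (ler_distD x' _ _)).
    by rewrite [ltRHS]splitr ltrD// (lt_trans xy).
  apply: (le_trans (ler_distD (g x) _ _)); rewrite [leRHS]splitr lerD//.
  by rewrite distrC.
- have /= := H (d / 2); rewrite sub0r normrN gtr0_norm ?divr_gt0// => H'.
  exists (d / 2); first by rewrite divr_gt0.
  move=> r r' rI r'I rr'; have dd : d / 2 < d by rewrite ltr_pdivrMr// ltr_pMr// ltr1n.
  by apply: (H' dd isT r _ r' r'I rr'); rewrite /= in_itv.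
Qed.

(** By uniform continuity [g] changes by at most 1 on each of the finitely many steps of length
    [d / 2]. *)
Lemma pos_bounded g a b : pos_continuous g -> 0 < a ->
  exists2 M, 0 <= M & forall r, a <= r <= b -> `|g r| <= M.
Proof.
move=> gc a0; have [ab|ba] := leP a b; last first.
  by exists 0 => // r /andP[/le_trans h /h]; rewrite leNgt ba.
have [d d0 H] := pos_uniform_continuous b gc a0 ltr01.
exists (`|g a| + (Num.truncn ((b - a) / (d / 2))).+1%:R); first by rewrite addr_ge0.
move=> r rI; have /andP[ar rb] := rI.
have d20 : 0 < d / 2 by rewrite divr_gt0.
have main (k : nat) : forall x, a <= x <= b -> x - a <= k%:R * (d / 2) ->
    `|g x| <= `|g a| + k%:R.
  elim: k => [x /andP[ax xb]|k IH x xI].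
    by rewrite mul0r subr_le0 => xa; rewrite (@le_anti _ _ x a) ?ax ?xa// addr0.
  rewrite -natr1 => xk; have /andP[ax xb] := xI.
  have [xd|xd] := leP x (a + d / 2).
    have := H x a xI; rewrite lexx ab => /(_ isT) h.
    have /h : `|x - a| < d.
      by rewrite ger0_norm ?subr_ge0//; lra.
    have := ler_distD 0 (g x) 0; rewrite !subr0 => _ h'.
    have -> : g x = g x - g a + g a by rewrite subrK.
    apply: (le_trans (ler_normD _ _)); have : 0 <= k%:R :> R by []; lra.
  have yI : a <= x - d / 2 <= b by lra.
  have h1 := IH (x - d / 2) yI; have {}h1 : `|g (x - d / 2)| <= `|g a| + k%:R.
    by apply: h1; lra.
  have h2 : `|g x - g (x - d / 2)| <= 1.
    by apply: H => //; rewrite opprB addrCA subrr addr0 gtr0_norm//; lra.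
  have -> : g x = g x - g (x - d / 2) + g (x - d / 2) by rewrite subrK.
  by apply: (le_trans (ler_normD _ _)); lra.
apply: main => //; apply: (@le_trans _ _ (b - a)); first by lra.
by rewrite -ler_pdivrMr//; apply: ltW; exact: truncnS_gt.
Qed.

Lemma derive_pos_continuous g g' : (forall r : R, 0 < r -> is_derive r 1 g (g' r)) ->
  pos_continuous g.
Proof.
move=> gD r r0; have [gd _] := gD r r0.
by apply: differentiable_continuous; apply/derivable1_diffP.
Qed.

Lemma pos_mvt g g' x y : (forall r : R, 0 < r -> is_derive r 1 g (g' r)) ->
  0 < x -> x <= y -> exists2 c, x <= c <= y & g y - g x = g' c * (y - x).
Proof.
move=> gD x0 xy; have [c] : exists2 c, c \in `[x, y]%R & g y - g x = g' c * (y - x).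
  have posI c : c \in `[x, y]%R -> 0 < c.
    by rewrite in_itv/= => /andP[+ _]; apply: lt_le_trans.
  apply: MVT_segment => //.
    by move=> c /subset_itv_oo_cc cI; apply: gD; exact: posI.
  by apply: derivable_within_continuous => c cI; have [] := gD c (posI c cI).
by rewrite in_itv/= => cI e; exists c.
Qed.

Lemma antider_scalar (V : normedModType R) (A al : R -> R) (x : V) :
  (forall r : R, 0 < r -> is_derive r 1 A (al r)) -> pos_continuous al ->
  antider (fun r => al r *: x) (fun r => A r *: x).
Proof.
move=> AD alc a b eps a0 e0; have x0 : 0 < `|x| + 1 by rewrite ltr_wpDl.
have [d d0 H] := pos_uniform_continuous b alc a0 (divr_gt0 e0 x0).
exists d => // t xi t' at_ txi xit' t'b tt'.
have t0 := lt_le_trans a0 at_; have tt := le_trans txi xit'.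
have [c /andP[tc ct'] e] := pos_mvt AD t0 tt.
rewrite scalerA -!scalerBl e mulrC -mulrBr normrZ normrM ger0_norm ?subr_ge0//.
rewrite mulrAC [leRHS]mulrC -mulrA; apply: ler_wpM2l; first by rewrite subr_ge0.
have := H c xi; rewrite (le_trans at_ tc) (le_trans ct')// (le_trans at_ txi) (le_trans xit')//.
have cx : `|c - xi| < d.
  by apply: le_lt_trans tt'; rewrite ler_norml; lra.
move=> /(_ isT isT cx); rewrite ler_pdivlMr// => h.
by apply: le_trans h; rewrite mulrC ler_wpM2l// lerDl.
Qed.

Lemma total_incr_scalar (V : normedModType R) (A : R -> R) (x : V) l0 l1 :
  A r @[r --> 0^'+] --> l0 -> A r @[r --> +oo] --> l1 ->
  total_incr (fun r => A r *: x) ((l1 - l0) *: x).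
Proof.
move=> A0 A1 e e0; have x0 : 0 < 2 * (`|x| + 1) by rewrite mulr_gt0// ltr_wpDl.
have ex0 := divr_gt0 e0 x0.
have /cvgr_dist_le /(_ _ ex0) [d /= d0 Hd] := A0.
have /cvgr_dist_le /(_ _ ex0) [M [_ HM]] := A1.
exists (d / 2), (Num.max (M + 1) 1); split; rewrite ?divr_gt0// ?lt_max ?ltr01 ?orbT//.
move=> a b a0 ad; rewrite ge_max => /andP[Mb _].
have h1 : `|l0 - A a| <= e / (2 * (`|x| + 1)).
  apply: Hd => //=; rewrite sub0r normrN gtr0_norm//.
  by apply: (le_lt_trans ad); rewrite ltr_pdivrMr// ltr_pMr// ltr1n.
have h2 : `|l1 - A b| <= e / (2 * (`|x| + 1)) by apply: HM; lra.
rewrite -!scalerBl normrZ.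
have -> : A b - A a - (l1 - l0) = (l0 - A a) - (l1 - A b) by ring.
have h3 := le_trans (ler_normB (l0 - A a) (l1 - A b)) (lerD h1 h2).
apply: (le_trans (ler_wpM2r (normr_ge0 x) h3)).
have -> : (e / (2 * (`|x| + 1)) + e / (2 * (`|x| + 1))) * `|x| = e * (`|x| / (`|x| + 1)).
  by field; rewrite gt_eqF// ltr_wpDl.
by rewrite ger_pMr// ler_pdivrMr ?ltr_wpDl// mul1r lerDl.
Qed.

Lemma antider_quadratic (V : normedModType R) (u U : R -> V) :
  (forall a b, 0 < a -> exists2 M, 0 <= M & forall t t', a <= t <= b -> a <= t' <= b ->
     `|U t' - U t - (t' - t) *: u t| <= M * (t' - t) ^+ 2) ->
  antider u U.
Proof.
move=> H a b eps a0 e0; have [M M0 HM] := H a b a0.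
exists (eps / (2 * M + 1)); first by rewrite divr_gt0// ltr_wpDl// mulr_ge0.
move=> t xi t' at_ txi xit' t'b; rewrite ltr_pdivlMr ?ltr_wpDl ?mulr_ge0// => tt'.
have xiI : a <= xi <= b by rewrite (le_trans at_ txi) (le_trans xit').
have h1 := HM xi t' xiI; have {}h1 := h1 _.
have t'I : a <= t' <= b by rewrite t'b (le_trans at_) ?(le_trans txi).
have tI : a <= t <= b by rewrite at_ (le_trans txi)// (le_trans xit').
have {}h1 := h1 t'I; have h2 := HM xi t xiI tI.
(* Both ends are expanded at the tag [xi]; this is why the hypothesis covers increments in both
   directions. *)
have -> : U t' - U t - (t' - t) *: u xi =
    (U t' - U xi - (t' - xi) *: u xi) - (U t - U xi - (t - xi) *: u xi) by module.
apply: (le_trans (ler_normB _ _)); apply: (le_trans (lerD h1 h2)).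
have tx : t <= t' by exact: le_trans xit'.
rewrite -mulrDr; apply: (@le_trans _ _ (M * (2 * (t' - t) ^+ 2))); first by apply: ler_wpM2l => //; nra.
suff : M * (2 * (t' - t)) * (t' - t) <= eps * (t' - t) by apply: le_trans; nra.
by apply: ler_wpM2r; [rewrite subr_ge0|nra].
Qed.

(* subdividing [a, b] gets rid of the quadratic error *)
Lemma subdivision_le (V : normedModType R) (f : R -> V) a b d C : a <= b -> 0 <= C ->
  (forall x y, a <= x -> x <= y -> y <= b -> y - x <= 1 ->
    `|f y - f x| <= d * (y - x) + C * (y - x) ^+ 2) ->
  `|f b - f a| <= d * (b - a).
Proof.
rewrite le_eqVlt => /predU1P[<-|ab] C0 H; first by rewrite !subrr normr0 mulr0.
have ba : 0 < b - a by rewrite subr_gt0.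
apply/ler_addgt0Pr => e e0.
pose n := (Num.truncn (b - a + C * (b - a) ^+ 2 / e)).+1.
have n0 : (0 < n%:R :> R) by rewrite ltr0n.
have nb : b - a + C * (b - a) ^+ 2 / e <= n%:R by apply: ltW; exact: truncnS_gt.
have Ce0 : 0 <= C * (b - a) ^+ 2 / e by rewrite divr_ge0 ?mulr_ge0 ?sqr_ge0// ltW.
pose h := (b - a) / n%:R.
have nh : n%:R * h = b - a by rewrite mulrC divfK// gt_eqF.
have h0 : 0 < h by rewrite divr_gt0.
have h1 : h <= 1 by rewrite ler_pdivrMr// mul1r; lra.
pose tt i : R := a + i%:R * h.
have main i : (i <= n)%N -> `|f (tt i) - f a| <= i%:R * (d * h + C * h ^+ 2).
  elim: i => [_|i IH i1]; first by rewrite /tt !mul0r addr0 subrr normr0.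
  have ttS : tt i.+1 - tt i = h by rewrite /tt -natr1; ring.
  have -> : f (tt i.+1) - f a = (f (tt i.+1) - f (tt i)) + (f (tt i) - f a).
    by rewrite addrA subrK.
  apply: (le_trans (ler_normD _ _)).
  have := H (tt i) (tt i.+1); rewrite ttS => Hi.
  have {}Hi : `|f (tt i.+1) - f (tt i)| <= d * h + C * h ^+ 2.
    apply: Hi => //; first by rewrite lerDl mulr_ge0// ltW.
      by rewrite -subr_ge0 ttS ltW.
    by rewrite /tt -lerBrDl -nh; apply: ler_wpM2r; [exact: ltW|rewrite ler_nat].
  have := IH (ltnW i1); rewrite -natr1; lra.
have := main n (leqnn n); have -> : tt n = b by rewrite /tt nh addrC subrK.
move=> /le_trans; apply; rewrite mulrDr mulrCA nh lerD2l.
have -> : n%:R * (C * h ^+ 2) = C * (b - a) ^+ 2 / n%:R.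
  by rewrite /h; field; rewrite gt_eqF.
rewrite ler_pdivrMr// -ler_pdivrMl// [leLHS]mulrC; lra.
Qed.

Lemma abs_sin_le (h : R) : `|sin h| <= `|h|.
Proof.
have [h0|/ltW h0] := leP 0 h.
  have [c _] : exists2 c, c \in `[0, h]%R & sin h - sin 0 = cos c * (h - 0).
    by apply: MVT_segment => // ; apply: derivable_within_continuous.
  rewrite sin0 !subr0 => ->; rewrite normrM ler_piMl//.
  by rewrite ler_norml cos_geN1 cos_le1.
have [c _] : exists2 c, c \in `[h, 0]%R & sin 0 - sin h = cos c * (0 - h).
  by apply: MVT_segment => // ; apply: derivable_within_continuous.
rewrite sin0 !sub0r => /eqP; rewrite eqr_oppLR => /eqP ->; rewrite mulrN opprK normrM ler_piMl//.
by rewrite ler_norml cos_geN1 cos_le1.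
Qed.

Lemma abs_cosB1_le (h : R) : `|cos h - 1| <= h ^+ 2.
Proof.
have -> : cos h - 1 = - (sin (h / 2) ^+ 2 *+ 2).
  rewrite {1}(splitr h) -mulr2n cos_mulr2n cos2sin2; lra.
rewrite normrN ger0_norm ?mulrn_wge0 ?sqr_ge0//.
have := abs_sin_le (h / 2); rewrite -(ler_pXn2r (ltn0Sn 1)) ?nnegrE// !real_normK ?num_real//.
by rewrite expr_div_n; have := sqr_ge0 h; lra.
Qed.

Lemma abs_sinB_le (h : R) : `|h| <= 1 -> `|sin h - h| <= h ^+ 2.
Proof.
wlog h0 : h / 0 <= h => [H h1|].
  have [h0|/ltW h0] := leP 0 h; first exact: H.
  have := H (- h); rewrite oppr_ge0 normrN sqrrN sinN => /(_ h0 h1).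
  by rewrite -opprD normrN.
move=> h1; have [c] : exists2 c, c \in `[0, h]%R &
    (sin h - h) - (sin 0 - 0) = (cos c - 1) * (h - 0).
  apply: (@MVT_segment _ (fun x => sin x - x) (fun x => cos x - 1)) => //.
  by apply: derivable_within_continuous => x _; apply: derivableB.
rewrite in_itv/= sin0 !subr0 => /andP[c0 ch] ->; rewrite normrM (ger0_norm h0).
rewrite expr2; apply: ler_wpM2r => //; apply: (le_trans (abs_cosB1_le c)).
rewrite ger0_norm// in h1; nra.
Qed.

End real_functions.

(** * Integrals of the resolvent over rays *)

Section complex_bounds.
Variables (R : realType) (n : nat) (E : normedModType R).
Local Notation V := (cliff_mod n E).
Variable D : set (V -> V).
Local Notation alg := (balg D).
Local Notation iota := (cplx_map (bscale D)).
Implicit Types (X Y : cplx alg) (A B : alg) (z w : cplx R).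

Lemma opnorm_balgM A B (a b : R) : 0 <= a -> opnorm_le A a -> opnorm_le B b ->
  opnorm_le (A * B) (a * b).
Proof.
move=> a0 Aa Bb v; rewrite balgME; apply: (le_trans (Aa _)).
by rewrite -mulrA ler_wpM2l.
Qed.

Lemma opnorm_balgN A a : opnorm_le A a -> opnorm_le (- A) a.
Proof. by move=> Aa v; rewrite balgNE normrN. Qed.

Lemma opnorm_balgD A B (a b : R) : opnorm_le A a -> opnorm_le B b ->
  opnorm_le (A + B) (a + b).
Proof. by move=> Aa Bb; exact: opnorm_leD. Qed.

Lemma opnorm_scale (k c : R) : `|k| <= c -> opnorm_le (bscale D k) c.
Proof. by move=> kc v; rewrite bscaleE normrZ ler_wpM2r. Qed.

Lemma opnorm_balg0 (c : R) : 0 <= c -> opnorm_le (0 : alg) c.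
Proof. by move=> c0 v; rewrite balg0E normr0 mulr_ge0. Qed.

(** The two components are bounded separately, at the price of the factor 2 in [cleM]. *)
Definition cle X (c : R) : Prop := opnorm_le (re X) c /\ opnorm_le (im X) c.

Lemma cleD X Y (a b : R) : cle X a -> cle Y b -> cle (X + Y) (a + b).
Proof. by move=> [h1 h2] [h3 h4]; split; exact: opnorm_balgD. Qed.

Lemma cleN X (a : R) : cle X a -> cle (- X) a.
Proof. by move=> [h1 h2]; split; exact: opnorm_balgN. Qed.

Lemma cleW X (a b : R) : a <= b -> cle X a -> cle X b.
Proof. by move=> ab [h1 h2]; split; exact: opnorm_leW ab _. Qed.

Lemma cleM X Y (a b : R) : 0 <= a -> cle X a -> cle Y b -> cle (X * Y) (2 * (a * b)).
Proof.
move=> a0 [h1 h2] [h3 h4]; rewrite mulr_natl mulr2n; split; rewrite !cplxE.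
  by apply: opnorm_balgD; [|apply: opnorm_balgN]; exact: opnorm_balgM.
by apply: opnorm_balgD; exact: opnorm_balgM.
Qed.

Lemma cle_iota z (c : R) : `|re z| <= c -> `|im z| <= c -> cle (iota z) c.
Proof. by move=> h1 h2; split; exact: opnorm_scale. Qed.

Lemma cle_real A (c : R) : 0 <= c -> opnorm_le A c -> cle (creal A) c.
Proof. by move=> c0 Ac; split=> //; exact: opnorm_balg0. Qed.

End complex_bounds.

Definition polar (R : realType) (r psi : R) : cplx R := (r * cos psi, r * sin psi).

(** * Deformation of the ray *)

Section resolvent_family.
Variables (R : realType) (n : nat) (E : normedModType R).
Local Notation V := (cliff_mod n E).
Hypothesis V_reflexive : reflexive_space V.
Variable D : set (V -> V).
Local Notation alg := (balg D).
Local Notation bscale := (bscale D).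
Local Notation iota := (cplx_map bscale).

(* Rs z stands for (z - T)^{-1}, S for (1 + T^2)^{-1} and K for T (1 + T^2)^{-1} *)
Variables (S K : alg) (Rs : cplx R -> cplx alg) (phi c0 : R).
Hypothesis phi_itv : 0 < phi < pi / 2.
Hypothesis c0_ge0 : 0 <= c0.

(** The part of the complement of the double sector in the upper half plane; the lower half is
    reached by conjugation. *)
Definition in_sector (z : cplx R) : Prop := exists r psi,
  [/\ 0 < r, phi <= psi <= pi - phi & z = polar r psi].

Hypothesis Rs_resolvent : forall z w, in_sector z -> in_sector w ->
  Rs w - Rs z = iota (z - w) * Rs z * Rs w.
Hypothesis K_Rs : forall z, in_sector z ->
  creal K * Rs z = creal S * (iota z * Rs z - 1).
Hypothesis S_Rs : forall z, in_sector z ->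
  (1 - creal S) * Rs z = creal K * (iota z * Rs z - 1).
Hypothesis Rs_le : forall r psi, 0 < r -> phi <= psi <= pi - phi ->
  cle (Rs (polar r psi)) (c0 / r).
Hypothesis S_le : opnorm_le S c0.
Hypothesis K_le : opnorm_le K c0.

Let polar_sector r psi : 0 < r -> phi <= psi <= pi - phi -> in_sector (polar r psi).
Proof. by move=> r0 psiI; exists r, psi. Qed.

Let abs_cos_le (x : R) : `|cos x| <= 1. Proof. by rewrite ler_norml cos_geN1 cos_le1. Qed.
Let abs_sin1 (x : R) : `|sin x| <= 1. Proof. by rewrite ler_norml sin_geN1 sin_le1. Qed.

Let cle_c0 r a psi : 0 < a -> a <= r -> phi <= psi <= pi - phi ->
  cle (Rs (polar r psi)) (c0 / a).
Proof.
move=> a0 ar psiI; have r0 := lt_le_trans a0 ar.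
apply: cleW (Rs_le r0 psiI); apply: ler_wpM2l => //.
by rewrite lef_pV2.
Qed.

Lemma Rs_lipschitz a r r' psi : 0 < a -> a <= r -> a <= r' -> phi <= psi <= pi - phi ->
  cle (Rs (polar r psi) - Rs (polar r' psi)) (4 * (c0 / a) ^+ 2 * `|r - r'|).
Proof.
move=> a0 ar ar' psiI; have r0 := lt_le_trans a0 ar; have r'0 := lt_le_trans a0 ar'.
rewrite Rs_resolvent; try exact: polar_sector.
have ca0 : 0 <= c0 / a by rewrite divr_ge0// ltW.
have -> : 4 * (c0 / a) ^+ 2 * `|r - r'| = 2 * ((2 * (`|r - r'| * (c0 / a))) * (c0 / a)).
  by ring.
have zw : cle (iota (polar r' psi - polar r psi)) `|r - r'|.
  by apply: cle_iota; rewrite ?(reD, imD, reN, imN) /polar /re /im /= -mulrBl normrM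
     [`|r - r'|]distrC ler_piMr.
apply: cleM; [by apply: mulr_ge0 => //; exact: mulr_ge0| |exact: cle_c0].
by apply: cleM => //; exact: cle_c0.
Qed.

Section ray.
Variables (c : R -> cplx R) (psi : R).
Hypothesis psiI : phi <= psi <= pi - phi.
Hypothesis re_c : pos_continuous (fun r => re (c r)).
Hypothesis im_c : pos_continuous (fun r => im (c r)).

Definition ray_fun (r : R) : cplx alg := iota (c r) * Rs (polar r psi).

Lemma ray_fun_bounded a b : 0 < a -> exists2 M, 0 <= M & forall r, a <= r <= b ->
  cle (ray_fun r) M.
Proof.
move=> a0; have [M1 M10 H1] := pos_bounded b re_c a0; have [M2 M20 H2] := pos_bounded b im_c a0.
have ca0 : 0 <= c0 / a by rewrite divr_ge0// ltW.
exists (2 * ((M1 + M2) * (c0 / a))); first by apply: mulr_ge0 => //; apply: mulr_ge0 => //; exact: addr_ge0.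
move=> r rI; apply: cleM; first exact: addr_ge0.
  by apply: cle_iota; [apply: (le_trans (H1 r rI))|apply: (le_trans (H2 r rI))];
    rewrite ?lerDl ?lerDr.
by have /andP[ar _] := rI; exact: cle_c0.
Qed.

Lemma ray_fun_continuous a b eps : 0 < a -> 0 < eps ->
  exists2 delta, 0 < delta & forall r r', a <= r <= b -> a <= r' <= b ->
    `|r - r'| < delta -> cle (ray_fun r - ray_fun r') eps.
Proof.
move=> a0 e0; have [M1 M10 H1] := pos_bounded b re_c a0; have [M2 M20 H2] := pos_bounded b im_c a0.
have ca0 : 0 <= c0 / a by rewrite divr_ge0// ltW.
pose e1 := eps / 2 / (2 * (c0 / a) + 1).
have k0 : 0 < 2 * (c0 / a) + 1 by rewrite ltr_wpDl// mulr_ge0.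
have e10 : 0 < e1 by rewrite /e1 !divr_gt0.
have [d1 d10 C1] := pos_uniform_continuous b re_c a0 e10.
have [d2 d20 C2] := pos_uniform_continuous b im_c a0 e10.
pose L := 2 * ((M1 + M2) * (4 * (c0 / a) ^+ 2)).
have L0 : 0 <= L.
  apply: mulr_ge0 => //; apply: mulr_ge0; first exact: addr_ge0.
  by apply: mulr_ge0 => //; exact: sqr_ge0.
exists (Num.min (Num.min d1 d2) (eps / 2 / (L + 1))).
  by rewrite !lt_min d10 d20 !divr_gt0// ltr_wpDl.
move=> r r' rI r'I; rewrite !lt_min => /andP[/andP[rd1 rd2] rd3].
have -> : ray_fun r - ray_fun r' = iota (c r - c r') * Rs (polar r psi) +
    iota (c r') * (Rs (polar r psi) - Rs (polar r' psi)).
  by rewrite /ray_fun; ring.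
have /andP[ar _] := rI; have /andP[ar' _] := r'I.
rewrite (splitr eps); apply: cleD.
  apply: (@cleW _ _ _ _ _ (2 * (e1 * (c0 / a)))).
    have <- : e1 * (2 * (c0 / a) + 1) = eps / 2 by rewrite divfK// gt_eqF.
    by rewrite mulrDr mulr1 mulrCA lerDl ltW.
  apply: cleM; [exact: ltW| |exact: cle_c0].
  by apply: cle_iota; [exact: C1|exact: C2].
apply: (@cleW _ _ _ _ _ (L * `|r - r'|)).
  move: (ltW rd3); rewrite ler_pdivlMr ?ltr_wpDl//; have := normr_ge0 (r - r'); nra.
have -> : L * `|r - r'| = 2 * ((M1 + M2) * (4 * (c0 / a) ^+ 2 * `|r - r'|)).
  by rewrite /L; ring.
apply: cleM; first exact: addr_ge0.
  by apply: cle_iota; [apply: (le_trans (H1 r' r'I))|apply: (le_trans (H2 r' r'I))];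
    rewrite ?lerDl ?lerDr.
exact: Rs_lipschitz.
Qed.

Lemma ray_fun_re_antider : exists U, op_antider (fun r => re (ray_fun r)) U.
Proof.
apply: op_antider_ex => // [a b eps a0 e0|a b a0].
  have [d d0 H] := ray_fun_continuous b a0 e0; exists d => // r r' rI r'I rr'.
  by have [] := H r r' rI r'I rr'.
by have [M M0 H] := ray_fun_bounded b a0; exists M => r /H[].
Qed.

Lemma ray_fun_im_antider : exists U, op_antider (fun r => im (ray_fun r)) U.
Proof.
apply: op_antider_ex => // [a b eps a0 e0|a b a0].
  have [d d0 H] := ray_fun_continuous b a0 e0; exists d => // r r' rI r'I rr'.
  by have [] := H r r' rI r'I rr'.
by have [M M0 H] := ray_fun_bounded b a0; exists M => r /H[].
Qed.

End ray.

Let re_iota_real k X : re (iota (creal k) * X) = bscale k * re X.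
Proof. by rewrite reM /cplx_map /re /im /= rmorph0 mul0r subr0. Qed.

Let im_iota_real k X : im (iota (creal k) * X) = bscale k * im X.
Proof. by rewrite imM /cplx_map /re /im /= rmorph0 mul0r addr0. Qed.

Let im_iota_imag k X : im (iota (0, k) * X) = bscale k * re X.
Proof. by rewrite imM /cplx_map /re /im /= rmorph0 mul0r add0r. Qed.

(** [M] is holomorphic with [M' = - (1 - S) R^2], and [Gz z = z M'(z)]. In polar coordinates
    [r dM/dr = G] and [dM/dpsi = i G], so the radial derivative of [re M] is [re G / r] and the
    angular derivative of [im M] is [re G]. *)
Let Mz z : cplx alg := (1 - creal S) * Rs z.
Let Gz z : cplx alg := - ((1 - creal S) * iota z * (Rs z * Rs z)).

Let cle_1S : cle (1 - creal S) (1 + c0).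
Proof.
apply: cleD; last by apply: cleN; exact: cle_real.
by split; [move=> v; rewrite balg1E mul1r|exact: opnorm_balg0].
Qed.

Let c1 a : R := 2 * ((1 + c0) * (2 * ((c0 / a) * (c0 / a)))).

Let c1_ge0 a : 0 < a -> 0 <= c1 a.
Proof.
move=> a0; have ca0 : 0 <= c0 / a by rewrite divr_ge0// ltW.
apply: mulr_ge0 => //; apply: mulr_ge0; first exact: addr_ge0.
by apply: mulr_ge0 => //; exact: mulr_ge0.
Qed.

Let cle_SRR a r psi : 0 < a -> a <= r -> phi <= psi <= pi - phi ->
  cle ((1 - creal S) * (Rs (polar r psi) * Rs (polar r psi))) (c1 a).
Proof.
move=> a0 ar psiI; have ca0 : 0 <= c0 / a by rewrite divr_ge0// ltW.
have h := cle_c0 a0 ar psiI.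
by apply: cleM; [exact: addr_ge0|exact: cle_1S|exact: cleM].
Qed.

(** Two applications of the resolvent identity give the exact remainder
    [(z - w)^2 (1 - S) R_z^2 R_w]. *)
Let Mz_second_order a r r' psi psi' rho : 0 < a -> a <= r -> a <= r' ->
  phi <= psi <= pi - phi -> phi <= psi' <= pi - phi ->
  let z := polar r psi in let w := polar r' psi' in
  `|re (z - w)| <= rho -> `|im (z - w)| <= rho ->
  cle (Mz w - Mz z - (1 - creal S) * iota (z - w) * (Rs z * Rs z))
    (8 * c1 a * (c0 / a) * rho ^+ 2).
Proof.
move=> a0 ar ar' psiI psi'I z w h1 h2.
have ca0 : 0 <= c0 / a by rewrite divr_ge0// ltW.
have zs : in_sector z by apply: polar_sector => //; exact: lt_le_trans ar.
have ws : in_sector w by apply: polar_sector => //; exact: lt_le_trans ar'.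
have e := Rs_resolvent zs ws.
have -> : Mz w - Mz z - (1 - creal S) * iota (z - w) * (Rs z * Rs z) =
    ((1 - creal S) * (Rs z * Rs z)) * (Rs w * (iota (z - w) * iota (z - w))).
  transitivity ((1 - creal S) * (Rs w - Rs z) - (1 - creal S) * iota (z - w) * (Rs z * Rs z)).
    by rewrite /Mz; ring.
  have e2 : Rs w = Rs z + iota (z - w) * Rs z * Rs w by rewrite -e; ring.
  rewrite e {1}e2; ring.
have rho0 : 0 <= rho by exact: le_trans h1.
have zw : cle (iota (z - w)) rho by exact: cle_iota.
have -> : 8 * c1 a * (c0 / a) * rho ^+ 2 =
    2 * (c1 a * (2 * ((c0 / a) * (2 * (rho * rho))))) by ring.
apply: cleM; [exact: c1_ge0|exact: cle_SRR|].
by apply: cleM => //; [exact: cle_c0|exact: cleM].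
Qed.

Let y_quadratic psi a b : phi <= psi <= pi - phi -> 0 < a ->
  exists2 M, 0 <= M & forall r r' v, a <= r <= b -> a <= r' <= b ->
    `|re (Mz (polar r' psi)) v - re (Mz (polar r psi)) v
      - (r' - r) *: (r^-1 *: re (Gz (polar r psi)) v)| <= M * (r' - r) ^+ 2 * `|v|.
Proof.
move=> psiI a0; exists (8 * c1 a * (c0 / a)).
  by apply: mulr_ge0; [apply: mulr_ge0 => //; exact: c1_ge0|rewrite divr_ge0// ltW].
move=> r r' v /andP[ar rb] /andP[ar' r'b]; have r0 := lt_le_trans a0 ar.
have h1 : `|re (polar r psi - polar r' psi)| <= `|r' - r|.
  by rewrite reD reN /polar /re /= -mulrBl normrM [`|r' - r|]distrC ler_piMr.
have h2 : `|im (polar r psi - polar r' psi)| <= `|r' - r|.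
  by rewrite imD imN /polar /im /= -mulrBl normrM [`|r' - r|]distrC ler_piMr.
have [H _] := Mz_second_order a0 ar ar' psiI psiI h1 h2.
have {H} := H v; rewrite real_normK ?num_real// => H; apply: le_trans H.
rewrite le_eqVlt; apply/orP; left; apply/eqP; congr (`|_|).
rewrite scalerA -(bscaleE D) -balgME -!balgNE -!balgDE; congr (bfun _ _).
have -> : iota (polar r psi - polar r' psi) = iota (creal (- ((r' - r) / r))) * iota (polar r psi).
  rewrite -rmorphM; congr iota; congr pair; rewrite /polar /re /im /=.
    by field; rewrite gt_eqF.
  by field; rewrite gt_eqF.
rewrite 2!reD 2!reN; congr (_ - _ - _).
have -> : (1 - creal S) * (iota (creal (- ((r' - r) / r))) * iota (polar r psi)) *
    (Rs (polar r psi) * Rs (polar r psi)) =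
  iota (creal ((r' - r) / r)) * Gz (polar r psi).
  rewrite /Gz; have -> : iota (creal (- ((r' - r) / r))) = - iota (creal ((r' - r) / r)).
    by rewrite -rmorphN; congr iota; congr pair; rewrite oppr0.
  ring.
by symmetry; exact: re_iota_real.
Qed.

Let expi_remainder (h : R) : `|h| <= 1 ->
  `|cos h - 1| <= h ^+ 2 /\ `|sin h - h| <= h ^+ 2.
Proof. by move=> h1; split; [exact: abs_cosB1_le|exact: abs_sinB_le]. Qed.

Let p_quadratic a b : 0 < a -> exists2 M, 0 <= M &
  forall r psi psi' v, a <= r <= b -> phi <= psi <= pi - phi ->
    phi <= psi' <= pi - phi -> `|psi' - psi| <= 1 ->
    `|im (Mz (polar r psi')) v - im (Mz (polar r psi)) v
      - (psi' - psi) *: re (Gz (polar r psi)) v| <= M * (psi' - psi) ^+ 2 * `|v|.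
Proof.
move=> a0.
(* [3 |b| |h|] bounds the components of [z - w] and yields [M1] from the second order remainder;
   [M2] accounts for the deviation of the arc from its tangent. *)
pose M1 := 8 * c1 a * (c0 / a) * (3 * `|b|) ^+ 2; pose M2 := 2 * (2 * `|b| * c1 a).
have c10 := c1_ge0 a0.
have M10 : 0 <= M1.
  apply: mulr_ge0; last exact: sqr_ge0.
  by apply: mulr_ge0; [exact: mulr_ge0|rewrite divr_ge0// ltW].
have M20 : 0 <= M2 by apply: mulr_ge0 => //; apply: mulr_ge0 => //; exact: mulr_ge0.
exists (M1 + M2); first exact: addr_ge0.
move=> r psi psi' v /andP[ar rb] psiI psi'I; set h := psi' - psi => h1.
have r0 := lt_le_trans a0 ar.
have [hc hs] := expi_remainder h1.
have psi'E : psi' = psi + h by rewrite /h addrC subrK.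
set z := polar r psi; set w := polar r psi'.
(* [z - w = - z (e^(i h) - 1)]; the linear part [- i h z] is split off and [err] is the quadratic
   rest. *)
pose err : cplx R := - (z * (cos h - 1, sin h - h)).
have zwE : z - w = - ((0, h) : cplx R) * z + err.
  rewrite /err /z /w psi'E /polar; apply: cplx_eq; rewrite !cplxE /re /im /= ?(cosD psi h) ?(sinD psi h); ring.
have zb : `|re z| <= `|b| /\ `|im z| <= `|b|.
  have rb' : r <= `|b| by apply: le_trans rb (ler_norm _).
  by split; rewrite /z /polar /re /im /= normrM gtr0_norm//; apply: le_trans rb';
    rewrite ler_piMr// ltW.
have hh : h ^+ 2 <= `|h| by rewrite -real_normK ?num_real// expr2 ler_piMl.
have errb : `|re err| <= 2 * `|b| * h ^+ 2 /\ `|im err| <= 2 * `|b| * h ^+ 2.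
  have [zr zi] := zb; rewrite /err reN imN !normrN reM imM.
  have -> : 2 * `|b| * h ^+ 2 = `|b| * h ^+ 2 + `|b| * h ^+ 2 by ring.
  split; [apply: (le_trans (ler_normB _ _))|apply: (le_trans (ler_normD _ _))];
    by rewrite (normrM (re z)) (normrM (im z)); apply: lerD; apply: ler_pM.
have hz (x : R) : `|x| <= `|b| -> `|h * x| <= `|b| * `|h|.
  by move=> xb; rewrite normrM mulrC ler_wpM2r.
have zwb : `|re (z - w)| <= 3 * `|b| * `|h| /\ `|im (z - w)| <= 3 * `|b| * `|h|.
  rewrite zwE; have [e1 e2] := errb; have [z1 z2] := zb.
  have := ler_wpM2l (normr_ge0 b) hh => hb.
  have := hz _ z1; have := hz _ z2 => k1 k2.
  split; rewrite ?reD ?imD; apply: (le_trans (ler_normD _ _)).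
    rewrite reM reN imN {1}/re {1}/im /= oppr0 mul0r sub0r mulNr opprK.
    by apply: (le_trans (lerD k1 e1)); nra.
  rewrite imM reN imN {1}/re {2}/im /= oppr0 mul0r add0r mulNr normrN.
  by apply: (le_trans (lerD k2 e2)); nra.
have [zw1 zw2] := zwb.
have [_ H] := Mz_second_order a0 ar ar psiI psi'I zw1 zw2.
have {H} := H v; rewrite exprMn real_normK ?num_real// -/z -/w => H.
have [_ H2] : cle (iota err * ((1 - creal S) * (Rs z * Rs z)))
    (2 * ((2 * `|b| * h ^+ 2) * c1 a)).
  have [e1 e2] := errb; apply: cleM; last exact: cle_SRR.
    by apply: mulr_ge0; [exact: mulr_ge0|exact: sqr_ge0].
  exact: cle_iota.
have {H2} := H2 v => H2.
have -> : im (Mz w) v - im (Mz z) v - h *: re (Gz z) v =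
    im (Mz w - Mz z - (1 - creal S) * iota (z - w) * (Rs z * Rs z)) v +
    im (iota err * ((1 - creal S) * (Rs z * Rs z))) v.
  rewrite -(bscaleE D) -balgME -!balgNE -!balgDE; congr (bfun _ _).
  have -> : Mz w - Mz z - (1 - creal S) * iota (z - w) * (Rs z * Rs z) =
     Mz w - Mz z - (iota (0, h) * Gz z + iota err * ((1 - creal S) * (Rs z * Rs z))).
    by rewrite zwE /Gz; ring.
  rewrite !imD !imN !imD im_iota_imag; ring.
apply: (le_trans (ler_normD _ _)); apply: (le_trans (lerD H H2)).
by rewrite -mulrDl; apply: ler_wpM2r => //; rewrite /M1 /M2; lra.
Qed.


Definition expi (psi : R) : cplx R := (cos psi, sin psi).

Let im_creal (A : alg) X : im (creal A * X) = A * im X.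
Proof. by rewrite imM /creal /re /im /= mul0r addr0. Qed.

Let polar_expi (r psi : R) : polar r psi = creal r * expi psi.
Proof. by apply: cplx_eq; rewrite !cplxE /re /im /=; ring. Qed.

(** [K z R = M + K] by [S_Rs], and the second term has no imaginary part; division by [r] turns [z]
    into [e^(i psi)]. *)
Lemma K_ray_fun r psi v : 0 < r -> phi <= psi <= pi - phi ->
  K (im (ray_fun (fun=> expi psi) psi r) v) = r^-1 *: im (Mz (polar r psi)) v.
Proof.
move=> r0 psiI; rewrite -(bscaleE D) -!balgME; congr (bfun _ _).
rewrite -im_creal -im_iota_real /Mz S_Rs; last exact: polar_sector.
rewrite {1}polar_expi /ray_fun.
have -> : iota (creal r^-1) * (creal K * (iota (creal r * expi psi) * Rs (polar r psi) - 1)) =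
    iota (creal r^-1 * creal r) * (creal K * (iota (expi psi) * Rs (polar r psi)))
    - iota (creal r^-1) * creal K by ring.
have -> : creal r^-1 * creal r = 1.
  by apply: cplx_eq; rewrite !cplxE /re /im /=; field; rewrite gt_eqF.
by rewrite rmorph1 mul1r imD imN im_iota_real mulr0 subr0.
Qed.

(** The boundary terms of the deformation: [M] is of order [1 / r] at infinity, and
    [M = z S (z R - 1) - K] tends to [- K] at 0. *)
Let y_limit r psi v : 0 < r -> phi <= psi <= pi - phi ->
  `|re (Mz (polar r psi)) v| <= 2 * ((1 + c0) * c0) / r * `|v| /\
  `|re (Mz (polar r psi)) v + K v| <= 4 * (c0 * (2 * c0 + 1)) * r * `|v|.
Proof.
move=> r0 psiI; split.
  have [+ _] : cle (Mz (polar r psi)) (2 * ((1 + c0) * (c0 / r))).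
    by apply: cleM; [exact: addr_ge0|exact: cle_1S|exact: Rs_le].
  by move=> /(_ v); rewrite !mulrA.
have cz : cle (iota (polar r psi)) r.
  by apply: cle_iota; rewrite /polar /re /im /= normrM gtr0_norm// ler_piMr// ltW.
set z := polar r psi in cz *.
have cz1 : cle (iota z * Rs z - 1) (2 * c0 + 1).
  apply: cleD.
    have -> : 2 * c0 = 2 * (r * (c0 / r)) by field; rewrite gt_eqF.
    by apply: cleM; [exact: ltW|exact: cz|exact: Rs_le].
  apply: cleN; split; first by move=> w; rewrite balg1E mul1r.
  exact: opnorm_balg0.
have -> : re (Mz z) v + K v = re (iota z * (creal S * (iota z * Rs z - 1))) v.
  rewrite -balgDE; congr (bfun _ _).
  have -> : Mz z = iota z * (creal S * (iota z * Rs z - 1)) - creal K.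
    rewrite -K_Rs; last exact: polar_sector.
    rewrite /Mz S_Rs; last exact: polar_sector.
    ring.
  by rewrite reD reN subrK.
have [+ _] : cle (iota z * (creal S * (iota z * Rs z - 1))) (2 * (r * (2 * (c0 * (2 * c0 + 1))))).
  by apply: cleM; [exact: ltW|exact: cz|apply: cleM => //; exact: cle_real].
move=> /(_ v) /le_trans; apply; rewrite le_eqVlt; apply/orP; left; apply/eqP; ring.
Qed.

Let phi_ends : phi <= phi <= pi - phi /\ phi <= pi - phi <= pi - phi.
Proof. by rewrite !lexx; move: phi_itv; lra. Qed.

(* Moving the ray from the angle phi to the angle pi - phi: the derivative in  *)
(* psi of the integral is, by the Cauchy-Riemann equations, a boundary term.   *)
Lemma ray_deformation : exists U : R -> V -> V, forall v,
  antider (fun r => K (im (ray_fun (fun=> expi (pi - phi)) (pi - phi) r) v) -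
                    K (im (ray_fun (fun=> expi phi) phi r) v)) (U^~ v) /\
  total_incr (U^~ v) ((pi - 2 * phi) *: K v).
Proof.
have /choice[W HW] : forall psi, exists U, phi <= psi <= pi - phi ->
    op_antider (fun r => im (ray_fun (fun=> expi psi) psi r)) U.
  move=> psi; have [psiI|//] := boolP (phi <= psi <= pi - phi); last by exists (fun _ => id).
  have [|r _|U HU] := @ray_fun_im_antider (fun=> expi psi) psi psiI.
  - by move=> r _; exact: cst_continuous.
  - exact: cst_continuous.
  by exists U.
pose Vf psi (v : V) (r : R) : V := K (W psi r v).
have antV psi v : phi <= psi <= pi - phi ->
    antider (fun r => r^-1 *: im (Mz (polar r psi)) v) (Vf psi v).
  move=> psiI; apply: (@antider_ext _ _ (fun r => K (im (ray_fun (fun=> expi psi) psi r) v))).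
    by move=> r r0; rewrite K_ray_fun.
  exact: antider_comp (balg_linear K) K_le (op_antider_at v (HW psi psiI)).
exists (fun r v => Vf (pi - phi) v r - Vf phi v r) => v; have [e1 e2] := phi_ends; split.
  apply: (antider_ext _ (antiderB (antV _ v e2) (antV _ v e1))) => r r0.
  by rewrite !K_ray_fun.
(* The errors of the two boundary terms: [re M] at [b], and [re M + K] at [a]. *)
pose delta a b := 2 * ((1 + c0) * c0) / b + 4 * (c0 * (2 * c0 + 1)) * a.
have main a b : 0 < a -> a <= b ->
    `|(Vf (pi - phi) v b - Vf phi v b) - (Vf (pi - phi) v a - Vf phi v a) -
      (pi - 2 * phi) *: K v| <= delta a b * `|v| * (pi - phi - phi).
  move=> a0 ab; have b0 := lt_le_trans a0 ab.
  (* The angular derivative of [f] is [re M(b) v - (re M(a) v + K v)], of norm at most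
     [delta a b * |v|], so [f] is nearly constant. *)
  pose f psi := Vf psi v b - Vf psi v a - psi *: K v.
  have -> : (Vf (pi - phi) v b - Vf phi v b) - (Vf (pi - phi) v a - Vf phi v a) -
      (pi - 2 * phi) *: K v = f (pi - phi) - f phi.
    by rewrite /f; module.
  have [M M0 HM] := p_quadratic b a0.
  apply: (@subdivision_le _ _ _ _ _ _ (M * `|v| / a * (b - a))).
  - by case/andP: e1.
  - by rewrite mulr_ge0 ?subr_ge0// divr_ge0 ?mulr_ge0// ltW.
  move=> x y phix xy ypi yx1.
  have xI : phi <= x <= pi - phi by rewrite phix (le_trans xy).
  have yI : phi <= y <= pi - phi by rewrite ypi (le_trans phix).
  (* The angular derivative of the integrand [im M / r] is [re G / r], which integrates to
     [re M]. *)
  have yq : antider (fun r => r^-1 *: re (Gz (polar r x)) v) (fun r => re (Mz (polar r x)) v).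
    apply: antider_quadratic => a' b' a'0.
    have [M' M'0 HM'] := y_quadratic b' xI a'0; exists (M' * `|v|); first exact: mulr_ge0.
    by move=> t t' tI t'I; rewrite mulrAC; exact: HM'.
  have := antider_lip (c := M * `|v| / a * (y - x) ^+ 2)
    (antiderB (antiderB (antV y v yI) (antV x v xI)) (antiderZ (y - x) yq)) a0 ab.
  move=> H; have {}H := H _.
  have h : `|(Vf y v b - Vf x v b - (y - x) *: re (Mz (polar b x)) v) -
      (Vf y v a - Vf x v a - (y - x) *: re (Mz (polar a x)) v)| <=
      M * `|v| / a * (y - x) ^+ 2 * (b - a).
    apply: H => r /andP[ar rb]; have r0 := lt_le_trans a0 ar.
    have yx : `|y - x| <= 1 by rewrite ger0_norm ?subr_ge0.
    have := HM r x y v; rewrite ar rb => /(_ isT xI yI yx) h.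
    rewrite scalerA mulrC -scalerA -!scalerBr normrZ gtr0_norm ?invr_gt0//.
    apply: (@le_trans _ _ (a^-1 * (M * (y - x) ^+ 2 * `|v|))).
      apply: ler_pM => //; first by rewrite invr_ge0 ltW.
      by rewrite lef_pV2.
    by rewrite le_eqVlt; apply/orP; left; apply/eqP; ring.
  have -> : f y - f x =
    ((Vf y v b - Vf x v b - (y - x) *: re (Mz (polar b x)) v) -
      (Vf y v a - Vf x v a - (y - x) *: re (Mz (polar a x)) v)) +
    (y - x) *: (re (Mz (polar b x)) v - (re (Mz (polar a x)) v + K v)).
    by rewrite /f; module.
  apply: (le_trans (ler_normD _ _)); rewrite addrC; apply: lerD; last first.
    by apply: (le_trans h); rewrite le_eqVlt; apply/orP; left; apply/eqP; ring.
  rewrite normrZ ger0_norm ?subr_ge0// mulrC; apply: ler_wpM2r; first by rewrite subr_ge0.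
  rewrite /delta mulrDl; apply: (le_trans (ler_normB _ _)).
  have [k1 _] := y_limit v b0 xI; have [_ k2] := y_limit v a0 xI.
  exact: lerD.
move=> e e0.
pose c2 := 2 * ((1 + c0) * c0); pose c3 := 4 * (c0 * (2 * c0 + 1)).
have c20 : 0 <= c2 by rewrite mulr_ge0// mulr_ge0// addr_ge0.
have c30 : 0 <= c3 by rewrite mulr_ge0// mulr_ge0// addr_ge0// mulr_ge0.
pose N := `|v| * (pi - phi - phi).
have N0 : 0 <= N by rewrite mulr_ge0//; move: phi_itv; lra.
pose L := 2 * (c2 + c3 + 1) * (N + 1).
have L0 : 0 < L by rewrite mulr_gt0 ?ltr_wpDl// mulr_gt0// ltr_wpDl// addr_ge0.
pose eta := Num.min 1 (e / L).
have eta0 : 0 < eta by rewrite lt_min ltr01 divr_gt0.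
exists eta, eta^-1; split=> //; first by rewrite invr_gt0.
move=> a b a0 aeta etab.
have eta1 : eta <= 1 by rewrite ge_min lexx.
have ab : a <= b.
  by rewrite (le_trans aeta)// (le_trans eta1)// (le_trans _ etab)// invf_ge1.
apply: (le_trans (main a b a0 ab)).
have b0 := lt_le_trans a0 ab.
have bi : b^-1 <= eta by rewrite invf_ple ?posrE.
have d1 : delta a b <= (c2 + c3) * eta.
  by rewrite /delta -/c2 -/c3 mulrDl; apply: lerD; apply: ler_wpM2l.
rewrite -mulrA -/N; apply: (le_trans (ler_wpM2r N0 d1)).
have etaL : eta * L <= e by rewrite -ler_pdivlMr// ge_min lexx orbT.
apply: le_trans etaL; rewrite mulrAC [leRHS]mulrC; apply: ler_wpM2r; first exact: ltW.
rewrite /L; have := mulr_ge0 c20 N0; have := mulr_ge0 c30 N0; nra.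
Qed.

End resolvent_family.

(** * Calculus of complex valued functions *)

Section complex_functions.
Variable R : realType.
Implicit Types (f g : R -> R) (c d : R -> cplx R) (z w : cplx R) (r : R).

Definition csq z : R := re z ^+ 2 + im z ^+ 2.
Definition cinv z : cplx R := (re z / csq z, - im z / csq z).

Lemma cinvM z : csq z != 0 -> z * cinv z = 1.
Proof.
rewrite /csq => z0; apply: cplx_eq; rewrite !cplxE /cinv /re /im /= /csq /re /im /=; field; exact: z0.
Qed.

Lemma csqM z w : csq (z * w) = csq z * csq w.
Proof. by rewrite /csq !cplxE; ring. Qed.

Lemma csqX z k : csq (z ^+ k) = csq z ^+ k.
Proof.
elim: k => [|k IH]; last by rewrite !exprS csqM IH.
by rewrite !expr0 /csq re1 im1 expr1n expr0n addr0.
Qed.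

Lemma csq_ge0 z : 0 <= csq z. Proof. by rewrite addr_ge0 ?sqr_ge0. Qed.

Lemma abs_re_le z : `|re z| <= Num.sqrt (csq z).
Proof. by rewrite -sqrtr_sqr ler_wsqrtr// lerDl sqr_ge0. Qed.

Lemma abs_im_le z : `|im z| <= Num.sqrt (csq z).
Proof. by rewrite -sqrtr_sqr ler_wsqrtr// lerDr sqr_ge0. Qed.

Lemma is_derive_mul f g r (f' g' : R) : is_derive r 1 f f' -> is_derive r 1 g g' ->
  is_derive r 1 (fun x => f x * g x) (f' * g r + f r * g').
Proof.
move=> fd gd; have := is_deriveM fd gd; rewrite /GRing.scale /= => h.
by rewrite [f' * _]mulrC addrC.
Qed.

Lemma is_derive_inv g r (g' : R) : g r != 0 -> is_derive r 1 g g' ->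
  is_derive r 1 (fun x => (g x)^-1) (- g' / g r ^+ 2).
Proof.
move=> g0 gd; have := is_deriveV g0 gd; rewrite /GRing.scale /= => h.
by rewrite mulrC mulrN -mulNr.
Qed.

Definition cderiv c r z : Prop :=
  is_derive r 1 (fun x => re (c x)) (re z) /\ is_derive r 1 (fun x => im (c x)) (im z).

Lemma cderiv_eq c r z w : z = w -> cderiv c r z -> cderiv c r w.
Proof. by move=> ->. Qed.

Lemma cderivM c d r z w : cderiv c r z -> cderiv d r w ->
  cderiv (fun x => c x * d x) r (z * d r + c r * w).
Proof.
move=> [c1 c2] [d1 d2]; split; rewrite !cplxE.
  have := is_deriveB (is_derive_mul c1 d1) (is_derive_mul c2 d2).
  move=> h; apply: is_derive_eq; ring.
have := is_deriveD (is_derive_mul c1 d2) (is_derive_mul c2 d1).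
move=> h; apply: is_derive_eq; ring.
Qed.

Lemma cderivD c d r z w : cderiv c r z -> cderiv d r w ->
  cderiv (fun x => c x + d x) r (z + w).
Proof. by move=> [c1 c2] [d1 d2]; split; exact: is_deriveD. Qed.

Lemma cderiv_cst z r : cderiv (fun=> z) r 0.
Proof. by split; exact: is_derive_cst. Qed.

Lemma cderivX c r z k : cderiv c r z ->
  cderiv (fun x => c x ^+ k.+1) r (k.+1%:R * c r ^+ k * z).
Proof.
move=> cz; elim: k => [|k IH].
  by rewrite expr0 !mul1r.
apply: cderiv_eq (cderivM cz IH); rewrite -(natr1 k.+1) [c r ^+ k.+1]exprS; ring.
Qed.

Lemma cderiv_inv c r z : csq (c r) != 0 -> cderiv c r z ->
  cderiv (fun x => cinv (c x)) r (- z * cinv (c r) ^+ 2).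
Proof.
move=> c0 [c1 c2].
have sq : is_derive r 1 (fun x => csq (c x)) (2 * (re z * re (c r) + im z * im (c r))).
  have := is_deriveD (is_derive_mul c1 c1) (is_derive_mul c2 c2) => h.
  apply: is_derive_eq; ring.
have sqi := @is_derive_inv (fun x => csq (c x)) r _ c0 sq.
have cE : csq (c r) = re (c r) ^+ 2 + im (c r) ^+ 2 by [].
rewrite cE in c0; split.
  have := is_derive_mul c1 sqi => h; apply: is_derive_eq.
  rewrite expr2 !cplxE /cinv /re /im /= -/(re z) -/(im z) -/(re (c r)) -/(im (c r)) cE.
  by field.
have := is_derive_mul (is_deriveN c2) sqi => h; apply: is_derive_eq.
rewrite expr2 !cplxE /cinv /re /im /= -/(re z) -/(im z) -/(re (c r)) -/(im (c r)) cE.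
by rewrite [X in _ + X * _ = _](_ : _ = - im (c r))//; field.
Qed.

Definition ccvg (F : set_system R) c z : Prop :=
  re (c r) @[r --> F] --> re z /\ im (c r) @[r --> F] --> im z.

Definition pos_ccontinuous c : Prop :=
  pos_continuous (fun r => re (c r)) /\ pos_continuous (fun r => im (c r)).

Lemma pos_ccontinuousM c d : pos_ccontinuous c -> pos_ccontinuous d ->
  pos_ccontinuous (fun r => c r * d r).
Proof.
move=> [c1 c2] [d1 d2]; split=> r r0.
  have h1 := c1 r r0; have h2 := c2 r r0; have h3 := d1 r r0; have h4 := d2 r r0.
  by apply: (@continuousB _ _ _ (fun r => re (c r) * re (d r)) (fun r => im (c r) * im (d r)));
    exact: continuousM.
have h1 := c1 r r0; have h2 := c2 r r0; have h3 := d1 r r0; have h4 := d2 r r0.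
by apply: (@continuousD _ _ _ (fun r => re (c r) * im (d r)) (fun r => im (c r) * re (d r)));
  exact: continuousM.
Qed.

Lemma pos_ccontinuous_cst z : pos_ccontinuous (fun=> z).
Proof. by split=> r r0; exact: cst_continuous. Qed.

Lemma pos_ccontinuousX c k : pos_ccontinuous c -> pos_ccontinuous (fun r => c r ^+ k).
Proof.
move=> cc; elim: k => [|k IH]; first exact: pos_ccontinuous_cst.
have -> : (fun r => c r ^+ k.+1) = (fun r => c r * c r ^+ k).
  by apply/funext => r; rewrite exprS.
exact: pos_ccontinuousM.
Qed.

Lemma cderiv_ccontinuous c d : (forall r, 0 < r -> cderiv c r (d r)) -> pos_ccontinuous c.
Proof.
move=> cd; split; [apply: (@derive_pos_continuous _ _ (fun r => re (d r)))|
  apply: (@derive_pos_continuous _ _ (fun r => im (d r)))] => r /cd[] //.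
Qed.

Section limits.
Context {F : set_system R} {FF : ProperFilter F}.

Lemma ccvgM c d z w : ccvg F c z -> ccvg F d w -> ccvg F (fun r => c r * d r) (z * w).
Proof.
move=> [c1 c2] [d1 d2]; split; rewrite cplxE.
  by apply: cvgB; exact: cvgM.
by apply: cvgD; exact: cvgM.
Qed.

Lemma ccvgB c d z w : ccvg F c z -> ccvg F d w -> ccvg F (fun r => c r - d r) (z - w).
Proof. by move=> [c1 c2] [d1 d2]; split; exact: cvgB. Qed.

Lemma ccvg_cst z : ccvg F (fun=> z) z.
Proof. by split; exact: cvg_cst. Qed.

Lemma ccvgX c z k : ccvg F c z -> ccvg F (fun r => c r ^+ k) (z ^+ k).
Proof.
move=> cz; elim: k => [|k IH]; first exact: ccvg_cst.
rewrite exprS; have -> : (fun r => c r ^+ k.+1) = (fun r => c r * c r ^+ k).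
  by apply/funext => r; rewrite exprS.
exact: ccvgM.
Qed.

End limits.
End complex_functions.

(** * Scalar integrals over a boundary ray *)

Section sector_functions.
Variables (R : realType) (phi : R).
Hypothesis phi_itv : 0 < phi < pi / 2.
Implicit Types (r : R).

Let z r : cplx R := polar r phi.
Let e : cplx R := expi phi.

Definition kappa r : cplx R := cinv (1 + polar r phi ^+ 2).

Lemma cos_phi_gt0 : 0 < cos phi.
Proof. by apply: cos_gt0_pihalf; move: phi_itv; have := pi_gt0 R; lra. Qed.

Lemma sin_phi_gt0 : 0 < sin phi.
Proof. by apply: sin_gt0_pi; move: phi_itv; have := pi_gt0 R; lra. Qed.

Lemma csq_polar r psi : csq (polar r psi) = r ^+ 2.
Proof. by rewrite /csq /polar /re /im /= !exprMn -mulrDr cos2Dsin2 mulr1. Qed.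

(** The right side exceeds the left one by [(1 - r^2)^2 sin(phi)^2]. So [1 + z^2] does not vanish on
    the ray and [kappa] decays like [1 / (1 + r^2)]. *)
Lemma csq_1z2_ge r : (1 + r ^+ 2) ^+ 2 * cos phi ^+ 2 <= csq (1 + z r ^+ 2).
Proof.
have := cos2Dsin2 phi; rewrite /csq expr2 !cplxE /z /polar /re /im /= => h.
have s2 : sin phi ^+ 2 = 1 - cos phi ^+ 2 by rewrite -h; ring.
have -> : (1 + (r * cos phi * (r * cos phi) - r * sin phi * (r * sin phi))) ^+ 2 +
   (0 + (r * cos phi * (r * sin phi) + r * sin phi * (r * cos phi))) ^+ 2 =
   1 + 2 * r ^+ 2 * (cos phi ^+ 2 - sin phi ^+ 2) +
   r ^+ 2 ^+ 2 * (cos phi ^+ 2 + sin phi ^+ 2) ^+ 2 by ring.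
rewrite h s2; have : 0 <= (1 - r ^+ 2) ^+ 2 * (1 - cos phi ^+ 2).
  by rewrite mulr_ge0 ?sqr_ge0// -s2 sqr_ge0.
by lra.
Qed.

Lemma csq_1z2_gt0 r : 0 < csq (1 + z r ^+ 2).
Proof.
apply: lt_le_trans (csq_1z2_ge r); rewrite mulr_gt0// exprn_gt0 ?cos_phi_gt0//.
by rewrite ltr_pwDl// sqr_ge0.
Qed.

Lemma kappaM r : (1 + z r ^+ 2) * kappa r = 1.
Proof. by rewrite cinvM// gt_eqF// csq_1z2_gt0. Qed.

Lemma csq_kappa r : csq (kappa r) <= ((1 + r ^+ 2) * cos phi)^-1 ^+ 2.
Proof.
have := congr1 (@csq R) (kappaM r); rewrite csqM {3}/csq re1 im1 expr1n expr0n addr0 => h.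
have c0 := csq_1z2_gt0 r; rewrite exprVn exprMn.
have -> : csq (kappa r) = (csq (1 + z r ^+ 2))^-1.
  by apply: (mulfI (lt0r_neq0 c0)); rewrite h mulfV// gt_eqF.
rewrite lef_pV2 ?posrE ?csq_1z2_ge// mulr_gt0// exprn_gt0 ?cos_phi_gt0//.
by rewrite ltr_pwDl// sqr_ge0.
Qed.

Lemma deriv_z r : cderiv z r e.
Proof.
split; rewrite /z /polar /e /expi /re /im /=.
  have := is_derive_mul (is_derive_id r 1) (is_derive_cst (cos phi) r 1) => h.
  by apply: is_derive_eq; rewrite mul1r mulr0 addr0.
have := is_derive_mul (is_derive_id r 1) (is_derive_cst (sin phi) r 1) => h.
by apply: is_derive_eq; rewrite mul1r mulr0 addr0.
Qed.

Lemma deriv_kappa r : cderiv kappa r (- (2 * z r * e) * kappa r ^+ 2).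
Proof.
apply: (@cderiv_inv _ (fun r => 1 + z r ^+ 2)); first by rewrite gt_eqF// csq_1z2_gt0.
apply: cderiv_eq (cderivD (cderiv_cst 1 r) (cderivX 1 (deriv_z r))).
by rewrite add0r expr1.
Qed.

Lemma deriv_pow_kappa r k : cderiv (fun r => kappa r ^+ k.+1) r
  (- (2 * k.+1%:R) * (e * z r * kappa r ^+ k.+2)).
Proof.
apply: cderiv_eq (cderivX k (deriv_kappa r)).
by rewrite -(addn2 k) exprD; ring.
Qed.

Lemma deriv_zpow_kappa r a b : cderiv (fun r => z r ^+ a.+1 * kappa r ^+ b.+1) r
  (a.+1%:R * (e * z r ^+ a * kappa r ^+ b.+1) - 2 * b.+1%:R * (e * z r ^+ a.+2 * kappa r ^+ b.+2)).
Proof.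
apply: cderiv_eq (cderivM (cderivX a (deriv_z r)) (deriv_pow_kappa r b)).
by rewrite -(addn2 a) exprD (exprS _ a); ring.
Qed.

Lemma cvg0_le (g : R -> R) (l C : R) : 0 <= C ->
  (forall r, 0 < r -> r < 1 -> `|g r - l| <= C * r) -> g r @[r --> 0^'+] --> l.
Proof.
move=> C0 H; apply/cvgrPdist_le => eps e0.
have d0 : 0 < Num.min 1 (eps / (C + 1)) by rewrite lt_min ltr01 divr_gt0// ltr_wpDl.
near=> r; have r0 : 0 < r by near: r; exact: nbhs_right_gt.
have : r < Num.min 1 (eps / (C + 1)) by near: r; exact: nbhs_right_lt.
rewrite lt_min => /andP[r1]; rewrite ltr_pdivlMr ?ltr_wpDl// => re.
by rewrite distrC; apply: (le_trans (H r r0 r1)); lra.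
Unshelve. all: by end_near. Qed.

Lemma cvgy_le (g : R -> R) (l C : R) : 0 <= C ->
  (forall r, 1 <= r -> `|g r - l| <= C / r) -> g r @[r --> +oo] --> l.
Proof.
move=> C0 H; apply/cvgrPdist_le => eps e0; near=> r.
have r1 : 1 <= r by near: r; apply: nbhs_pinfty_ge; rewrite num_real.
have rC : C / eps <= r by near: r; apply: nbhs_pinfty_ge; rewrite num_real.
have r0 : 0 < r by apply: lt_le_trans r1.
rewrite distrC; apply: (le_trans (H r r1)).
by rewrite ler_pdivrMr// mulrC -ler_pdivrMr.
Unshelve. all: by end_near. Qed.

Lemma sqrt_csq_kappa r : Num.sqrt (csq (kappa r)) <= ((1 + r ^+ 2) * cos phi)^-1.
Proof.
have p0 : 0 <= ((1 + r ^+ 2) * cos phi)^-1.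
  by rewrite invr_ge0 mulr_ge0 ?addr_ge0 ?sqr_ge0// ltW// cos_phi_gt0.
by rewrite -(ger0_norm p0) -sqrtr_sqr ler_wsqrtr// csq_kappa.
Qed.

Let z2kappa r : z r ^+ 2 * kappa r = 1 - kappa r.
Proof. by have := kappaM r; rewrite mulrDl mul1r => <-; rewrite addrAC subrr add0r. Qed.

Lemma kappa_lim0 : ccvg 0^'+ kappa 1.
Proof.
have c0 := cos_phi_gt0.
have H r : 0 < r -> r < 1 -> Num.sqrt (csq (1 - kappa r)) <= (cos phi)^-1 * r.
  move=> r0 r1; rewrite -z2kappa csqM csqX csq_polar sqrtrM ?sqr_ge0//.
  rewrite sqrtr_sqr ger0_norm ?sqr_ge0//.
  apply: (le_trans (ler_wpM2l (sqr_ge0 r) (sqrt_csq_kappa r))).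
  rewrite invfM mulrA [leRHS]mulrC; apply: ler_wpM2r; first by rewrite invr_ge0 ltW.
  have r2 : 0 < 1 + r ^+ 2 by rewrite ltr_pwDl// sqr_ge0.
  by rewrite ler_pdivrMr//; nra.
split; apply: (@cvg0_le _ _ (cos phi)^-1); rewrite ?invr_ge0 ?(ltW c0)// => r r0 r1.
  by rewrite distrC -reN -reD; apply: le_trans (H r r0 r1); exact: abs_re_le.
by rewrite distrC -imN -imD; apply: le_trans (H r r0 r1); exact: abs_im_le.
Qed.

Lemma kappa_limy : ccvg +oo kappa 0.
Proof.
have c0 := cos_phi_gt0.
have H r : 1 <= r -> Num.sqrt (csq (kappa r)) <= (cos phi)^-1 / r.
  move=> r1; have r0 : 0 < r by exact: lt_le_trans r1.
  apply: (le_trans (sqrt_csq_kappa r)); rewrite invfM mulrC; apply: ler_wpM2l.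
    by rewrite invr_ge0 ltW.
  have r2 : 0 < 1 + r ^+ 2 by rewrite ltr_pwDl// sqr_ge0.
  by rewrite lef_pV2//; nra.
split; apply: (@cvgy_le _ _ (cos phi)^-1); rewrite ?invr_ge0 ?(ltW c0)// => r r1.
  by rewrite subr0; apply: le_trans (H r r1); exact: abs_re_le.
by rewrite subr0; apply: le_trans (H r r1); exact: abs_im_le.
Qed.

(* the integrals of Im (e z^a / (1 + z^2)^b) over the ray vanish *)
Let im_natr k (w : cplx R) : im (k%:R * w) = k%:R * im w.
Proof. by rewrite !mulr_natl; elim: k => [|k IH]; rewrite ?mulr0n// !mulrS imD IH. Qed.

(** For [j = 0] the primitive is the imaginary part of a real multiple of [kappa^(b - 1)], whose
    limits are real. The step is an integration by parts with [z^(a + 1) kappa^(k + 1)], which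
    lowers the exponent of [z] by 2 and that of [kappa] by 1. *)
Lemma odd_antiderivative j b : (j.+2 <= b)%N -> exists A : R -> R,
  [/\ forall r, 0 < r -> is_derive r 1 A (im (e * z r ^+ j.*2.+1 * kappa r ^+ b)),
      A r @[r --> 0^'+] --> 0 & A r @[r --> +oo] --> 0].
Proof.
elim: j b => [|j IH] b.
  case: b => [//|[//|k]] _; pose k2 : R := (2 * k.+1)%:R.
  have k20 : k2 != 0 by rewrite pnatr_eq0.
  exists (fun r => - k2^-1 * im (kappa r ^+ k.+1)); split.
  - move=> r r0; have [_ h] := deriv_pow_kappa r k.
    have := is_deriveZ (- k2^-1) h => h'; apply: is_derive_eq.
    have -> : - (2 * k.+1%:R) = - (2 * k.+1)%:R :> cplx R by rewrite natrM.
    rewrite mulNr imN im_natr -/k2 -[LHS]/(- k2^-1 * _).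
    by rewrite mulrN mulNr opprK mulrA mulVf// mul1r.
  - have [_ h] := ccvgX k.+1 kappa_lim0; rewrite expr1n im1 in h.
    by rewrite -[X in _ --> X](mulr0 (- k2^-1)); exact: cvgMr.
  - have [_ h] := ccvgX k.+1 kappa_limy; rewrite expr0n /= in h.
    by rewrite -[X in _ --> X](mulr0 (- k2^-1)); exact: cvgMr.
case: b => [//|[//|k]]; rewrite !ltnS => jk.
have [A [A1 A2 A3]] := IH k.+1 jk.
pose k2 : R := (2 * k.+1)%:R; have k20 : k2 != 0 by rewrite pnatr_eq0.
pose a := j.*2.+1.
exists (fun r => k2^-1 * (a.+1%:R * A r - im (z r ^+ a.+1 * kappa r ^+ k.+1))).
(* Since [z^2 kappa = 1 - kappa], the boundary term is [(1 - kappa)^(j + 1) kappa^(k - j)], whose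
   limits follow from those of [kappa]. *)
have lim (F : set_system R) (l : cplx R) : ProperFilter F ->
    A r @[r --> F] --> 0 -> ccvg F kappa l -> im ((1 - l) ^+ j.+1 * l ^+ (k - j)) = 0 ->
    k2^-1 * (a.+1%:R * A r - im (z r ^+ a.+1 * kappa r ^+ k.+1)) @[r --> F] --> 0.
  move=> FF A0 kl l0.
  rewrite -[X in _ --> X](mulr0 k2^-1); apply: cvgMr.
  rewrite -[X in _ --> X](subr0 0); apply: cvgB.
    by rewrite -[X in _ --> X](mulr0 a.+1%:R); exact: cvgMr.
  have [_ h] := ccvgM (ccvgX j.+1 (ccvgB (ccvg_cst 1) kl)) (ccvgX (k - j) kl).
  rewrite l0 in h; apply: cvg_trans h; apply: near_eq_cvg; apply: nearW => r.
  rewrite -z2kappa exprMn -exprM -mulrA -exprD.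
  have -> : (j.+1 + (k - j) = k.+1)%N by rewrite addSn (subnKC (ltnW jk)).
  by rewrite /a -doubleS -mul2n.
split.
- move=> r r0; have [_ h] := deriv_zpow_kappa r a k.
  have h1 := is_deriveZ a.+1%:R (A1 r r0).
  have := is_deriveZ k2^-1 (is_deriveB h1 h) => h2; apply: is_derive_eq.
  have -> : 2 * k.+1%:R = (2 * k.+1)%:R :> cplx R by rewrite natrM.
  rewrite imD imN !im_natr -/k2 -/a -[LHS]/(k2^-1 * (_ * _ - _)) opprB addrCA subrr addr0.
  by rewrite mulrA mulVf// mul1r doubleS.
- by apply: (lim _ _ _ A2 kappa_lim0); rewrite subrr expr0n mul0r.
- apply: (lim _ _ _ A3 kappa_limy).
  by rewrite subr0 expr1n mul1r expr0n subn_eq0 leqNgt jk.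
Qed.

Let ek_im r : im (e * (z r * kappa r)) = r * (2 * cos phi * sin phi) / csq (1 + z r ^+ 2).
Proof.
have -> : e * (z r * kappa r) = e * z r * kappa r by rewrite mulrA.
have im_div (X W : cplx R) : im (X * cinv W) = (im X * re W - re X * im W) / csq W.
  by rewrite imM /cinv {2}/re {2}/im /=; ring.
rewrite im_div -/(z r); congr (_ / _).
rewrite expr2 !cplxE /z /e /expi /polar /re /im /=.
ring.
Qed.

(* the integral of Im (e z / (1 + z^2)) over the ray is phi, half the argument *)
(* swept by 1 + z^2 *)
Lemma log_antiderivative : exists A : R -> R,
  [/\ forall r, 0 < r -> is_derive r 1 A (im (e * (z r * kappa r))),
      A r @[r --> 0^'+] --> pi / 4 - phi & A r @[r --> +oo] --> pi / 4].
Proof.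
have c0 := cos_phi_gt0; have s0 := sin_phi_gt0.
pose s2 := 2 * cos phi * sin phi; pose c2 := cos phi ^+ 2 - sin phi ^+ 2.
have s20 : 0 < s2 by rewrite /s2 !mulr_gt0.
have cs : c2 ^+ 2 + s2 ^+ 2 = 1.
  have := cos2Dsin2 phi => h; transitivity ((cos phi ^+ 2 + sin phi ^+ 2) ^+ 2).
    by rewrite /c2 /s2; ring.
  by rewrite h expr1n.
pose q r := (r ^+ 2 + c2) / s2.
have qD r : is_derive r 1 q (2 * r / s2).
  have h1 := is_derive_mul (is_derive_id r 1) (is_derive_id r 1).
  have := is_derive_mul (is_deriveD h1 (is_derive_cst c2 r 1)) (is_derive_cst s2^-1 r 1) => h.
  have -> : q = (fun x => (x * x + c2) * s2^-1) by apply/funext => x; rewrite /q expr2.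
  by apply: is_derive_eq; rewrite mulr0 !addr0 mulr1 mul1r /cst; ring.
exists (fun r => 2^-1 * atan (q r)); split.
- move=> r r0; have h := is_derive1_comp (is_derive1_atan (q r)) (qD r).
  have := is_deriveZ 2^-1 h => h'; apply: is_derive_eq.
  rewrite ek_im -/s2 [LHS]/GRing.scale /=.
  have -> : csq (1 + z r ^+ 2) = s2 ^+ 2 + (r ^+ 2 + c2) ^+ 2.
    transitivity (1 + 2 * r ^+ 2 * c2 + r ^+ 2 ^+ 2 * (cos phi ^+ 2 + sin phi ^+ 2) ^+ 2).
      rewrite /csq expr2 !cplxE /z /polar /re /im /= /c2; ring.
    by rewrite cos2Dsin2 expr1n mulr1 -{1}cs; ring.
  have p0 : 0 < s2 ^+ 2 + (r ^+ 2 + c2) ^+ 2 by rewrite ltr_pwDl ?exprn_gt0 ?sqr_ge0.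
  by rewrite /q; field; rewrite !gt_eqF.
- have -> : pi / 4 - phi = 2^-1 * atan (c2 / s2).
    have -> : c2 / s2 = tan (pi / 2 - (phi + phi)).
      rewrite /tan sinB cosB sin_pihalf cos_pihalf !mul1r !mul0r subr0 add0r cosD sinD.
      by rewrite /c2 /s2; congr (_ / _); ring.
    rewrite tanK ?in_itv/=; first by field.
    by move: phi_itv; lra.
  have qc : {for 0, continuous (fun r => 2^-1 * atan (q r))}.
    apply: (@continuousM _ _ (fun=> 2^-1) (fun r => atan (q r))).
      exact: cst_continuous.
    apply: continuous_comp; last exact: continuous_atan.
    by have [qd _] := qD 0; apply: differentiable_continuous; apply/derivable1_diffP.
  have q0 : q 0 = c2 / s2 by rewrite /q expr0n add0r.
  by rewrite -q0; exact: cvg_at_right_filter qc.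
- have -> : pi / 4 = 2^-1 * (pi / 2) :> R by field.
  apply: cvgMr; apply: (@cvg_comp _ _ _ q atan); last exact: cvgy_atan.
  apply/cvgryPge => M; near=> r.
  rewrite /q ler_pdivlMr//.
  have r1 : 1 <= r by near: r; apply: nbhs_pinfty_ge; rewrite num_real.
  have rM : M * s2 - c2 <= r by near: r; apply: nbhs_pinfty_ge; rewrite num_real.
  by nra.
Unshelve. all: by end_near. Qed.

End sector_functions.

(** * Reflection between the two rays *)

Section reflected_ray.
Variables (R : realType) (phi : R).
Hypothesis phi_itv : 0 < phi < pi / 2.

Lemma expi_reflect psi : expi (pi - psi) = - conjc (expi psi) :> cplx R.
Proof.
by rewrite /expi cosB sinB cospi sinpi; congr pair; rewrite /re /im /=; ring.
Qed.

Lemma polar_reflect (r psi : R) : polar r (pi - psi) = - conjc (polar r psi).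
Proof.
by rewrite /polar cosB sinB cospi sinpi; congr pair; rewrite /re /im /=; ring.
Qed.

Lemma conjc1 : conjc 1 = 1 :> cplx R.
Proof. by apply: cplx_eq => //=; rewrite /conjc /im /= oppr0. Qed.

Lemma conjcX (z : cplx R) k : conjc (z ^+ k) = conjc z ^+ k.
Proof.
by elim: k => [|k IH]; [rewrite !expr0 conjc1|rewrite !exprS conjcM IH].
Qed.

Lemma conjc_inv (z : cplx R) : conjc (cinv z) = cinv (conjc z).
Proof. by rewrite /cinv /conjc /csq /re /im /= sqrrN; congr pair; rewrite !mulNr. Qed.

Lemma kappa_reflect psi (r : R) : kappa (pi - psi) r = conjc (kappa psi r).
Proof.
by rewrite /kappa conjc_inv polar_reflect sqrrN conjcD conjcX conjc1.
Qed.

Definition monomial psi a b (r : R) : cplx R :=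
  expi psi * polar r psi ^+ a * kappa psi r ^+ b.

(** The rays are exchanged by [z -> - conj z], which conjugates [kappa]; only signs of the factors
    remain. *)
Lemma im_monomial_reflect a b r :
  im (monomial (pi - phi) a b r) = (-1) ^+ a * im (monomial phi a b r).
Proof.
rewrite /monomial expi_reflect polar_reflect kappa_reflect (exprNn (conjc _)) -!conjcX.
have -> : - conjc (expi phi) * ((-1) ^+ a * conjc (polar r phi ^+ a)) * conjc (kappa phi r ^+ b)
   = (-1) ^+ a * - conjc (expi phi * polar r phi ^+ a * kappa phi r ^+ b).
  by rewrite !conjcM; ring.
rewrite -[X in im (X * _) = _]signr_odd -[X in _ = X * _]signr_odd; case: (odd a); rewrite ?expr1 ?expr0 ?mulN1r ?mul1r.
  by rewrite opprK /conjc /im.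
by rewrite imN /conjc /im /= opprK.
Qed.

Lemma monomial_continuous psi a b : psi = phi \/ psi = pi - phi ->
  pos_ccontinuous (monomial psi a b).
Proof.
have H c : pos_ccontinuous c -> pos_ccontinuous (fun r => conjc (c r)).
  move=> [c1 c2]; split=> // r r0.
  by apply: (@continuousN _ _ _ (fun r => im (c r))); exact: c2.
have HN c : pos_ccontinuous c -> pos_ccontinuous (fun r => - c r).
  move=> [c1 c2]; split=> r r0.
    by apply: (@continuousN _ _ _ (fun r => re (c r))); exact: c1.
  by apply: (@continuousN _ _ _ (fun r => im (c r))); exact: c2.
have k1 : pos_ccontinuous (kappa phi).
  exact: (cderiv_ccontinuous (fun r _ => deriv_kappa phi_itv r)).
have z1 : pos_ccontinuous (fun r => polar r phi).
  exact: (cderiv_ccontinuous (fun r _ => deriv_z phi r)).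
have kz : psi = phi \/ psi = pi - phi ->
    pos_ccontinuous (kappa psi) /\ pos_ccontinuous (fun r => polar r psi).
  move=> [->//|->]; split.
    have -> : kappa (pi - phi) = (fun r => conjc (kappa phi r)).
      by apply/funext => r; exact: kappa_reflect.
    exact: H.
  have -> : (fun r => polar r (pi - phi)) = (fun r => - conjc (polar r phi)).
    by apply/funext => r; exact: polar_reflect.
  by apply: HN; exact: H.
move=> /kz [kc zc].
apply: (@pos_ccontinuousM _ (fun r => expi psi * polar r psi ^+ a) (fun r => kappa psi r ^+ b)).
  apply: (@pos_ccontinuousM _ (fun=> expi psi) (fun r => polar r psi ^+ a)).
    exact: pos_ccontinuous_cst.
  exact: pos_ccontinuousX.
exact: pos_ccontinuousX.
Qed.

(* The double sector is symmetric: even powers cancel between its two halves. *)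
Lemma monomial_diff_antiderivative a b : (1 <= a)%N -> (a.+2 <= b.*2)%N ->
  (odd a -> (a.+3 <= b.*2)%N) ->
  exists A : R -> R, [/\ forall r : R, 0 < r ->
        is_derive r 1 A (im (monomial (pi - phi) a b r) - im (monomial phi a b r)),
      A r @[r --> 0^'+] --> 0 & A r @[r --> +oo] --> 0].
Proof.
move=> a1 ab abo; have [ao|ae] := boolP (odd a); last first.
  exists (fun=> 0); split; [|exact: cvg_cst|exact: cvg_cst] => r r0.
  rewrite im_monomial_reflect -signr_odd (negbTE ae) expr0 mul1r subrr.
  exact: is_derive_cst.
have jb : (a./2.+2 <= b)%N.
  by have := abo ao; have := odd_double_half a; rewrite ao -!muln2; lia.
have [A [A1 A2 A3]] := odd_antiderivative phi_itv jb.
(* For odd [a] the contributions add up: [(-1)^a - 1 = -2]. *)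
exists (fun r => -2 * A r); split.
- move=> r r0; have h := A1 r r0; have := is_deriveZ (-2 : R) h => h'.
  apply: is_derive_eq; rewrite im_monomial_reflect -signr_odd ao expr1 [LHS]/GRing.scale /=.
  rewrite -[in RHS](odd_double_half a) ao add1n /monomial; ring.
- by rewrite -[X in _ --> X](mulr0 (-2 : R)); exact: cvgMr.
- by rewrite -[X in _ --> X](mulr0 (-2 : R)); exact: cvgMr.
Qed.

End reflected_ray.

(** * Powers of K as integrals *)

Section powers.
Variables (R : realType) (n : nat) (E : normedModType R).
Local Notation V := (cliff_mod n E).
Hypothesis V_reflexive : reflexive_space V.
Variable D : set (V -> V).
Local Notation alg := (balg D).
Local Notation bscale := (bscale D).
Local Notation iota := (cplx_map bscale).
Variables (S K : alg) (Rs : cplx R -> cplx alg) (phi c0 : R).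
Hypothesis phi_itv : 0 < phi < pi / 2.
Hypothesis c0_ge0 : 0 <= c0.
Hypothesis Rs_resolvent : forall z w, in_sector phi z -> in_sector phi w ->
  Rs w - Rs z = iota (z - w) * Rs z * Rs w.
Hypothesis K_Rs : forall z, in_sector phi z ->
  creal K * Rs z = creal S * (iota z * Rs z - 1).
Hypothesis S_Rs : forall z, in_sector phi z ->
  (1 - creal S) * Rs z = creal K * (iota z * Rs z - 1).
Hypothesis Rs_le : forall r psi, 0 < r -> phi <= psi <= pi - phi ->
  cle (Rs (polar r psi)) (c0 / r).
Hypothesis S_le : opnorm_le S c0.
Hypothesis K_le : opnorm_le K c0.

Definition power_weight m psi (r : R) : cplx R :=
  expi psi * (polar r psi * kappa psi r) ^+ m.

Definition power_ray m psi (r : R) : alg := im (ray_fun Rs (power_weight m psi) psi r).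

(** The identity [z R = (1 + z^2) K R + S - z K], divided by [1 + z^2], exchanges one factor
    [z / (1 + z^2)] of the weight for the operator [K], up to scalar functions times [S] and [K]. *)
Lemma power_ray_step m psi r : 0 < r -> psi = phi \/ psi = pi - phi ->
  power_ray m.+1 psi r = K * power_ray m psi r
    + bscale (im (monomial psi m m.+1 r)) * S - bscale (im (monomial psi m.+1 m.+1 r)) * K.
Proof.
move=> r0 psiE.
have zs : in_sector phi (polar r psi).
  by exists r, psi; split=> //; case: psiE => ->; move: phi_itv; rewrite lexx; lra.
have kM : (1 + polar r psi ^+ 2) * kappa psi r = 1.
  case: psiE => ->; first exact: kappaM.
  rewrite polar_reflect kappa_reflect sqrrN -conjcX.
  have -> : 1 + conjc (polar r phi ^+ 2) = conjc (1 + polar r phi ^+ 2) :> cplx R.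
    by rewrite conjcD conjc1.
  by rewrite -conjcM kappaM// conjc1.
set z := polar r psi in zs kM *; set k := kappa psi r in kM *.
have zR : iota z * Rs z = (1 + iota z ^+ 2) * (creal K * Rs z) + creal S - iota z * creal K.
  have h1 := K_Rs zs; have h2 := S_Rs zs.
  apply/eqP; rewrite -subr_eq0; apply/eqP.
  transitivity (iota z * ((1 - creal S) * Rs z - creal K * (iota z * Rs z - 1))
    - (creal K * Rs z - creal S * (iota z * Rs z - 1))); first ring.
  by rewrite h1 h2 !subrr mulr0 subr0.
have main : ray_fun Rs (power_weight m.+1 psi) psi r =
    creal K * ray_fun Rs (power_weight m psi) psi r +
    iota (monomial psi m m.+1 r) * creal S - iota (monomial psi m.+1 m.+1 r) * creal K.
  rewrite /ray_fun /power_weight /monomial -/z -/k.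
  transitivity (iota (expi psi * (z * k) ^+ m * k) * (iota z * Rs z)).
    by rewrite exprS; ring.
  have kI : iota k * (1 + iota z ^+ 2) = 1.
    by rewrite -[in LHS](rmorph1 iota) -rmorphXn -rmorphD -rmorphM mulrC kM rmorph1.
  rewrite zR !exprMn !rmorphM !rmorphXn.
  transitivity (iota (expi psi) * (iota z ^+ m * iota k ^+ m) *
     ((iota k * (1 + iota z ^+ 2)) * (creal K * Rs z) + iota k * creal S - iota k * iota z * creal K)).
    ring.
  by rewrite kI !exprS; ring.
have im_cK X : im (creal K * X) = K * im X.
  by rewrite imM /creal /re /im /= mul0r addr0.
have im_Xc X (A : alg) : im (iota X * creal A) = bscale (im X) * A.
  by rewrite imM /creal /cplx_map /re /im /= mulr0 add0r.
by rewrite /power_ray main imD imN imD im_cK !im_Xc.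
Qed.

(** Cauchy's formula for powers of [z / (1 + z^2)]. For exponent 1 the deformation gives
    [(pi - 2 phi) K] and the scalar integral adds the missing [2 phi K]. For higher exponents the
    scalar integrals vanish, so each step multiplies by [K]. *)
Lemma power_integral m : exists U : R -> V -> V, forall v,
  antider (fun r => power_ray m.+1 (pi - phi) r v - power_ray m.+1 phi r v) (U^~ v) /\
  total_incr (U^~ v) (pi *: (K ^+ m.+1) v).
Proof.
have e1 : pi - phi = phi \/ pi - phi = pi - phi by right.
have e2 : phi = phi \/ phi = pi - phi by left.
have c1 : 0 < cos phi := cos_phi_gt0 phi_itv.
have imc psi a b (h : psi = phi \/ psi = pi - phi) :
    pos_continuous (fun r => im (monomial psi a b r)).
  by have [] := monomial_continuous phi_itv a b h.
have imcB a b : pos_continuous (fun r => im (monomial (pi - phi) a b r) - im (monomial phi a b r)).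
  move=> r r0; apply: (@continuousB _ _ _ (fun r => im (monomial (pi - phi) a b r))
     (fun r => im (monomial phi a b r))); exact: imc.
have oddb (k : nat) : odd k.+2 -> (k.+2.+3 <= k.+2.*2)%N.
  by case: k => [//|k] _; rewrite -addnn; lia.
elim: m => [|m [U HU]].
  have [U HU] := ray_deformation V_reflexive phi_itv c0_ge0 Rs_resolvent K_Rs S_Rs Rs_le S_le K_le.
  have [A [A1 A2 A3]] := log_antiderivative phi_itv.
  exists (fun r v => U r v + A r *: (2 *: K v)) => v; have [aU tU] := HU v.
  split.
    have aA := antider_scalar (2 *: K v) A1 _; have {aA} := aA _.
    have -> : (fun r => im (expi phi * (polar r phi * kappa phi r))) =
        (fun r => im (monomial phi 1 1 r)) by apply/funext => r; rewrite /monomial !expr1 mulrA.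
    move=> /(_ (imc phi 1 1 e2)) aA; apply: (antider_ext _ (antiderD aU aA)) => r r0.
    have w0 psi : power_ray 0 psi r = im (ray_fun Rs (fun=> expi psi) psi r).
      by rewrite /power_ray /ray_fun /power_weight expr0 mulr1.
    rewrite !(power_ray_step _ r0)// !w0 !im_monomial_reflect expr0 mul1r expr1.
    have -> : im (expi phi * (polar r phi * kappa phi r)) = im (monomial phi 1 1 r).
      by rewrite /monomial !expr1 mulrA.
    set x := im (monomial phi 0 1 r); set y := im (monomial phi 1 1 r).
    set w1 := im (ray_fun Rs _ phi r); set w2 := im (ray_fun Rs _ (pi - phi) r).
    move: w1 w2 => w1 w2.
    rewrite !(balgDE, balgNE, balgME, bscaleE); module.
  have -> : pi *: (K ^+ 1) v = (pi - 2 * phi) *: K v + (pi / 4 - (pi / 4 - phi)) *: (2 *: K v).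
    by rewrite expr1; module.
  by apply: total_incrD => //; exact: total_incr_scalar.
have [A [A1 A2 A3]] : exists A : R -> R, [/\ forall r : R, 0 < r ->
        is_derive r 1 A (im (monomial (pi - phi) m.+1 m.+2 r) - im (monomial phi m.+1 m.+2 r)),
      A r @[r --> 0^'+] --> 0 & A r @[r --> +oo] --> 0].
  by apply: monomial_diff_antiderivative => // *; rewrite -addnn; lia.
have [B [B1 B2 B3]] : exists A : R -> R, [/\ forall r : R, 0 < r ->
        is_derive r 1 A (im (monomial (pi - phi) m.+2 m.+2 r) - im (monomial phi m.+2 m.+2 r)),
      A r @[r --> 0^'+] --> 0 & A r @[r --> +oo] --> 0].
  apply: monomial_diff_antiderivative => //; last exact: oddb.
  by rewrite -addnn; lia.
exists (fun r v => K (U r v) + A r *: S v - B r *: K v) => v; have [aU tU] := HU v.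
have KL := balg_linear K.
split.
  have h1 := antider_comp KL K_le aU.
  have h2 := antider_scalar (S v) A1 (imcB _ _); have h3 := antider_scalar (K v) B1 (imcB _ _).
  apply: (antider_ext _ (antiderB (antiderD h1 h2) h3)) => r r0.
  rewrite !(power_ray_step m.+1 r0)// !(balgDE, balgNE, balgME, bscaleE).
  by rewrite (linear_addE KL) (linear_oppE KL); module.
have -> : pi *: (K ^+ m.+2) v = K (pi *: (K ^+ m.+1) v) + (0 - 0) *: S v - (0 - 0) *: K v.
  by rewrite !subrr !scale0r addr0 subr0 (linear_scaleE KL) exprS.
apply: total_incrB; last exact: total_incr_scalar.
by apply: total_incrD; [exact: total_incr_comp KL K_le tU|exact: total_incr_scalar].
Qed.

End powers.

(** * Integrable majorants *)

Section domination.
Variables (R : realType) (beta : R).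
Hypothesis beta0 : 0 < beta.
Implicit Types r : R.

(* r times the derivative of r^beta / (1 + r^beta), up to the factor beta *)
Definition peak r : R := r `^ beta / (1 + r `^ beta) ^+ 2.

Let p r : R := r `^ beta / (1 + r `^ beta).

Let p1 r : 0 < 1 + r `^ beta. Proof. by rewrite ltr_pwDl// powR_ge0. Qed.

Lemma peak_derive c r : 0 < r ->
  is_derive r 1 (fun x => c / beta * p x) (c * peak r / r).
Proof.
move=> r0; have h := is_derive1_powR beta r0.
have h1 : is_derive r 1 (fun x => 1 + x `^ beta) (0 + beta * r `^ (beta - 1)).
  have h0 : is_derive r 1 (fun=> (1 : R)) (0 : R) := is_derive_cst (1 : R) r 1.
  exact: (is_deriveD h0 h).
have h2 := @is_derive_inv _ (fun x => 1 + x `^ beta) r _ (lt0r_neq0 (p1 r)) h1.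
have := is_deriveZ (c / beta) (is_derive_mul h h2) => h3; apply: is_derive_eq.
rewrite [LHS]/GRing.scale /= /peak.
have -> : r `^ (beta - 1) = r `^ beta / r.
  rewrite (@powRD _ r beta (-1)); first by rewrite powR_inv1 ?ltW.
  by rewrite (gt_eqF r0) implybT.
field; rewrite (gt_eqF (p1 r)) (gt_eqF r0) gt_eqF//.
Qed.

Let p_ge0 r : 0 <= p r.
Proof. by rewrite divr_ge0 ?powR_ge0// ltW. Qed.

Let p_le1 r : p r <= 1.
Proof. by rewrite ler_pdivrMr// mul1r lerDr. Qed.

(** [p] is at most [r^beta], and [1 - p] at most [r^(- beta)]; this dictates [a0] and its inverse as
    thresholds. *)
Lemma peak_total (c : R) : 0 <= c -> forall eps : R, 0 < eps -> exists a0 b0 : R,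
  [/\ 0 < a0, 0 < b0,
    forall a a', 0 < a -> a <= a' -> a' <= a0 -> c / beta * p a' - c / beta * p a <= eps &
    forall b b', b0 <= b -> b <= b' -> c / beta * p b' - c / beta * p b <= eps].
Proof.
move=> c0 eps e0; pose k := c / beta + 1.
have k0 : 0 < k by rewrite ltr_wpDl// divr_ge0// ltW.
have cb0 : 0 <= c / beta by rewrite divr_ge0// ltW.
have ek0 : 0 < eps / k by rewrite divr_gt0.
pose a0 := (eps / k) `^ beta^-1.
have a00 : 0 < a0 by rewrite powR_gt0.
have a0b : a0 `^ beta = eps / k.
  by rewrite /a0 -powRrM mulVf ?gt_eqF// powRr1// ltW.
exists a0, a0^-1; split; rewrite ?invr_gt0//.
- move=> a a' a_gt0 aa' a'a0; have a'0 : 0 <= a' by rewrite (le_trans (ltW a_gt0)).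
  have h : a' `^ beta <= eps / k.
    by rewrite -a0b; apply: ge0_ler_powR; rewrite ?nnegrE// ltW.
  have h1 : p a' <= eps / k.
    apply: le_trans h; rewrite /p ler_pdivrMr// ler_peMr ?powR_ge0// lerDl powR_ge0//.
  have h2 : p a' * k <= eps by rewrite -ler_pdivlMr.
  have := mulr_ge0 cb0 (p_ge0 a); have := p_ge0 a'; rewrite /k in h2; nra.
- move=> b b' bb bb'; have b0 : 0 < b by rewrite (lt_le_trans _ bb)// invr_gt0.
  have h : (b `^ beta)^-1 <= eps / k.
    rewrite -a0b invf_ple ?posrE ?powR_gt0//.
    have -> : (a0 `^ beta)^-1 = a0^-1 `^ beta.
      by rewrite -(powR_inv1 (ltW a00)) -powRrM mulN1r powRN.
    by apply: ge0_ler_powR; rewrite ?nnegrE ?invr_ge0// ltW.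
  have h1 : 1 - p b <= eps / k.
    apply: le_trans h; have b1 : 0 < b `^ beta by rewrite powR_gt0.
    have -> : 1 - p b = (1 + b `^ beta)^-1 by rewrite /p; field; rewrite gt_eqF.
    by rewrite lef_pV2 ?posrE ?p1// lerDr ler01.
  have h2 : (1 - p b) * k <= eps by rewrite -ler_pdivlMr.
  have := ler_wpM2l cb0 (p_le1 b'); have := p_le1 b; rewrite /k in h2; nra.
Qed.

Lemma peak_bounded (c r : R) : 0 <= c -> `|c / beta * p r| <= c / beta.
Proof.
move=> c0; have cb0 : 0 <= c / beta by rewrite divr_ge0// ltW.
have h0 : 0 <= c / beta * p r by exact: mulr_ge0.
by rewrite ger0_norm// ler_piMr.
Qed.

End domination.

(** Both sides are invariant under [r -> 1 / r], so [r <= 1] may be assumed. Then the left side is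
    at most [2 r^beta], and [(1 + r^beta)^2 <= 4]. *)
Lemma growth_le_peak (R : realType) (m : nat) (alpha r : R) : 0 <= alpha -> alpha < m%:R ->
  0 < r -> (r / (1 + r ^+ 2)) ^+ m * (r `^ alpha + r `^ (- alpha)) <= 8 * peak (m%:R - alpha) r.
Proof.
move=> al0 alm r0; set beta := m%:R - alpha.
have beta0 : 0 < beta by rewrite subr_gt0.
have r2 : 0 < 1 + r ^+ 2 by rewrite ltr_pwDl// sqr_ge0.
have q0 : 0 < r / (1 + r ^+ 2) by rewrite divr_gt0.
have rm (x : R) : 0 < x -> x ^+ m * x `^ (- alpha) = x `^ beta.
  by move=> x0; rewrite -powR_mulrn ?ltW// -powRD// (gt_eqF x0) implybT.
have peakV (x : R) : 0 < x -> peak beta x^-1 = peak beta x.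
  move=> x0; rewrite /peak; have y0 : 0 < x `^ beta by rewrite powR_gt0.
  have -> : x^-1 `^ beta = (x `^ beta)^-1.
    by rewrite -(powR_inv1 (ltW x0)) -powRrM mulN1r powRN.
  have y1 : 0 < 1 + x `^ beta by rewrite ltr_wpDr// ltW.
  by field; rewrite (gt_eqF y0) /= ?(gt_eqF y1) // addrC (gt_eqF y1).
wlog r1 : r r0 r2 q0 / r <= 1 => [H|].
  have [r1|/ltW r1] := leP r 1; first exact: H.
  have ri0 : 0 < r^-1 by rewrite invr_gt0.
  have ri2 : 0 < 1 + r^-1 ^+ 2 by rewrite ltr_pwDl// sqr_ge0.
  have := H r^-1 ri0 ri2; rewrite peakV//.
  have -> : r^-1 / (1 + r^-1 ^+ 2) = r / (1 + r ^+ 2).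
    by field; rewrite (gt_eqF r0) gt_eqF//= gt_eqF// addrC.
  have rV x : r^-1 `^ x = r `^ (- x).
    by rewrite -(powR_inv1 (ltW r0)) -powRrM mulN1r.
  rewrite !rV opprK (addrC (r `^ _)); apply; last by rewrite invf_le1.
  by [].
have rb0 : 0 < r `^ beta by rewrite powR_gt0.
have rb1 : r `^ beta <= 1.
  by have := ger_powR (a := r) _ (ltW beta0); rewrite r0 r1 powRr0; exact.
have h1 : (r / (1 + r ^+ 2)) ^+ m <= r ^+ m.
  apply: lerXn2r; rewrite ?nnegrE; [exact: ltW|exact: ltW|].
  by rewrite ler_pdivrMr//; have := sqr_ge0 r; nra.
have h2 : r `^ alpha <= r `^ (- alpha).
  by apply: ger_powR; rewrite ?r0//; lra.
have h3 : r `^ alpha + r `^ (- alpha) <= 2 * r `^ (- alpha) by lra.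
apply: (@le_trans _ _ (r ^+ m * (2 * r `^ (- alpha)))).
  by apply: ler_pM => //; rewrite ?exprn_ge0 ?addr_ge0 ?powR_ge0// ltW.
rewrite mulrCA rm// /peak mulrA ler_pdivlMr ?exprn_gt0 ?ltr_pwDl//; last exact: ltW.
by nra.
Qed.

(** * Operator antiderivatives and dominated ray integrals *)

Section op_antider_algebra.
Variables (R : realType) (n : nat) (E : normedModType R).
Local Notation V := (cliff_mod n E).
Implicit Types (F G U W : R -> V -> V) (A B L : V -> V).

Lemma op_antider_ext F G U : (forall r, 0 < r -> F r = G r) -> op_antider F U -> op_antider G U.
Proof.
move=> FG FU a b eps a0 e0; have [d d0 H] := FU a b eps a0 e0.
exists d => // t xi t' at_ txi *; rewrite -FG; first exact: H.
by rewrite (lt_le_trans a0)// (le_trans at_).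
Qed.

Lemma op_antiderD F G U W : op_antider F U -> op_antider G W ->
  op_antider (fun r v => F r v + G r v) (fun r v => U r v + W r v).
Proof.
move=> FU GW a b eps a0 e0; have e20 : 0 < eps / 2 by rewrite divr_gt0.
have [d d0 H] := FU a b _ a0 e20; have [d' d'0 H'] := GW a b _ a0 e20.
exists (Num.min d d'); first by rewrite lt_min d0.
move=> t xi t' h1 h2 h3 h4; rewrite lt_min => /andP[h5 h6] v.
have := opnorm_leD (H t xi t' h1 h2 h3 h4 h5) (H' t xi t' h1 h2 h3 h4 h6) => /(_ v).
by rewrite -mulrDl -splitr => h; apply: le_trans h; rewrite le_eqVlt; apply/orP; left;
  apply/eqP; congr (`|_|); module.
Qed.

Lemma op_antiderZ k F U : op_antider F U ->
  op_antider (fun r v => k *: F r v) (fun r v => k *: U r v).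
Proof.
move=> FU a b eps a0 e0; have k0 : 0 < `|k| + 1 by rewrite ltr_wpDl.
have [d d0 H] := FU a b _ a0 (divr_gt0 e0 k0); exists d => // t xi t' h1 h2 h3 h4 h5 v.
have := H t xi t' h1 h2 h3 h4 h5 v; set x := _ - _ - _ => hx.
have -> : k *: U t' v - k *: U t v - (t' - t) *: (k *: F xi v) = k *: x.
  by rewrite /x; module.
rewrite normrZ; apply: (@le_trans _ _ ((`|k| + 1) * `|x|)).
  by apply: ler_wpM2r; rewrite ?normr_ge0// lerDl.
apply: (le_trans (ler_wpM2l (ltW k0) hx)); rewrite le_eqVlt; apply/orP; left; apply/eqP.
by field; rewrite gt_eqF.
Qed.

Lemma op_antiderN F U : op_antider F U -> op_antider (fun r v => - F r v) (fun r v => - U r v).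
Proof.
move=> /(op_antiderZ (-1)) FU a b eps a0 e0; have [d d0 H] := FU a b eps a0 e0.
by exists d => // t xi t' h1 h2 h3 h4 h5 v; have := H t xi t' h1 h2 h3 h4 h5 v; rewrite !scaleN1r.
Qed.

Lemma op_antider_compr F U L c : opnorm_le L c -> op_antider F U ->
  op_antider (fun r v => F r (L v)) (fun r v => U r (L v)).
Proof.
move=> Lc FU a b eps a0 e0; have k0 : 0 < `|c| + 1 by rewrite ltr_wpDl.
have [d d0 H] := FU a b _ a0 (divr_gt0 e0 k0); exists d => // t xi t' h1 h2 h3 h4 h5 v.
apply: (le_trans (H t xi t' h1 h2 h3 h4 h5 (L v))).
have t0 : 0 <= t' - t by rewrite subr_ge0 (le_trans h2).
have h : `|L v| <= (`|c| + 1) * `|v|.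
  by apply: (le_trans (Lc v)); apply: ler_wpM2r => //; rewrite (le_trans (ler_norm c))// lerDl.
apply: (le_trans (ler_wpM2l (mulr_ge0 (ltW (divr_gt0 e0 k0)) t0) h)).
by rewrite le_eqVlt; apply/orP; left; apply/eqP; field; rewrite gt_eqF.
Qed.

Lemma op_total_incrD U W A B : op_total_incr U A -> op_total_incr W B ->
  op_total_incr (fun r v => U r v + W r v) (fun v => A v + B v).
Proof.
move=> Uz Ww e e0; have e20 : 0 < e / 2 by rewrite divr_gt0.
have [a1 [b1 [a10 b10 H1]]] := Uz _ e20; have [a2 [b2 [a20 b20 H2]]] := Ww _ e20.
exists (Num.min a1 a2), (Num.max b1 b2); split; rewrite ?lt_min ?lt_max ?a10 ?b10//.
move=> a b a0; rewrite le_min ge_max => /andP[aa1 aa2] /andP[bb1 bb2] v.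
have := opnorm_leD (H1 a b a0 aa1 bb1) (H2 a b a0 aa2 bb2) => /(_ v).
by rewrite -splitr => h; apply: le_trans h; rewrite le_eqVlt; apply/orP; left;
  apply/eqP; congr (`|_|); module.
Qed.

Lemma op_total_incrZ k U A : op_total_incr U A ->
  op_total_incr (fun r v => k *: U r v) (fun v => k *: A v).
Proof.
move=> UA e e0; have k0 : 0 < `|k| + 1 by rewrite ltr_wpDl.
have [a1 [b1 [a10 b10 H]]] := UA _ (divr_gt0 e0 k0).
exists a1, b1; split=> // a b a0 aa bb v; have := H a b a0 aa bb v.
set x := _ - _ - _ => hx; rewrite -!scalerBr normrZ -/x.
apply: (@le_trans _ _ ((`|k| + 1) * `|x|)).
  by apply: ler_wpM2r; rewrite ?normr_ge0// lerDl.
apply: (le_trans (ler_wpM2l (ltW k0) hx)); rewrite le_eqVlt; apply/orP; left; apply/eqP.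
by field; rewrite gt_eqF.
Qed.

Lemma op_total_incrN U A : op_total_incr U A ->
  op_total_incr (fun r v => - U r v) (fun v => - A v).
Proof.
move=> /(op_total_incrZ (-1)) UA e e0; have [a1 [b1 [? ? H]]] := UA _ e0.
by exists a1, b1; split=> // a b a0 aa bb v; have := H a b a0 aa bb v; rewrite !scaleN1r.
Qed.

Lemma op_total_incr_compr U A L c : opnorm_le L c -> op_total_incr U A ->
  op_total_incr (fun r v => U r (L v)) (fun v => A (L v)).
Proof.
move=> Lc UA e e0; have k0 : 0 < `|c| + 1 by rewrite ltr_wpDl.
have [a1 [b1 [a10 b10 H]]] := UA _ (divr_gt0 e0 k0).
exists a1, b1; split=> // a b a0 aa bb v; apply: (le_trans (H a b a0 aa bb (L v))).
have h : `|L v| <= (`|c| + 1) * `|v|.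
  by apply: (le_trans (Lc v)); apply: ler_wpM2r => //; rewrite (le_trans (ler_norm c))// lerDl.
apply: (le_trans (ler_wpM2l (ltW (divr_gt0 e0 k0)) h)).
by rewrite le_eqVlt; apply/orP; left; apply/eqP; field; rewrite gt_eqF.
Qed.

End op_antider_algebra.

Section dominated_ray.
Variables (R : realType) (n : nat) (E : normedModType R).
Local Notation V := (cliff_mod n E).
Hypothesis V_reflexive : reflexive_space V.
Variable D : set (V -> V).
Local Notation alg := (balg D).
Local Notation iota := (cplx_map (bscale D)).
Variables (Rs : cplx R -> cplx alg) (phi c0 : R).
Hypothesis phi_itv : 0 < phi < pi / 2.
Hypothesis c0_ge0 : 0 <= c0.
Hypothesis Rs_resolvent : forall z w, in_sector phi z -> in_sector phi w ->
  Rs w - Rs z = iota (z - w) * Rs z * Rs w.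
Hypothesis Rs_le : forall r psi, 0 < r -> phi <= psi <= pi - phi ->
  cle (Rs (polar r psi)) (c0 / r).
Variables (c : R -> cplx R) (psi M beta : R).
Hypothesis psiI : phi <= psi <= pi - phi.
Hypothesis c_cont : pos_ccontinuous c.
Hypothesis beta0 : 0 < beta.
Hypothesis M0 : 0 <= M.
Hypothesis c_le : forall r, 0 < r -> Num.sqrt (csq (c r)) <= M * peak beta r.

Let ray_le r : 0 < r -> cle (ray_fun Rs c psi r) (2 * M * c0 * peak beta r / r).
Proof.
move=> r0; have h := c_le r0.
have -> : 2 * M * c0 * peak beta r / r = 2 * (M * peak beta r * (c0 / r)) by ring.
apply: cleM; [exact: le_trans h|apply: cle_iota|exact: Rs_le].
  exact: le_trans (abs_re_le _) h.
exact: le_trans (abs_im_le _) h.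
Qed.

Let Mc0 : 0 <= 2 * M * c0. Proof. by rewrite mulr_ge0// mulr_ge0. Qed.

Lemma dominated_ray_re : exists U A,
  op_antider (fun r => re (ray_fun Rs c psi r)) U /\ op_total_incr U A.
Proof.
have [c1 c2] := c_cont.
have [U HU] := ray_fun_re_antider V_reflexive c0_ge0 Rs_resolvent Rs_le psiI c1 c2.
have [r r0|r r0|A HA] := op_total_incr_ex (c := 2 * M * c0 / beta) V_reflexive HU
  (fun r r0 => peak_derive beta0 (2 * M * c0) r0) _ _ (peak_total beta0 Mc0).
- by have [] := ray_le r0.
- exact: peak_bounded.
by exists U, A.
Qed.

Lemma dominated_ray_im : exists U A,
  op_antider (fun r => im (ray_fun Rs c psi r)) U /\ op_total_incr U A.
Proof.
have [c1 c2] := c_cont.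
have [U HU] := ray_fun_im_antider V_reflexive c0_ge0 Rs_resolvent Rs_le psiI c1 c2.
have [r r0|r r0|A HA] := op_total_incr_ex (c := 2 * M * c0 / beta) V_reflexive HU
  (fun r r0 => peak_derive beta0 (2 * M * c0) r0) _ _ (peak_total beta0 Mc0).
- by have [] := ray_le r0.
- exact: peak_bounded.
by exists U, A.
Qed.

End dominated_ray.

(** * The complex planes of the Clifford algebra *)

Section complex_plane.
Variables (R : realType) (n : nat) (J : clifford R n).
Hypothesis J_sphere : unit_sphere J.
Implicit Types (z w : cplx R) (A B : {set 'I_n}).

Lemma clifford_normE (s : clifford R n) : `|s| ^+ 2 = \sum_A s A ^+ 2.
Proof.
have -> : `|s| = cliff_norm (s : cliff_mod n R^o) by [].
rewrite sqr_sqrtr; last by apply: sumr_ge0 => A _; rewrite sqr_ge0.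
by apply: eq_bigr => A _; rewrite real_normK// num_real.
Qed.

Let J0 : J finset.set0 = 0. Proof. by have [_ + _] := J_sphere. Qed.

Let J_singleton A : J A != 0 -> exists i, A = [set i]%SET.
Proof.
move=> JA; apply/cards1P; have [Jp _ _] := J_sphere.
have [|A1|//] := ltngtP #|A| 1%N; last by rewrite Jp ?eqxx in JA.
by rewrite ltnS leqn0 cards_eq0 => /eqP A0; rewrite A0 J0 eqxx in JA.
Qed.

(** The coefficient at the empty set is [- |J|^2]. At any other [K] the terms of [A] and [symd A K]
    are opposite, because distinct units anticommute. *)
Lemma unit_sphere_sqr : J * J = -1.
Proof.
have -> : -1 = (-1 : R) *: (1 : clifford R n) by rewrite scaleN1r.
apply/ffunP => K; rewrite [LHS]ffunE [RHS]ffunE /= ffunE.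
have [->|K0] := eqVneq K finset.set0.
  transitivity (- \sum_A J A ^+ 2); last first.
    by rewrite -clifford_normE; have [_ _ ->] := J_sphere; rewrite expr1n /GRing.scale /= mulr1.
  rewrite -sumrN; apply: eq_bigr => A _.
  rewrite symdC sym0d /GRing.scale /=.
  have [->|JA] := eqVneq (J A) 0; first by rewrite mulr0 expr0n oppr0.
  have [i ->] := J_singleton JA.
  by rewrite /csign !big_set1 leqnn mulrN1 mulNr expr2.
rewrite [RHS]/GRing.scale /= mulr0.
set f := fun A => (J A * csign R A (symd A K)) *: (J (symd A K) : R^o).
have fN A : f (symd A K) = - f A.
  rewrite /f -symdA symdd (symdC A finset.set0) sym0d /GRing.scale /=.
  have [->|JA] := eqVneq (J A) 0; first by rewrite mulr0 !mul0r oppr0.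
  have [->|JB] := eqVneq (J (symd A K)) 0; first by rewrite mulr0 !mul0r oppr0.
  have [i Ai] := J_singleton JA; have [j Bj] := J_singleton JB.
  have ij : i != j.
    apply: contra_neq K0 => ij.
    by rewrite -[K](symdK A) Bj Ai ij symdd.
  rewrite Bj Ai /csign !big_set1.
  case: (ltngtP i j) => [ij'|ij'|/val_inj ij']; last by rewrite ij' eqxx in ij.
    by ring.
  by ring.
have : \sum_A f A = - \sum_A f A.
  rewrite -sumrN [LHS](reindex_inj (h := fun A => symd A K)) /=.
    by apply: eq_bigr => A _; exact: fN.
  by move=> A B; rewrite !(symdC _ K) => /(inv_inj (symdK K)).
by move=> h; apply/eqP; have := h; rewrite -/f; lra.
Qed.

(** Since [J^2 = -1], this identifies the complex numbers with C_J; the lemmas below match products,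
    norms, conjugates and inverses. *)
Definition jc z : clifford R n := slice_point J (re z) (im z).

Lemma jcE z A : jc z A = if A == finset.set0 then re z else im z * J A.
Proof.
rewrite /jc /slice_point !ffunE; have [->|A0] := eqVneq A finset.set0.
  by rewrite J0 /GRing.scale /= mulr0 mulr1 addr0.
by rewrite /GRing.scale /= mulr0 add0r.
Qed.

Lemma jcM z w : jc (z * w) = jc z * jc w.
Proof.
rewrite /jc /slice_point !cplxE mulrDl !mulrDr -!scalerAl -!scalerAr !mul1r mulr1.
by rewrite unit_sphere_sqr; module.
Qed.

Lemma jc1 : jc 1 = 1.
Proof. by rewrite /jc /slice_point re1 im1 scale1r scale0r addr0. Qed.

Lemma jcD z w : jc (z + w) = jc z + jc w.
Proof. by rewrite /jc /slice_point !cplxE !scalerDl addrACA. Qed.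

Lemma jcX z k : jc (z ^+ k) = jc z ^+ k.
Proof. by elim: k => [|k IH]; [rewrite !expr0 jc1|rewrite !exprS jcM IH]. Qed.

Lemma jc_norm z : `|jc z| ^+ 2 = csq z.
Proof.
rewrite clifford_normE (bigD1 finset.set0)//= jcE eqxx /csq; congr (_ + _).
transitivity (im z ^+ 2 * \sum_(A | A != finset.set0) J A ^+ 2).
  by rewrite mulr_sumr; apply: eq_bigr => A A0; rewrite jcE (negbTE A0) exprMn.
have := clifford_normE J; rewrite (bigD1 finset.set0)//= J0 expr0n add0r => <-.
by have [_ _ ->] := J_sphere; rewrite expr1n mulr1.
Qed.

Lemma jc_paravector z : paravector (jc z).
Proof.
move=> A A1; rewrite jcE; case: eqP => [A0|_]; first by rewrite A0 cards0 in A1.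
by have [Jp _ _] := J_sphere; rewrite Jp// mulr0.
Qed.

Lemma jc_scalar z : scalar_part (jc z) = re z.
Proof. by rewrite /scalar_part jcE eqxx. Qed.

Lemma jc_conj z : pconj (jc z) = jc (conjc z).
Proof.
apply/ffunP => A; rewrite ffunE !jcE; case: eqP => // _.
by rewrite /conjc {2}/im /= mulNr.
Qed.

Lemma jc_inv z : Defs.pinv (jc z) = jc (cinv z).
Proof.
rewrite /Defs.pinv jc_norm jc_conj; apply/ffunP => A; rewrite ffunE !jcE.
by case: eqP => _; rewrite /cinv /conjc /re /im /= /GRing.scale /=; ring.
Qed.

Lemma jc_polar r psi : r *: cexp J psi = jc (polar r psi).
Proof. by rewrite /cexp /jc /slice_point scalerDr !scalerA. Qed.

Lemma jc_expi psi : cexp J psi = jc (expi psi). Proof. by []. Qed.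

Lemma jc_imag : J = jc (0, 1).
Proof. by rewrite /jc /slice_point /re /im /= scale0r add0r scale1r. Qed.

Variable E : normedModType R.
Local Notation V := (cliff_mod n E).

Lemma lmul_jc z (v : V) : lmul (jc z) v = re z *: v + im z *: lmul J v.
Proof. by rewrite /jc /slice_point lmulDl !lmulZl lmul1l. Qed.

Lemma lmulJ_sqr (v : V) : lmul J (lmul J v) = - v.
Proof.
rewrite lmulA -[lmul J _]/(J * J) unit_sphere_sqr.
have -> : -1 = (-1 : R) *: (1 : clifford R n) by rewrite scaleN1r.
by rewrite lmulZl lmul1l scaleN1r.
Qed.

Lemma component_le (v : V) A : `|v A| <= `|v|.
Proof.
have -> : `|v| = cliff_norm v by [].
rewrite -[leLHS]ger0_norm// -sqrtr_sqr ler_wsqrtr// (bigD1 A)//= lerDl.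
by apply: sumr_ge0 => B _; rewrite sqr_ge0.
Qed.

Lemma cliff_norm_le_sum (v : V) : `|v| <= \sum_A `|v A|.
Proof.
have -> : `|v| = cliff_norm v by [].
have s0 : 0 <= \sum_A `|v A| by apply: sumr_ge0.
rewrite -[leRHS]ger0_norm// -sqrtr_sqr ler_wsqrtr// expr2 mulr_suml.
apply: ler_sum => A _; rewrite expr2; apply: ler_wpM2l => //.
by rewrite (bigD1 A)//= lerDl; apply: sumr_ge0.
Qed.

Lemma lmul_bounded (a : clifford R n) : exists c, opnorm_le (lmul a : V -> V) c.
Proof.
exists (\sum_(K : {set 'I_n}) \sum_A `|a A * csign R A (symd A K)|) => v.
apply: (le_trans (cliff_norm_le_sum _)); rewrite mulr_suml; apply: ler_sum => K _.
rewrite ffunE; apply: (le_trans (ler_norm_sum _ _ _)); rewrite mulr_suml.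
by apply: ler_sum => A _; rewrite normrZ ler_wpM2l// component_le.
Qed.

End complex_plane.

Section right_linear_operators.
Variables (R : realType) (n : nat) (E : normedModType R).
Local Notation V := (cliff_mod n E).

(** Real scalars are right multiplications, so right linear operators are linear over the reals. *)
Lemma rmul_scalar (k : R) (v : V) : rmul v (k *: 1) = k *: v.
Proof.
apply/ffunP => K; rewrite !ffunE (bigD1 K)//= big1 ?addr0 => [|A AK].
  by rewrite symdd csign0r !ffunE eqxx mul1r /GRing.scale /= mulr1.
rewrite !ffunE; case: eqP => [AK0|_]; last by rewrite scaler0 mulr0 scale0r.
by move: AK; rewrite -[K](symdK A) AK0 symdC sym0d eqxx.
Qed.

Lemma rmul_linear (a : clifford R n) : linear (fun v : V => rmul v a).
Proof.
move=> k v w; apply/ffunP => K; rewrite !ffunE scaler_sumr -big_split.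
by apply: eq_bigr => A _; rewrite !ffunE scalerDr !scalerA mulrC.
Qed.

Lemma right_linear_lin (T : set (V * V)) : right_linear T ->
  forall (k : R) u v u' v', T (u, v) -> T (u', v') -> T (k *: u + u', k *: v + v').
Proof.
move=> [_ TD TM] k u v u' v' uv u'v'; apply: TD => //.
by rewrite -(rmul_scalar k u) -(rmul_scalar k v); exact: TM.
Qed.

End right_linear_operators.

(** * Double sectors *)

Section sectors.
Variables (R : realType) (n : nat).
Implicit Types (s : clifford R n) (phi psi r : R).

Lemma abs_cos_gt phi psi : 0 < phi < pi / 2 ->
  (- phi < psi < phi) || (pi - phi < psi < pi + phi) -> cos phi < `|cos psi|.
Proof.
move=> phiI; wlog psiI : psi / - phi < psi < phi => [H /orP[h|h]|_].
- by apply: H => //; rewrite h.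
- have -> : `|cos psi| = `|cos (psi - pi)|.
    by rewrite cosB cospi sinpi mulr0 addr0 mulrN1 normrN.
  have h' : - phi < psi - pi < phi by lra.
  by apply: H; rewrite // h'.
wlog psi0 : psi psiI / 0 <= psi => [H|].
  have [p0|p0] := leP 0 psi; first exact: H.
  by rewrite -(cosN psi); apply: H; lra.
apply: lt_le_trans (ler_norm _); rewrite ltr_cos ?in_itv/=; have := pi_gt0 R; lra.
Qed.

Lemma abs_cos_le phi psi : 0 < phi < pi / 2 -> phi <= psi <= pi - phi ->
  `|cos psi| <= cos phi.
Proof.
move=> phiI psiI; have p0 := pi_gt0 R; rewrite ler_norml.
have -> : - cos phi = cos (pi - phi) by rewrite cosB cospi sinpi mul0r addr0 mulN1r.
have mono := @ltr_cos R.
apply/andP; split; rewrite leNgt; apply/negP; rewrite mono ?in_itv/=; lra.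
Qed.

(** Membership is expressed by the ratio of scalar part to norm, a form that involves no choice of
    angle and passes to the closure. *)
Lemma double_sector_scalar phi s : 0 < phi < pi / 2 -> double_sector phi s ->
  cos phi * `|s| < `|scalar_part s|.
Proof.
move=> phiI [r [J [psi [r0 JS psiI ->]]]]; rewrite jc_polar.
have -> : `|jc J (polar r psi)| = r.
  by apply: (pexpIrn (n := 2)); rewrite ?nnegrE ?(ltW r0)// jc_norm// csq_polar.
rewrite jc_scalar// /polar /re /= normrM gtr0_norm// mulrC ltr_pM2l//.
exact: abs_cos_gt.
Qed.

Lemma closure_sector_scalar phi s : 0 < phi < pi / 2 -> closure (double_sector phi) s ->
  cos phi * `|s| <= `|scalar_part s|.
Proof.
move=> phiI sc; apply/ler_addgt0Pr => e e0; have e20 : 0 < e / 2 by rewrite divr_gt0.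
have [t [tD st]] := sc _ (nbhsx_ballx s (PosNum e20)%:num e20).
have {}st : `|s - t| < e / 2 by move: st; rewrite /= -ball_normE.
have ht := double_sector_scalar phiI tD.
have h1 : `|s| <= `|t| + e / 2.
  by have := ler_normD (s - t) t; rewrite subrK => h; lra.
have h2 : `|scalar_part t| <= `|scalar_part s| + e / 2.
  have -> : scalar_part t = scalar_part s - (s - t) finset.set0.
    by rewrite /scalar_part !ffunE opprB addrC subrK.
  apply: (le_trans (ler_normB _ _)); rewrite lerD2l.
  by apply: le_trans (ltW st); exact: (component_le (s - t : cliff_mod n R^o)).
have c1 := cos_le1 phi; have c0 : 0 < cos phi by apply: cos_gt0_pihalf; have := pi_gt0 R; lra.
by have := normr_ge0 t; nra.
Qed.

End sectors.

(** * Resolvent bounds for bisectorial operators *)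

Section bisectorial_resolvents.
Variables (R : realType) (n : nat) (E : normedModType R).
Local Notation V := (cliff_mod n E).
Variables (T : set (V * V)) (omega phi : R) (J : clifford R n).
Hypothesis omega_itv : 0 < omega < pi / 2.
Hypothesis phi_itv : omega < phi < pi / 2.
Hypothesis T_closed : closed_operator T.
Hypothesis T_bisectorial : bisectorial omega T.
Hypothesis J_sphere : unit_sphere J.
Implicit Types (r psi : R).

Let phi_itv0 : 0 < phi < pi / 2.
Proof. by move: omega_itv phi_itv; lra. Qed.

Let T_fun : single_valued T. Proof. by have [] := T_closed. Qed.

Lemma Qop_jc z (u v : V) : Qop (jc J z) T (u, v) <-> Qrel T z u v.
Proof. by rewrite /Qop /Qrel /= jc_scalar// jc_norm. Qed.

Let polar_norm r psi : 0 < r -> `|jc J (polar r psi)| = r.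
Proof.
by move=> r0; apply: (pexpIrn (n := 2)); rewrite ?nnegrE ?(ltW r0)// jc_norm// csq_polar.
Qed.

(** The scalar part is at most [r cos phi < r cos omega], too small for a point of the closed double
    sector of angle [omega]. *)
Lemma polar_S_resolvent r psi : 0 < r -> `|cos psi| <= cos phi ->
  S_resolvent T (jc J (polar r psi)).
Proof.
move=> r0 psiI; apply: contrapT => nS.
have [_ + _] := T_bisectorial; move=> /(_ (jc J (polar r psi))) H.
have {H} /(closure_sector_scalar omega_itv) : closure (double_sector omega) (jc J (polar r psi)).
  by apply: H; split=> //; exact: jc_paravector.
rewrite polar_norm// jc_scalar// /polar /re /= normrM gtr0_norm// mulrC ler_pM2l//.
rewrite leNgt => /negP; apply; apply: (le_lt_trans psiI).
by rewrite ltr_cos ?in_itv/=; have := pi_gt0 R; move: omega_itv phi_itv; lra.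
Qed.

Lemma polar_regular r psi : 0 < r -> `|cos psi| <= cos phi -> regular T (polar r psi).
Proof.
move=> r0 psiI; have [_ [B _ BQ]] := polar_S_resolvent r0 psiI.
have BE u v : Qrel T (polar r psi) u v <-> u = B v.
  rewrite -Qop_jc; have := congr1 (fun S => S (v, u)) BQ; rewrite /op_inv /graph_of /=.
  by move=> ->.
split=> [v|u u' v /BE -> /BE -> //]; by exists (B v); apply/BE.
Qed.

Lemma SL_inv_polar r psi v : 0 < r -> `|cos psi| <= cos phi ->
  SL_inv (jc J (polar r psi)) T v =
  Qinv T (polar r psi) (lmul (jc J (conjc (polar r psi))) v) - TQinv T (polar r psi) v.
Proof.
move=> r0 psiI; have zr := polar_regular r0 psiI.
rewrite /SL_inv /op_app; apply: xget_unique.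
  exists (Qinv T (polar r psi) (lmul (jc J (conjc (polar r psi))) v)), (TQinv T (polar r psi) v).
  split=> //=.
    exists (lmul (pconj (jc J (polar r psi))) v) => //.
    by apply/Qop_jc; rewrite jc_conj//; exact: Qinv_rel.
  exists (Qinv T (polar r psi) v); first by apply/Qop_jc; exact: Qinv_rel.
  exact: Qinv_T.
move=> w [a [b [[u /= uE /Qop_jc ua] [u' /= /Qop_jc u'v u'b] ->]]].
have e1 : Qinv T (polar r psi) v = u' := Qinv_eq zr u'v.
have e2 : Qinv T (polar r psi) u = a := Qinv_eq zr ua.
have {}uE : u = lmul (pconj (jc J (polar r psi))) v := uE.
have e3 : op_app T u' = b by apply: (op_app_eq T_fun); exact: u'b.
by rewrite /= -e2 uE jc_conj// -e3 -e1.
Qed.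

Lemma Qinv_polarN r psi : Qinv T (polar r (- psi)) = Qinv T (polar r psi).
Proof.
rewrite /Qinv /Qrel /sqmod /polar /re /im /= cosN sinN mulrN sqrrN //.
Qed.

Lemma TQinv_polarN r psi : TQinv T (polar r (- psi)) = TQinv T (polar r psi).
Proof. by rewrite /TQinv Qinv_polarN. Qed.

Lemma conjc_polar r psi : conjc (polar r psi) = polar r (- psi).
Proof. by rewrite /conjc /polar /re /im /= cosN sinN mulrN. Qed.

(** [Q_s] is the same at [s] and at its conjugate. The difference of the two left resolvents is
    [- 2 r sin psi] times [Q^{-1} J], which bounds [Q^{-1}] since [|sin psi| >= sin phi]; their sum
    then bounds [T Q^{-1}]. *)
Lemma polar_resolvent_bounds : exists2 c, 0 <= c & forall r psi, 0 < r ->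
  `|cos psi| <= cos phi ->
  opnorm_le (Qinv T (polar r psi)) (c / r ^+ 2) /\ opnorm_le (TQinv T (polar r psi)) (c / r).
Proof.
have [_ _ /(_ phi phi_itv)[C C0 HC]] := T_bisectorial.
have [cJ HJ] := lmul_bounded E J.
have s0 := sin_phi_gt0 phi_itv0.
have T_lin := right_linear_lin (let: And3 _ h _ := T_closed in h).
have SL r psi : 0 < r -> `|cos psi| <= cos phi ->
    opnorm_le (SL_inv (jc J (polar r psi)) T) (C / r).
  move=> r0 psiI; rewrite -[in C / r](polar_norm psi r0); apply: HC.
  - exact: jc_paravector.
  - move=> /(double_sector_scalar phi_itv0); rewrite polar_norm// jc_scalar//.
    rewrite /polar /re /= normrM gtr0_norm// mulrC ltr_pM2l// ltNge psiI //.
  - by move=> /(congr1 (fun s => `|s|)); rewrite polar_norm// normr0; apply/eqP; rewrite gt_eqF.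
pose c1 := C * `|cJ| / sin phi.
have c10 : 0 <= c1 by rewrite divr_ge0 ?mulr_ge0// ltW.
have HQ r psi : 0 < r -> `|cos psi| <= cos phi ->
    opnorm_le (Qinv T (polar r psi)) (c1 / r ^+ 2).
  move=> r0 psiI w; have zr := polar_regular r0 psiI.
  have QL := Qinv_linear T_lin zr.
  pose v := - lmul J w.
  have Jv : lmul J v = w.
    by rewrite /v -scaleN1r lmulZr lmulJ_sqr// scaleN1r opprK.
  have vb : `|v| <= `|cJ| * `|w|.
    by rewrite normrN; apply: (le_trans (HJ w)); rewrite ler_wpM2r// ler_norm.
  have psiI' : `|cos (- psi)| <= cos phi by rewrite cosN.
  have e : SL_inv (jc J (polar r psi)) T v - SL_inv (jc J (polar r (- psi))) T v =
      (- (2 * (r * sin psi))) *: Qinv T (polar r psi) w.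
    rewrite !SL_inv_polar// Qinv_polarN TQinv_polarN !conjc_polar opprK !lmul_jc.
    rewrite !(linear_addE QL) !(linear_scaleE QL) Jv /polar /re /im /= cosN sinN; module.
  have sp : sin phi <= `|sin psi|.
    rewrite -(ger0_norm (ltW s0)) -!sqrtr_sqr ler_wsqrtr// !sin2cos2 lerD2l lerN2.
    by rewrite -[leLHS]real_normK ?num_real// lerXn2r ?nnegrE// (le_trans _ psiI).
  have h := le_trans (ler_normB _ _) (lerD (SL r psi r0 psiI v) (SL r (- psi) r0 psiI' v)).
  rewrite e normrZ normrN !normrM (ger0_norm (ler0n _ 2)) (gtr0_norm r0) in h.
  set N := `|Qinv T _ w| in h *.
  have N0 : 0 <= N by exact: normr_ge0.
  have rs0 : 0 < r * sin phi by rewrite mulr_gt0.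
  have h1 : N * (r * sin phi) <= C / r * `|v|.
    apply: (@le_trans _ _ (N * (r * `|sin psi|))); last by lra.
    by apply: ler_wpM2l => //; rewrite ler_wpM2l// ltW.
  have h2 : N * (r * sin phi) <= C / r * (`|cJ| * `|w|).
    by apply: (le_trans h1); apply: ler_wpM2l => //; rewrite divr_ge0// ltW.
  rewrite -ler_pdivlMr// in h2; apply: (le_trans h2); rewrite le_eqVlt; apply/orP; left; apply/eqP.
  by rewrite /c1; field; rewrite (gt_eqF r0) (gt_eqF s0).
exists (c1 + (C + c1)); first by rewrite !addr_ge0.
move=> r psi r0 psiI; split.
  apply: opnorm_leW (HQ r psi r0 psiI); apply: ler_wpM2r.
    by rewrite invr_ge0 exprn_ge0// ltW.
  by rewrite lerDl addr_ge0.
have zr := polar_regular r0 psiI; have QL := Qinv_linear T_lin zr.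
have psiI' : `|cos (- psi)| <= cos phi by rewrite cosN.
move=> v.
have e : 2 *: TQinv T (polar r psi) v = (2 * (r * cos psi)) *: Qinv T (polar r psi) v -
    (SL_inv (jc J (polar r psi)) T v + SL_inv (jc J (polar r (- psi))) T v).
  rewrite !SL_inv_polar// Qinv_polarN TQinv_polarN !conjc_polar opprK !lmul_jc.
  rewrite !(linear_addE QL) !(linear_scaleE QL) /polar /re /im /= cosN sinN; module.
have h := le_trans (ler_normD _ _) (lerD (SL r psi r0 psiI v) (SL r (- psi) r0 psiI' v)).
have h1 := HQ r psi r0 psiI v.
have h2 : `|2 *: TQinv T (polar r psi) v| <= 2 * r * (c1 / r ^+ 2 * `|v|) + (C / r * `|v| + C / r * `|v|).
  rewrite e; apply: (le_trans (ler_normB _ _)); apply: lerD => //.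
  rewrite normrZ; apply: ler_pM => //; rewrite !normrM (ger0_norm (ler0n _ 2)) (gtr0_norm r0).
  by rewrite ler_wpM2l// ler_piMr ?(ltW r0)// (le_trans psiI)// cos_le1.
rewrite normrZ (ger0_norm (ler0n _ 2)) in h2.
have -> : (c1 + (C + c1)) / r * `|v| = c1 / r * `|v| + (C / r * `|v| + c1 / r * `|v|) by ring.
have e3 : 2 * r * (c1 / r ^+ 2 * `|v|) = 2 * (c1 / r * `|v|) by field; rewrite gt_eqF.
have : 0 <= c1 / r * `|v| by rewrite mulr_ge0// divr_ge0// ltW.
rewrite e3 in h2; lra.
Qed.

End bisectorial_resolvents.

(** * The functional calculus as a difference of two ray integrals *)

Section omega_calculus_value.
Variables (R : realType) (n : nat) (E : normedModType R).
Local Notation V := (cliff_mod n E).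
Hypothesis V_reflexive : reflexive_space V.
Variables (T : set (V * V)) (omega phi : R) (J : clifford R n).
Hypothesis omega_itv : 0 < omega < pi / 2.
Hypothesis phi_itv : omega < phi < pi / 2.
Hypothesis T_closed : closed_operator T.
Hypothesis T_bisectorial : bisectorial omega T.
Hypothesis J_sphere : unit_sphere J.
Hypothesis T_fun : single_valued T.
Hypothesis T_lin : forall (k : R) u v u' v', T (u, v) -> T (u', v') ->
  T (k *: u + u', k *: v + v').
Hypothesis T_00 : T (0, 0).
Variable c0 : R.
Hypothesis c0_ge0 : 0 <= c0.
Hypothesis T_bounds : forall r psi, 0 < r -> `|cos psi| <= cos phi ->
  opnorm_le (Qinv T (polar r psi)) (c0 / r ^+ 2) /\ opnorm_le (TQinv T (polar r psi)) (c0 / r).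
Implicit Types (r psi : R).

Local Notation alg := (balg (resolvent_ops T)).
Local Notation bscale := (bscale (resolvent_ops T)).
Local Notation iota := (cplx_map bscale).
Local Notation Rs := (Rz T_fun T_lin T_00).
Local Notation qb := (qb T_fun T_lin T_00).
Local Notation pb := (pb T_fun T_lin T_00).

Let phi_itv0 : 0 < phi < pi / 2.
Proof. by move: omega_itv phi_itv; lra. Qed.

Let regular_polar r psi : 0 < r -> `|cos psi| <= cos phi -> regular T (polar r psi).
Proof. exact: (polar_regular omega_itv phi_itv T_bisectorial J_sphere). Qed.

Lemma sector_regular z : in_sector phi z -> regular T z.
Proof. by move=> [r [psi [r0 psiI ->]]]; apply: regular_polar => //; exact: abs_cos_le. Qed.

Lemma imag_polar r : (0, r) = polar r (pi / 2).
Proof. by rewrite /polar cos_pihalf sin_pihalf mulr0 mulr1. Qed.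

Lemma imag_regular r : 0 < r -> regular T (0, r).
Proof.
move=> r0; rewrite imag_polar; apply: regular_polar => //.
by rewrite cos_pihalf normr0 ltW// (cos_phi_gt0 phi_itv0).
Qed.

Lemma imag_bounds r : 0 < r ->
  opnorm_le (qb (0, r)) (c0 / r ^+ 2) /\ opnorm_le (pb (0, r)) (c0 / r).
Proof.
move=> r0; have zr := imag_regular r0.
have c1 : `|cos (pi / 2)| <= cos phi.
  by rewrite cos_pihalf normr0 ltW// (cos_phi_gt0 phi_itv0).
have [h1 h2] := T_bounds r0 c1; rewrite -imag_polar in h1 h2.
by split=> v; rewrite ?qbE// ?pbE//.
Qed.

Lemma Rs_bound r psi : 0 < r -> phi <= psi <= pi - phi -> cle (Rs (polar r psi)) (2 * c0 / r).
Proof.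
move=> r0 psiI; have c1 := abs_cos_le phi_itv0 psiI.
have [h1 h2] := T_bounds r0 c1; have zr := regular_polar r0 c1.
have q1 : opnorm_le (qb (polar r psi)) (c0 / r ^+ 2) by move=> v; rewrite qbE.
have p1 : opnorm_le (pb (polar r psi)) (c0 / r) by move=> v; rewrite pbE.
have rq (x : R) : `|x| <= r -> opnorm_le (bscale x * qb (polar r psi)) (c0 / r).
  move=> xr; have -> : c0 / r = r * (c0 / r ^+ 2) by field; rewrite gt_eqF.
  by apply: opnorm_balgM; [exact: ltW|exact: opnorm_scale|].
have -> : 2 * c0 / r = c0 / r + c0 / r by ring.
split.
  have rc : `|re (polar r psi)| <= r.
    by rewrite /polar /re /= normrM gtr0_norm// ler_piMr ?(ltW r0)// ler_norml cos_geN1 cos_le1.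
  exact: (opnorm_balgD (rq _ rc) (opnorm_balgN p1)).
have rs : `|im (polar r psi)| <= r.
  by rewrite /polar /im /= normrM gtr0_norm// ler_piMr ?(ltW r0)// ler_norml sin_geN1 sin_le1.
apply: opnorm_leW (opnorm_balgN (rq _ rs)).
by rewrite lerDl divr_ge0// ltW.
Qed.

Lemma Rs_resolvent z w : in_sector phi z -> in_sector phi w ->
  Rs w - Rs z = iota (z - w) * Rs z * Rs w.
Proof. by move=> /sector_regular zr /sector_regular wr; exact: Rz_resolvent. Qed.

(** The coefficient acts first and need not commute with the resolvent. Moving [J] onto the vector
    leaves only operators of the commutative algebra. *)
Lemma ray_integrand r psi c v : 0 < r -> `|cos psi| <= cos phi ->
  SL_inv (jc J (polar r psi)) T (lmul (jc J c) v) =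
  re (iota c * Rs (polar r psi)) v + im (iota c * Rs (polar r psi)) (lmul J v).
Proof.
move=> r0 psiI; have zr := regular_polar r0 psiI.
rewrite (SL_inv_polar omega_itv phi_itv T_closed T_bisectorial J_sphere)//.
have QL := Qinv_linear T_lin zr; have TQL := TQinv_linear T_fun T_lin zr.
have JJ := lmulJ_sqr J_sphere v.
rewrite !lmul_jc lmulDr !lmulZr JJ.
rewrite !(linear_addE QL, linear_scaleE QL, linear_oppE QL, linear_addE TQL, linear_scaleE TQL).
rewrite !cplxE /Rz /cplx_map /re /im /= ?qbE// ?pbE//.
rewrite /conjc /re /im /=; module.
Qed.

Lemma Rs_conj r psi : 0 < r -> `|cos psi| <= cos phi ->
  Rs (polar r (- psi)) = conjc (Rs (polar r psi)).
Proof.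
move=> r0 psiI; have psiI' : `|cos (- psi)| <= cos phi by rewrite cosN.
have zr := regular_polar r0 psiI; have zr' := regular_polar r0 psiI'.
have eq : qb (polar r (- psi)) = qb (polar r psi).
  by apply: balgP => v; rewrite (qbE _ _ _ _ zr) (qbE _ _ _ _ zr') Qinv_polarN.
have ep : pb (polar r (- psi)) = pb (polar r psi).
  by apply: balgP => v; rewrite (pbE _ _ _ _ zr) (pbE _ _ _ _ zr') TQinv_polarN.
rewrite /Rz eq ep -conjc_polar; apply: cplx_eq; first by [].
transitivity (- (bscale (- im (polar r psi)) * qb (polar r psi))); first by [].
by rewrite rmorphN mulNr.
Qed.

(** On the conjugate ray only the real part changes sign, so subtracting the two rays removes the
    terms with [J]. *)
Lemma ray_integrandN r psi c v : 0 < r -> `|cos psi| <= cos phi ->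
  SL_inv (jc J (polar r (- psi))) T (lmul (jc J (- conjc c)) v) =
  - re (iota c * Rs (polar r psi)) v + im (iota c * Rs (polar r psi)) (lmul J v).
Proof.
move=> r0 psiI; have psiI' : `|cos (- psi)| <= cos phi by rewrite cosN.
have -> := ray_integrand (- conjc c) v r0 psiI'.
have -> : iota (- conjc c) * Rs (polar r (- psi)) = - conjc (iota c * Rs (polar r psi)).
  rewrite Rs_conj// conjcM rmorphN mulNr; congr (- (_ * _)).
  by apply: cplx_eq; rewrite /cplx_map /conjc /re /im /= ?rmorphN.
set Y := iota c * _; have -> : im (- conjc Y) = im Y by rewrite imN /conjc {1}/im /= opprK.
by have -> : re (- conjc Y) = - re Y by [].
Qed.

Section one_pair.
Variables (f : clifford R n -> clifford R n) (psi : R) (G : R -> cplx R) (M beta : R).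
Hypothesis psiI : phi <= psi <= pi - phi.
Hypothesis fG : forall r, 0 < r -> f (jc J (polar r psi)) = jc J (G r).
Hypothesis fGN : forall r, 0 < r -> f (jc J (polar r (- psi))) = jc J (conjc (G r)).
Hypothesis G_cont : pos_ccontinuous G.
Hypothesis beta0 : 0 < beta.
Hypothesis M0 : 0 <= M.
Hypothesis G_le : forall r, 0 < r -> Num.sqrt (csq (G r)) <= M * peak beta r.

Definition im_ray (r : R) : alg := im (ray_fun Rs (fun r => expi psi * G r) psi r).

Lemma ray_pair : exists U A, [/\ op_antider im_ray U, op_total_incr U A &
  forall v, ray_integral T J f (- psi) v - ray_integral T J f psi v = - 2 *: A v].
Proof.
(* The coefficient [ds_J f(s)] per [dr]. Because of the division by [i], the real part of [w R] is
   [im_ray]. *)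
pose w r : cplx R := expi psi * cinv (0, 1) * G r.
have ci : cinv (0, 1) = (0, -1) :> cplx R.
  by rewrite /cinv /csq /re /im /= expr0n add0r expr1n !divr1.
have wc : pos_ccontinuous w.
  by apply: (@pos_ccontinuousM _ (fun=> expi psi * cinv (0, 1)) G) => //; exact: pos_ccontinuous_cst.
have w_le r : 0 < r -> Num.sqrt (csq (w r)) <= M * peak beta r.
  move=> r0; have -> : csq (w r) = csq (G r); last exact: G_le.
  rewrite /w !csqM ci /expi {1}/csq {1}/re {1}/im /= cos2Dsin2 mul1r.
  by rewrite {1}/csq {1}/re {1}/im /= expr0n add0r sqrrN expr1n mul1r.
have c20 : 0 <= 2 * c0 by rewrite mulr_ge0.
have psi_cos := abs_cos_le phi_itv0 psiI.
have [U [A [aU tU]]] := dominated_ray_re V_reflexive c20 Rs_resolvent Rs_bound psiI wc beta0 M0 w_le.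
have [W [B [aW tW]]] := dominated_ray_im V_reflexive c20 Rs_resolvent Rs_bound psiI wc beta0 M0 w_le.
have [cJ HJ] := lmul_bounded E J.
exists U, A; split; [|exact: tU|move=> v].
  apply: op_antider_ext aU => r r0; rewrite /im_ray /ray_fun.
  have -> : iota (expi psi * G r) * Rs (polar r psi) =
      iota (0, 1) * (iota (w r) * Rs (polar r psi)).
    rewrite mulrA -rmorphM; congr (iota _ * _); rewrite /w.
    transitivity (((0, 1) : cplx R) * cinv (0, 1) * (expi psi * G r)); last by ring.
    rewrite cinvM ?mul1r//.
    by rewrite /csq /re /im /= expr0n add0r expr1n oner_eq0.
  set Y := iota (w r) * _.
  have -> : im (iota (0, 1) * Y) = bscale 0 * im Y + bscale 1 * re Y by exact: imM.
  by rewrite rmorph0 rmorph1 mul0r add0r mul1r.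
have JE : Defs.pinv J = jc J (cinv (0, 1)) by rewrite -(jc_inv J_sphere) -jc_imag.
have e1 : ray_integral T J f psi = (fun v => A v + B (lmul J v)).
  apply: improper_integral_total (op_total_incrD tU (op_total_incr_compr HJ tW)).
  apply: op_antider_ext (op_antiderD aU (op_antider_compr HJ aW)) => r r0.
  apply/funext => u; rewrite jc_polar fG// jc_expi JE -!(jcM J_sphere).
  by rewrite ray_integrand.
have e2 : ray_integral T J f (- psi) = (fun v => - A v + B (lmul J v)).
  apply: improper_integral_total (op_total_incrD (op_total_incrN tU) (op_total_incr_compr HJ tW)).
  apply: op_antider_ext (op_antiderD (op_antiderN aU) (op_antider_compr HJ aW)) => r r0.
  apply/funext => u; rewrite jc_polar fGN// jc_expi JE -!(jcM J_sphere).
  have -> : expi (- psi) * cinv (0, 1) * conjc (G r) = - conjc (w r).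
    rewrite /w !conjcM ci /expi cosN sinN.
    have -> : conjc (0, -1) = - (0, -1) :> cplx R.
      by apply: cplx_eq; rewrite /conjc /re /im /= ?oppr0.
    by rewrite mulrN mulNr opprK.
  by rewrite ray_integrandN.
by rewrite e1 e2; module.
Qed.

End one_pair.

(** The angles [pi + phi] and [- (pi - phi)] agree modulo [2 pi], so the four rays form two
    conjugate pairs; the factor 2 from each pair turns [1 / (2 pi)] into [1 / pi]. *)
Lemma omega_calculus_total (f : clifford R n -> clifford R n) (G1 G2 : R -> cplx R) (M beta : R) :
  (forall r, 0 < r -> f (jc J (polar r phi)) = jc J (G1 r)) ->
  (forall r, 0 < r -> f (jc J (polar r (- phi))) = jc J (conjc (G1 r))) ->
  (forall r, 0 < r -> f (jc J (polar r (pi - phi))) = jc J (G2 r)) ->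
  (forall r, 0 < r -> f (jc J (polar r (- (pi - phi)))) = jc J (conjc (G2 r))) ->
  pos_ccontinuous G1 -> pos_ccontinuous G2 -> 0 < beta -> 0 <= M ->
  (forall r, 0 < r -> Num.sqrt (csq (G1 r)) <= M * peak beta r) ->
  (forall r, 0 < r -> Num.sqrt (csq (G2 r)) <= M * peak beta r) ->
  exists U, op_antider (fun r v => im_ray (pi - phi) G2 r v - im_ray phi G1 r v) U /\
    op_total_incr U (fun v => pi *: omega_calculus T J phi f v).
Proof.
move=> f1 f1' f2 f2' G1c G2c beta0 M0 G1_le G2_le.
have e1 : phi <= phi <= pi - phi by move: phi_itv0; lra.
have e2 : phi <= pi - phi <= pi - phi by move: phi_itv0; lra.
have [U1 [A1 [aU1 tU1 r1]]] := ray_pair e1 f1 f1' G1c beta0 M0 G1_le.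
have [U2 [A2 [aU2 tU2 r2]]] := ray_pair e2 f2 f2' G2c beta0 M0 G2_le.
exists (fun r v => U2 r v - U1 r v); split.
  exact: op_antiderD aU2 (op_antiderN aU1).
have -> : (fun v => pi *: omega_calculus T J phi f v) = (fun v => A2 v - A1 v).
  apply/funext => v; rewrite /omega_calculus r1.
  have -> : ray_integral T J f (pi + phi) = ray_integral T J f (- (pi - phi)).
    have E1 : cexp J (pi + phi) = cexp J (- (pi - phi)).
      rewrite /cexp cosN sinN cosD cosB sinD sinB cospi sinpi; congr slice_point; ring.
    by rewrite /ray_integral E1.
  have p0 : pi != 0 :> R by rewrite gt_eqF ?pi_gt0.
  rewrite -[_ + _ - _]addrA -[X in _ + X]opprB r2 scalerA.
  have -> : pi * (2 * pi)^-1 = 2^-1 :> R by rewrite invfM mulrCA mulfV// mulr1.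
  rewrite scalerBr !scalerA !mulrN mulVf ?pnatr_eq0//; module.
exact: op_total_incrD tU2 (op_total_incrN tU1).
Qed.

End omega_calculus_value.

(** * Functions on rays *)

Section continuously_differentiable_functions.
Variable R : realType.
Implicit Types (g : R * R -> R) (O : set (R * R)).

Lemma derive_lipschitz (h dh : R -> R) (a b M : R) :
  (forall t : R, Num.min a b <= t <= Num.max a b -> is_derive t 1 h (dh t)) ->
  (forall t, Num.min a b <= t <= Num.max a b -> `|dh t| <= M) ->
  `|h b - h a| <= M * `|b - a|.
Proof.
wlog ab : a b / a <= b => [H|].
  have [ab|ba] := orP (le_total a b); first exact: H.
  by rewrite minC maxC => h1 h2; rewrite distrC (distrC b); exact: H.
rewrite min_l// max_r// => hD dM.
have [c cI ->] : exists2 c, c \in `[a, b]%R & h b - h a = dh c * (b - a).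
  apply: MVT_segment => //.
    by move=> x /subset_itv_oo_cc; rewrite in_itv; exact: hD.
  by apply: derivable_within_continuous => c; rewrite in_itv => /hD [].
by rewrite normrM ler_wpM2r//; apply: dM; move: cI; rewrite in_itv.
Qed.

Lemma derive_dx g (x y : R) : derivable g (x, y) (1, 0) ->
  is_derive x 1 (fun t => g (t, y)) (dx g (x, y)).
Proof.
rewrite /dx /derivable /derive => h.
have e : (fun t : R => t^-1 *: (g (t *: (1, 0) + (x, y)) - g (x, y))) =
    (fun t : R => t^-1 *: (((fun t => g (t, y)) \o shift x) (t *: 1) - g (x, y))).
  apply/funext => t; congr (_ *: (g _ - _)); congr pair => /=.
  by rewrite /GRing.scale /= mulr0 add0r.
rewrite e in h; split; first exact: h.
by rewrite /derive e.
Qed.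

Lemma derive_dy g (x y : R) : derivable g (x, y) (0, 1) ->
  is_derive y 1 (fun t => g (x, t)) (dy g (x, y)).
Proof.
rewrite /dy /derivable /derive => h.
have e : (fun t : R => t^-1 *: (g (t *: (0, 1) + (x, y)) - g (x, y))) =
    (fun t : R => t^-1 *: (((fun t => g (x, t)) \o shift y) (t *: 1) - g (x, y))).
  apply/funext => t; congr (_ *: (g _ - _)); congr pair => /=.
  by rewrite /GRing.scale /= mulr0 add0r.
rewrite e in h; split; first exact: h.
by rewrite /derive e.
Qed.

(** The partial derivatives are bounded near [p]; the mean value theorem along a vertical and a
    horizontal segment gives a Lipschitz estimate. *)
Lemma continuously_differentiable_continuous g O p : open O ->
  continuously_differentiable O g -> O p -> {for p, continuous g}.
Proof.
move=> Oo gC Op; have [_ _ cx cy] := gC p Op.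
pose M : R := `|dx g p| + `|dy g p| + 1.
have M0 : 0 < M by rewrite ltr_wpDl.
have : \forall q \near p, [/\ O q, `|dx g q| <= M & `|dy g q| <= M].
  move: (cx) => /cvgr_norm_le ax; move: (cy) => /cvgr_norm_le ay.
  near=> q; split.
  - by near: q; exact: open_nbhs_nbhs.
  - near: q; apply: ax; rewrite /M ltr_pwDr// lerDl //.
  - near: q; apply: ay; rewrite /M ltr_pwDr// lerDr //.
move=> /nbhs_ballP [d /= d0 Hd].
apply/cvgrPdist_le => eps e0 /=.
pose d' := Num.min d (eps / (2 * M)).
have d'0 : 0 < d' by rewrite lt_min d0 divr_gt0// mulr_gt0.
exists (ball p.1 d', ball p.2 d'); first by split; exact: nbhsx_ballx.
move=> [q1 q2] []; clearbody M; case: p Op cx cy Hd => p1 p2 Op cx cy Hd /=.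
rewrite -!ball_normE /= !lt_min => /andP[a1 a2] /andP[b1 b2].
have near_le (x y t : R) : `|x - y| < d -> Num.min y x <= t <= Num.max y x -> `|x - t| < d.
  rewrite !ltr_norml; case: (leP y x) => _; lra.
have yline (t : R) : Num.min q2 p2 <= t <= Num.max q2 p2 -> O (q1, t) /\ `|dy g (q1, t)| <= M.
  move=> tI; have /Hd [h1 h2 h3] : ball (p1, p2) d (q1, t); last by [].
  by split => //=; exact: near_le tI.
have xline (t : R) : Num.min q1 p1 <= t <= Num.max q1 p1 -> O (t, p2) /\ `|dx g (t, p2)| <= M.
  move=> tI; have /Hd [h1 h2 h3] : ball (p1, p2) d (t, p2); last by [].
  by split => /=; [exact: near_le tI|exact: ballxx].
have l1 : `|g (q1, p2) - g (q1, q2)| <= M * `|p2 - q2|.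
  apply: (@derive_lipschitz (fun t => g (q1, t)) (fun t => dy g (q1, t))) => t /yline [Ot //].
  by move=> _; apply: derive_dy; have [] := gC _ Ot.
have l2 : `|g (p1, p2) - g (q1, p2)| <= M * `|p1 - q1|.
  apply: (@derive_lipschitz (fun t => g (t, p2)) (fun t => dx g (t, p2))) => t /xline [Ot //].
  by move=> _; apply: derive_dx; have [] := gC _ Ot.
apply: (le_trans (ler_distD (g (q1, p2)) _ _)).
have m1 : M * `|p2 - q2| <= eps / 2.
  by move: b2 => /ltW; rewrite ler_pdivlMr ?mulr_gt0//; lra.
have m2 : M * `|p1 - q1| <= eps / 2.
  by move: a2 => /ltW; rewrite ler_pdivlMr ?mulr_gt0//; lra.
lra.
Unshelve. all: by end_near.
Qed.

End continuously_differentiable_functions.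

(** * Intrinsic functions on the boundary rays *)

Section slice_data.
Variables (R : realType) (n : nat) (theta phi : R).
Hypothesis theta_itv : 0 < theta < pi / 2.
Hypothesis phi_itv : 0 < phi < theta.
Implicit Types (r psi x y : R).

(** A subset of [slice_domain] given by a polynomial inequality, so that its openness is immediate;
    it contains the rays of the integration path. *)
Let sector2 : set (R * R) := [set p | 0 < p.1 ^+ 2 - cos theta ^+ 2 * (p.1 ^+ 2 + p.2 ^+ 2)].

Let cos_theta_gt0 : 0 < cos theta.
Proof. by apply: cos_gt0_pihalf; move: theta_itv (pi_gt0 R); lra. Qed.

Let sector2_open : open sector2.
Proof.
rewrite openE => p /= p0.
have c : {for p, continuous (fun p : R * R => p.1 ^+ 2 - cos theta ^+ 2 * (p.1 ^+ 2 + p.2 ^+ 2))}.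
  have c1 : {for p, continuous (fun p : R * R => p.1 ^+ 2)}.
    exact: (@continuous_comp _ _ _ fst (fun x : R => x ^+ 2) p (@cvg_fst _ _ _ _ _) (@exprn_continuous _ 2 _)).
  have c2 : {for p, continuous (fun p : R * R => p.2 ^+ 2)}.
    exact: (@continuous_comp _ _ _ snd (fun x : R => x ^+ 2) p (@cvg_snd _ _ _ _ _) (@exprn_continuous _ 2 _)).
  apply: cvgB => //; apply: cvgMr; exact: cvgD.
move: c => /cvgr_gt /(_ _ p0).
by rewrite -near_nbhs.
Qed.

(** The angle [asin (y / r)] serves for [x >= 0], and its supplement for [x < 0]. *)
Lemma sector_polar x y : 0 < x ^+ 2 - cos theta ^+ 2 * (x ^+ 2 + y ^+ 2) ->
  exists r psi, [/\ 0 < r,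
    (- theta < psi < theta) || (pi - theta < psi < pi + theta),
    x = r * cos psi & y = r * sin psi].
Proof.
move=> xy; have c0 := cos_theta_gt0; have p0 := pi_gt0 R.
have x20 : 0 < x ^+ 2.
  have : 0 <= cos theta ^+ 2 * (x ^+ 2 + y ^+ 2) by rewrite mulr_ge0 ?addr_ge0 ?sqr_ge0.
  by lra.
pose r := Num.sqrt (x ^+ 2 + y ^+ 2).
have r20 : 0 < x ^+ 2 + y ^+ 2 by rewrite ltr_pwDl// sqr_ge0.
have r0 : 0 < r by rewrite sqrtr_gt0.
have r2 : r ^+ 2 = x ^+ 2 + y ^+ 2 by rewrite sqr_sqrtr// ltW.
have yr : -1 <= y / r <= 1.
  rewrite -ler_norml normrM normfV (gtr0_norm r0) ler_pdivrMr// mul1r.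
  by rewrite -[leRHS]ger0_norm ?(ltW r0)// -ler_sqr ?nnegrE// !real_normK ?num_real// r2 lerDr sqr_ge0.
have sa : sin (asin (y / r)) = y / r by exact: asinK.
have ca : cos (asin (y / r)) = `|x| / r.
  rewrite cos_asin//; apply: (pexpIrn (n := 2)); rewrite ?nnegrE ?sqrtr_ge0//.
    by rewrite divr_ge0// ltW.
  rewrite sqr_sqrtr.
    by rewrite !exprMn !exprVn real_normK ?num_real// r2; field; rewrite gt_eqF.
  by rewrite subr_ge0 exprMn exprVn r2 ler_pdivrMr// mul1r lerDr sqr_ge0.
have ct : cos theta < cos (asin (y / r)).
  rewrite ca ltr_pdivlMr// -ltr_sqr ?nnegrE ?mulr_ge0 ?(ltW c0) ?(ltW r0)//.
  by rewrite exprMn r2 real_normK ?num_real//; lra.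
have [b1 b2] := (asin_geNpi2 yr, asin_lepi2 yr).
set a := asin _ in sa ca ct b1 b2 *.
have aI : - theta < a < theta.
  move: theta_itv => tI; have mono := @ltr_cos R.
  have [a0|a0] := leP 0 a.
    have : a < theta; last by lra.
    by rewrite -mono ?in_itv/=//; lra.
  have : - a < theta; last by lra.
  by rewrite -mono ?in_itv/= ?cosN//; lra.
have [x0|x0] := leP 0 x.
  exists r, a; split=> //; first by rewrite aI.
    by rewrite ca ger0_norm//; field; rewrite gt_eqF.
  by rewrite sa; field; rewrite gt_eqF.
exists r, (pi - a); split=> //; first by apply/orP; right; lra.
  by rewrite cosB cospi sinpi ca ltr0_norm//; field; rewrite gt_eqF.
by rewrite sinB cospi sinpi sa; field; rewrite gt_eqF.
Qed.

Let sector2_slice p : sector2 p -> slice_domain (@double_sector R n theta) p.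
Proof.
move=> /sector_polar [r [psi [r0 psiI xE yE]]] J JS.
exists r, J, psi; split=> //.
by rewrite /cexp /slice_point scalerDr !scalerA -xE -yE.
Qed.

Lemma ray_in_sector r psi : 0 < r -> psi = phi \/ psi = pi - phi ->
  sector2 (r * cos psi, r * sin psi) /\ sector2 (r * cos (- psi), r * sin (- psi)).
Proof.
move=> r0 psiE.
have cs := cos2Dsin2 psi.
have c2 : cos psi ^+ 2 = cos phi ^+ 2.
  by case: psiE => [->//|->]; rewrite cosB cospi sinpi mul0r addr0 mulN1r sqrrN.
have lt : cos theta ^+ 2 < cos psi ^+ 2.
  have c1 : cos theta < cos phi.
    by rewrite ltr_cos ?in_itv/=; move: theta_itv phi_itv (pi_gt0 R); lra.
  rewrite c2 ltr_sqr ?nnegrE ?(ltW cos_theta_gt0)//.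
  exact: ltW (lt_trans cos_theta_gt0 c1).
have h : 0 < r ^+ 2 * (cos psi ^+ 2 - cos theta ^+ 2).
  by rewrite mulr_gt0 ?subr_gt0// exprn_gt0.
have e : (r * cos psi) ^+ 2 - cos theta ^+ 2 * ((r * cos psi) ^+ 2 + (r * sin psi) ^+ 2) =
    r ^+ 2 * (cos psi ^+ 2 - cos theta ^+ 2).
  transitivity (r ^+ 2 * (cos psi ^+ 2 - cos theta ^+ 2 * (cos psi ^+ 2 + sin psi ^+ 2))).
    by ring.
  by rewrite cs mulr1.
by rewrite /sector2 /= cosN sinN mulrN sqrrN e; split.
Qed.

(** [g = f0 + i f1] represents [f] in all planes C_J at once, and the parities of [f0] and [f1] give
    conjugate values on conjugate rays. *)
Lemma intrinsic_rays f C alpha : intrinsic_poly theta C alpha f ->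
  exists g : cplx R -> cplx R, forall psi, psi = phi \/ psi = pi - phi ->
  [/\ pos_ccontinuous (fun r => g (polar r psi)),
      forall (J : clifford R n) r, unit_sphere J -> 0 < r ->
        f (jc J (polar r psi)) = jc J (g (polar r psi)) /\
        f (jc J (polar r (- psi))) = jc J (conjc (g (polar r psi))) &
      forall (J : clifford R n) r, unit_sphere J -> 0 < r ->
        Num.sqrt (csq (g (polar r psi))) <= C * (r `^ alpha + r `^ (- alpha))].
Proof.
move=> [[f0 [f1 [f0C f1C fE fN _]]] C0 al0 fle].
exists (fun z => (f0 z, f1 z)) => psi psiE.
have ray r : 0 < r -> slice_domain (@double_sector R n theta) (polar r psi).
  by move=> r0; apply: sector2_slice; have [] := ray_in_sector r0 psiE.
have rayN r : 0 < r -> slice_domain (@double_sector R n theta) (polar r (- psi)).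
  by move=> r0; apply: sector2_slice; have [] := ray_in_sector r0 psiE.
have gE (J : clifford R n) r : unit_sphere J -> 0 < r ->
    f (jc J (polar r psi)) = jc J (f0 (polar r psi), f1 (polar r psi)).
  move=> JS r0; rewrite /jc fE//; last exact: ray.
  by rewrite /slice_point /= -scalerAr mulr1.
split.
- have H (h : R * R -> R) : continuously_differentiable (slice_domain (@double_sector R n theta)) h ->
      pos_continuous (fun r => h (polar r psi)).
    move=> hC r r0.
    have hc : {for polar r psi, continuous h}.
      apply: (continuously_differentiable_continuous sector2_open).
        by move=> p /sector2_slice; exact: hC.
      by have [] := ray_in_sector r0 psiE.
    apply: (@continuous_comp _ _ _ (fun r => polar r psi : R * R) h) => //.
    have lin (c : R) : x * c @[x --> r] --> r * c by apply: cvgM; [exact: cvg_id|exact: cvg_cst].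
    exact: (cvg_pair (lin (cos psi)) (lin (sin psi))).
  by split; exact: H.
- move=> J r JS r0; split; first exact: gE.
  have [] := fN _ _ (ray r r0); rewrite /= => e0 e1.
  rewrite /jc fE//; last exact: rayN.
  have -> : polar r (- psi) = (r * cos psi, - (r * sin psi)) by rewrite /polar cosN sinN mulrN.
  by rewrite /re /im /= e0 e1 /slice_point -scalerAr mulr1.
- move=> J r JS r0.
  have sD : double_sector theta (jc J (polar r psi)) by exact: ray.
  have := fle _ sD; rewrite (gE J)//.
  have nE z : `|jc J z| = Num.sqrt (csq z).
    by rewrite -(jc_norm JS) sqrtr_sqr ger0_norm.
  by rewrite !nE csq_polar sqrtr_sqr (gtr0_norm r0).
Qed.

End slice_data.

(** * The regularizer on the rays *)

Section regularizer_data.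
Variables (R : realType) (n : nat) (phi : R).
Hypothesis phi_itv : 0 < phi < pi / 2.
Implicit Types (r psi : R) (z w : cplx R).

Lemma cinvX z k : cinv (z ^+ k) = cinv z ^+ k.
Proof.
elim: k => [|k IH].
  by rewrite !expr0; apply: cplx_eq; rewrite /cinv /csq /re /im /= expr1n expr0n addr0 ?oppr0 divr1.
rewrite !exprS -IH; set w := z ^+ k; apply: cplx_eq; rewrite cplxE /cinv csqM.
  by rewrite /re /im /= invfM; ring.
by rewrite /re /im /= invfM; ring.
Qed.

Lemma csq_conjc z : csq (conjc z) = csq z.
Proof. by rewrite /csq /conjc /re /im /= sqrrN. Qed.

Lemma csqN z : csq (- z) = csq z.
Proof. by rewrite /csq reN imN !sqrrN. Qed.

Lemma regularizer_jc (J : clifford R n) m z : unit_sphere J ->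
  regularizer m (jc J z) = jc J ((z * cinv (1 + z ^+ 2)) ^+ m).
Proof.
move=> JS; rewrite /regularizer -(jcX JS z 2) -(jc1 J) -jcD -!jcX// jc_inv// -jcM//.
by rewrite cinvX exprMn.
Qed.

Definition ray_weight m psi r : cplx R := (polar r psi * kappa psi r) ^+ m.

Lemma regularizer_polar (J : clifford R n) m r psi : unit_sphere J ->
  regularizer m (jc J (polar r psi)) = jc J (ray_weight m psi r) /\
  regularizer m (jc J (polar r (- psi))) = jc J (conjc (ray_weight m psi r)).
Proof.
move=> JS; split; rewrite regularizer_jc//; congr (jc J _).
have -> : polar r (- psi) = conjc (polar r psi).
  by rewrite /conjc /polar cosN sinN mulrN.
by rewrite /ray_weight conjcX conjcM /kappa conjc_inv conjcD conjcX conjc1.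
Qed.

Lemma ray_weight_continuous m psi : psi = phi \/ psi = pi - phi ->
  pos_ccontinuous (ray_weight m psi).
Proof.
move=> psiE; have h := monomial_continuous phi_itv m m psiE.
have := pos_ccontinuousM (pos_ccontinuous_cst (expi (- psi))) h.
congr pos_ccontinuous; apply/funext => r; rewrite /monomial /ray_weight exprMn !mulrA.
have -> : expi (- psi) * expi psi = 1.
  by apply: cplx_eq; rewrite cplxE /expi /re /im /= cosN sinN;
    [rewrite mulNr opprK -!expr2 cos2Dsin2|ring].
by rewrite mul1r.
Qed.

Lemma ray_weight_le m psi r : psi = phi \/ psi = pi - phi -> 0 < r ->
  Num.sqrt (csq (ray_weight m psi r)) <= (cos phi)^-1 ^+ m * (r / (1 + r ^+ 2)) ^+ m.
Proof.
move=> psiE r0; have c0 := cos_phi_gt0 phi_itv.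
have csq0 z : 0 <= csq z by exact: csq_ge0.
have r1 : 0 < 1 + r ^+ 2 by rewrite ltr_wpDr// sqr_ge0.
have base : Num.sqrt (csq (polar r psi * kappa psi r)) <= (cos phi)^-1 * (r / (1 + r ^+ 2)).
  have -> : csq (polar r psi * kappa psi r) = csq (polar r phi * kappa phi r).
    case: psiE => [->//|->].
    by rewrite polar_reflect kappa_reflect mulNr -conjcM csqN csq_conjc.
  rewrite csqM csq_polar sqrtrM ?sqr_ge0// sqrtr_sqr gtr0_norm//.
  apply: (le_trans (ler_wpM2l (ltW r0) (sqrt_csq_kappa phi_itv r))).
  by rewrite le_eqVlt; apply/orP; left; apply/eqP; field; rewrite (gt_eqF c0) (gt_eqF r1).
rewrite /ray_weight csqX; have -> : Num.sqrt (csq (polar r psi * kappa psi r) ^+ m) =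
    Num.sqrt (csq (polar r psi * kappa psi r)) ^+ m.
  elim: (m) => [|k IH]; first by rewrite !expr0 sqrtr1.
  by rewrite !exprS sqrtrM// IH.
by rewrite -exprMn lerXn2r ?nnegrE ?sqrtr_ge0// (le_trans _ base) ?sqrtr_ge0.
Qed.

Lemma weighted_le m psi (C alpha r : R) (g : cplx R) : psi = phi \/ psi = pi - phi -> 0 < r ->
  0 <= alpha -> alpha < m%:R -> 0 <= C ->
  Num.sqrt (csq g) <= C * (r `^ alpha + r `^ (- alpha)) ->
  Num.sqrt (csq (ray_weight m psi r * g)) <= ((cos phi)^-1 ^+ m * C * 8) * peak (m%:R - alpha) r.
Proof.
move=> psiE r0 al0 alm C0 gle; have c0 := cos_phi_gt0 phi_itv.
rewrite csqM sqrtrM ?csq_ge0//.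
have h := ler_pM (sqrtr_ge0 _) (sqrtr_ge0 _) (ray_weight_le m psiE r0) gle.
apply: (le_trans h).
have -> : (cos phi)^-1 ^+ m * (r / (1 + r ^+ 2)) ^+ m * (C * (r `^ alpha + r `^ (- alpha))) =
  ((cos phi)^-1 ^+ m * C) * ((r / (1 + r ^+ 2)) ^+ m * (r `^ alpha + r `^ (- alpha))) by ring.
rewrite -[leRHS]mulrA; apply: ler_wpM2l; last exact: growth_le_peak.
by rewrite mulr_ge0// exprn_ge0// invr_ge0 ltW.
Qed.

End regularizer_data.

(** * The closure *)

Section bounded_pairs.
Variables (R : realType) (n : nat) (VR : normedModType R).
Local Notation V := (cliff_mod n VR).

Lemma rmul_bounded (a : clifford R n) : exists c, opnorm_le (fun v : V => rmul v a) c.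
Proof.
exists (\sum_(K : {set 'I_n}) \sum_A `|csign R A (symd A K) * a (symd A K)|) => v.
apply: (le_trans (cliff_norm_le_sum _)); rewrite mulr_suml; apply: ler_sum => K _.
rewrite ffunE; apply: (le_trans (ler_norm_sum _ _ _)); rewrite mulr_suml.
by apply: ler_sum => A _; rewrite normrZ ler_wpM2l// component_le.
Qed.

Lemma bounded_weak_cvg (B : V -> V) c (G : set_system nat) (x : nat -> V) z :
  linear B -> opnorm_le B c -> weak_cvg G x z -> weak_cvg G (fun k => B (x k)) (B z).
Proof.
move=> BL Bc xz f [fL [d fd]]; apply: (xz (fun v => f (B v))).
split=> [k u v|]; first by rewrite BL fL.
exists (`|d| * c) => v; rewrite -mulrA; apply: (le_trans (fd _)).
by apply: (le_trans (ler_wpM2r _ (ler_norm d))) => //; rewrite ler_wpM2l.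
Qed.

Variables (E F : V -> V) (cE cF : R).
Hypothesis E_linear : linear E.
Hypothesis F_linear : linear F.
Hypothesis E_le : opnorm_le E cE.
Hypothesis F_le : opnorm_le F cF.
Hypothesis E_rmul : forall v a, E (rmul v a) = rmul (E v) a.
Hypothesis F_rmul : forall v a, F (rmul v a) = rmul (F v) a.
Hypothesis EF : forall v, E (F v) = F (E v).
Hypothesis E_inj : forall v, E v = 0 -> v = 0.

Let E0 : E 0 = 0. Proof. by apply: (addrI (E 0)); rewrite -linear_addE// !addr0. Qed.

Let E_injective v w : E v = E w -> v = w.
Proof.
move=> vw; apply/eqP; rewrite -subr_eq0; apply/eqP; apply: E_inj.
by rewrite linear_addE// linear_oppE// vw subrr.
Qed.

Lemma left_quotientP v w :
  op_comp (op_inv (graph_of E)) (graph_of F) (v, w) <-> F v = E w.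
Proof.
rewrite /op_comp /op_inv /graph_of /=; split=> [[u -> //]|vw].
by exists (F v).
Qed.

Lemma right_quotientP v w :
  op_comp (graph_of F) (op_inv (graph_of E)) (v, w) <-> exists u, v = E u /\ w = F u.
Proof.
rewrite /op_comp /op_inv /graph_of /=; split=> [[u vE wF]|[u [vE wF]]]; first by exists u.
by exists u.
Qed.

(** The graph is the kernel of the bounded map [(v, w) -> F v - E w], and it is single valued by
    injectivity of [E]. *)
Lemma left_quotient_closed :
  closed_operator (op_comp (op_inv (graph_of E)) (graph_of F)).
Proof.
have F0 := linear_0E F_linear; split.
- by move=> v w w' /left_quotientP vw /left_quotientP vw'; apply: E_injective; rewrite -vw.
- split; first by apply/left_quotientP; rewrite F0 E0.
    move=> v w v' w' /left_quotientP vw /left_quotientP vw'; apply/left_quotientP.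
    by rewrite !(linear_addE E_linear, linear_addE F_linear) vw vw'.
  by move=> v w a /left_quotientP vw; apply/left_quotientP; rewrite F_rmul vw E_rmul.
- move=> [v w] vw; apply/left_quotientP; apply/eqP; rewrite -subr_eq0 -normr_le0.
  apply/ler_addgt0Pr => e e0; rewrite add0r.
  have k0 : 0 < `|cE| + `|cF| + 1 by rewrite ltr_wpDl ?addr_ge0.
  pose d := e / (`|cE| + `|cF| + 1); have d0 : 0 < d by rewrite divr_gt0.
  have [[v' w'] [/left_quotientP vw' [b1 b2]]] := vw _ (nbhsx_ballx (v, w) d d0).
  move: b1 b2; rewrite -!ball_normE /= => b1 b2.
  have -> : F v - E w = F (v - v') - E (w - w').
    rewrite !(linear_addE E_linear, linear_oppE E_linear, linear_addE F_linear,
      linear_oppE F_linear) vw' opprB.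
    by rewrite addrA subrK.
  have le_abs (B : V -> V) c u : opnorm_le B c -> `|u| <= d -> `|B u| <= `|c| * d.
    move=> Bc ud; apply: (le_trans (Bc u)).
    by apply: (le_trans (ler_wpM2r _ (ler_norm c))) => //; rewrite ler_wpM2l.
  apply: (le_trans (ler_normB _ _)).
  apply: (le_trans (lerD (le_abs _ _ _ F_le (ltW b1)) (le_abs _ _ _ E_le (ltW b2)))).
  have -> : e = (`|cE| + `|cF| + 1) * d by rewrite /d mulrCA mulfV ?mulr1 ?gt_eqF.
  by rewrite -mulrDl ler_wpM2r ?(ltW d0)//; lra.
Qed.

(** The distance, in the sum norm, to the graph of [F E^{-1}]; it is sublinear because this graph is
    a linear subspace. *)
Let gap (x : V * V) : R := inf [set `|x.1 - E u| + `|x.2 - F u| | u in setT].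

Let gap_has_inf x : has_inf [set `|x.1 - E u| + `|x.2 - F u| | u in setT].
Proof.
split; first by exists (`|x.1 - E 0| + `|x.2 - F 0|), 0.
by exists 0 => _ [u _ <-]; rewrite addr_ge0.
Qed.

Let gap_le x u : gap x <= `|x.1 - E u| + `|x.2 - F u|.
Proof. by apply: ge_inf; [exact: (gap_has_inf x).2|exists u]. Qed.

Let gap_sublinear : sublinear gap.
Proof.
split=> [x y|t x t0].
  apply/ler_addgt0Pr => e e0; have e20 : 0 < e / 2 by rewrite divr_gt0.
  have [_ [u _ <-] h1] := inf_adherent e20 (gap_has_inf x).
  have [_ [w _ <-] h2] := inf_adherent e20 (gap_has_inf y).
  have h := gap_le (x + y) (u + w).
  have e1 : `|(x + y).1 - E (u + w)| <= `|x.1 - E u| + `|y.1 - E w|.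
    by rewrite (linear_addE E_linear) opprD addrACA; exact: ler_normD.
  have e2 : `|(x + y).2 - F (u + w)| <= `|x.2 - F u| + `|y.2 - F w|.
    by rewrite (linear_addE F_linear) opprD addrACA; exact: ler_normD.
  rewrite -/(gap x) in h1; rewrite -/(gap y) in h2; lra.
apply/ler_addgt0Pr => e e0; have t10 : 0 < t + 1 by lra.
have [_ [u _ <-] h1] := inf_adherent (divr_gt0 e0 t10) (gap_has_inf x).
rewrite -/(gap x) in h1; apply: (le_trans (gap_le (t *: x) (t *: u))).
rewrite (linear_scaleE E_linear) (linear_scaleE F_linear) /= -!scalerBr !normrZ ger0_norm// -mulrDr.
apply: (le_trans (ler_wpM2l t0 (ltW h1))); rewrite mulrDr lerD2l.
rewrite mulrCA ler_piMr ?(ltW e0)// ler_pdivrMr// mul1r.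
by rewrite lerDl.
Qed.

Variables (B : nat -> V -> V) (c d : R).
Hypothesis V_reflexive : reflexive_space V.
Hypothesis EB : forall k v, E (B k v) = B k (E v).
Hypothesis FB : forall k v, F (B k v) = B k (F v).
Hypothesis EB_le : forall k v, `|E (B k v)| <= c * `|v|.
Hypothesis EB_cvg : forall k v, `|E (E (B k v) - v)| <= d / k.+1%:R * `|v|.

(** By boundedness there is some weak limit [z]. As [E (E B_k v)] tends to [E v] in norm,
    [E z = E v], and [E] is injective. *)
Let EB_weak (G : set_system nat) v : UltraFilter G -> \oo `<=` G ->
  weak_cvg G (fun k => E (B k v)) v.
Proof.
move=> GU Goo; have GP := @ultra_proper _ _ GU.
have [z vz] := weak_cvg_bounded GU V_reflexive (fun k => EB_le k v).
have zv : z = v; last by move: vz; rewrite zv.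
apply: E_injective; apply/eqP; rewrite -subr_eq0 -normr_eq0 eq_le normr_ge0 andbT.
apply/ler_addgt0Pr => e e0; rewrite add0r.
apply: (weak_cvg_norm_le GP (bounded_weak_cvg E_linear E_le vz)).
pose N := Num.truncn ((`|d| * `|v|) / e).
apply: Goo; exists N => // k /= Nk.
have -> : E (E (B k v)) - E v = E (E (B k v) - v).
  by rewrite [in RHS](linear_addE E_linear) (linear_oppE E_linear).
apply: (le_trans (EB_cvg k v)).
apply: (@le_trans _ _ (`|d| * `|v| / k.+1%:R)).
  by rewrite mulrAC ler_wpM2r// ler_wpM2r// ler_norm.
rewrite ler_pdivrMr// -ler_pdivrMl// mulrC.
apply: ltW; apply: (lt_le_trans (truncnS_gt _)); by rewrite ler_nat ltnS.
Qed.

(** Hahn-Banach for [gap] gives [f <= gap] with equality at [(v, w)]; such an [f] is bounded and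
    vanishes on the graph. From [F v = E w] follows [E B_k w = F B_k v], so [f] vanishes at
    [(E B_k v, E B_k w)], which tends weakly to [(v, w)]. *)
Lemma right_quotient_dense v w : F v = E w -> gap (v, w) <= 0.
Proof.
move=> vw; have [f [fL fle <-]] := hahn_banach (v, w) gap_sublinear.
have [G [GU Goo]] := @ultraFilterLemma nat \oo _.
have GP := @ultra_proper _ _ GU.
have f0 : f 0 = 0 by have := fL (-1) 0 0; rewrite scaler0 addr0 => ?; lra.
have fN x : f (- x) = - f x by have := fL (-1) x 0; rewrite !addr0 scaleN1r f0 addr0 mulN1r.
have fD x y : f (x + y) = f x + f y by have := fL 1 x y; rewrite scale1r mul1r.
have f_le x y : `|f (x, y)| <= `|x| + `|y|.
  have h a b : f (a, b) <= `|a| + `|b|.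
    have := gap_le (a, b) 0; rewrite /= E0 (linear_0E F_linear) !subr0.
    exact: le_trans (fle _).
  rewrite ler_norml h andbT lerNl -fN.
  by have := h (- x) (- y); rewrite !normrN.
have f1 : normed_dual (fun x : V => f (x, 0)).
  split=> [k x y|]; last by exists 1 => x; rewrite mul1r; have := f_le x 0; rewrite normr0 addr0.
  by rewrite -[RHS]fL; congr f; congr pair; rewrite /= ?scaler0 ?addr0.
have f2 : normed_dual (fun y : V => f (0, y)).
  split=> [k x y|]; last by exists 1 => x; rewrite mul1r; have := f_le 0 x; rewrite normr0 add0r.
  by rewrite -[RHS]fL; congr f; congr pair; rewrite /= ?scaler0 ?addr0.
have fz u : f (E u, F u) = 0.
  have h x : f (E x, F x) <= 0.
    by apply: (le_trans (fle _)); apply: (le_trans (gap_le _ x)); rewrite /= !subrr normr0 addr0.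
  apply/le_anti; rewrite h /= -oppr_le0 -fN; have := h (- u).
  by rewrite (linear_oppE E_linear) (linear_oppE F_linear).
have fs x y : f (x, y) = f (x, 0) + f (0, y).
  by rewrite -fD; congr f; congr pair; rewrite /= ?addr0 ?add0r.
have h1 := @EB_weak G v GU Goo _ f1; have h2 := @EB_weak G w GU Goo _ f2.
have e0 : (fun k => f (E (B k v), 0) + f (0, E (B k w))) = (fun=> 0).
  by apply/funext => k; rewrite -fs EB (EB k w) -vw -FB -EB fz.
have h : f (E (B k v), 0) + f (0, E (B k w)) @[k --> G] --> f (v, w).
  by rewrite fs; exact: cvgD.
by rewrite e0 in h; rewrite (cvg_unique _ h (cvg_cst _)).
Qed.

Lemma left_quotient_is_closure :
  closable (op_comp (graph_of F) (op_inv (graph_of E))) /\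
  is_op_closure (op_comp (graph_of F) (op_inv (graph_of E)))
    (op_comp (op_inv (graph_of E)) (graph_of F)).
Proof.
have cl := left_quotient_closed.
have sub : op_comp (graph_of F) (op_inv (graph_of E)) `<=`
    op_comp (op_inv (graph_of E)) (graph_of F).
  by move=> [v w] /right_quotientP [u [-> ->]]; apply/left_quotientP.
split; first by exists (op_comp (op_inv (graph_of E)) (graph_of F)).
split=> // S [_ _ Sc] GS [v w] /left_quotientP vw; apply: Sc => U [] /= [P Q] /= [vP wQ] PQ.
have /nbhs_ballP [e1 /= e10 He1] := vP; have /nbhs_ballP [e2 /= e20 He2] := wQ.
have e0 : 0 < Num.min e1 e2 by rewrite lt_min e10.
have [_ [u _ <-]] := inf_adherent e0 (gap_has_inf (v, w)).
rewrite -/(gap (v, w)) => h; have {h} := lt_le_trans h _.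
have g0 := right_quotient_dense vw.
move=> /(_ (Num.min e1 e2)); rewrite -[leRHS]add0r lerD2r => /(_ g0) /=.
rewrite lt_min => /andP[h1 h2].
exists (E u, F u); split; first by apply: GS; apply/right_quotientP; exists u.
apply: PQ; split=> /=.
  apply: He1; rewrite -ball_normE /=; apply: le_lt_trans h1; by rewrite lerDl.
apply: He2; rewrite -ball_normE /=; apply: le_lt_trans h2; by rewrite lerDr.
Qed.

End bounded_pairs.

Section bounded_algebra_powers.
Variables (R : realType) (n : nat) (E : normedModType R).
Local Notation V := (cliff_mod n E).
Variable D : set (V -> V).
Implicit Type A : balg D.

Lemma opnorm_balgX A (a : R) k : 0 <= a -> opnorm_le A a -> opnorm_le (A ^+ k) (a ^+ k).
Proof.
move=> a0 Aa; elim: k => [|k IH]; last by rewrite !exprS; exact: opnorm_balgM.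
by rewrite !expr0 => v; rewrite balg1E mul1r.
Qed.

Lemma opnorm_balg1 : opnorm_le (1 : balg D) 1.
Proof. by move=> v; rewrite balg1E mul1r. Qed.

End bounded_algebra_powers.

(** * An approximate unit divisible by the regularizer *)

Section approximate_unit.
Variables (R : realType) (n : nat) (E : normedModType R).
Local Notation V := (cliff_mod n E).
Variable T : set (V * V).
Hypothesis T_fun : single_valued T.
Hypothesis T_lin : forall (k : R) u v u' v', T (u, v) -> T (u', v') ->
  T (k *: u + u', k *: v + v').
Hypothesis T_00 : T (0, 0).
Local Notation alg := (balg (resolvent_ops T)).
Local Notation bscale := (bscale (resolvent_ops T)).
Local Notation qb := (qb T_fun T_lin T_00).
Local Notation pb := (pb T_fun T_lin T_00).
Local Notation K := (pb (0, 1)).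
Local Notation S := (qb (0, 1)).
Hypothesis imag_reg : forall t : R, 0 < t -> regular T (0, t).
Variable c0 : R.
Hypothesis c0_ge0 : 0 <= c0.
Hypothesis q_le : forall t : R, 0 < t -> opnorm_le (qb (0, t)) (c0 / t ^+ 2).
Hypothesis p_le : forall t : R, 0 < t -> opnorm_le (pb (0, t)) (c0 / t).
Implicit Types t s : R.

(** [T S v = K v = 0] gives [S v = 0] by injectivity of [T]; then [v = S v + T K v = 0]. *)
Lemma pb1_injective v : op_injective T -> K v = 0 -> v = 0.
Proof.
move=> Tinj Kv; have ir := imag_reg ltr01.
have h1 := Tmul_K T_fun T_lin T_00 ir v; rewrite Kv in h1.
have h2 := Tmul_qp T_fun T_lin T_00 ir v; rewrite Kv in h2.
have Sv : S v = 0 := Tinj _ _ _ h2 T_00.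
have := T_fun h1 T_00; rewrite balgDE balgNE balg1E Sv.
by rewrite subr0.
Qed.

(* T^2 (T^2 + t^2)^{-1} * s^2 (T^2 + s^2)^{-1}, which tends to 1 as t -> 0, s -> oo *)
Definition unit_approx t s : alg :=
  (1 - bscale (t ^+ 2) * qb (0, t)) * (bscale (s ^+ 2) * qb (0, s)).

(** One factor [T] of [T^2] goes to each of the two resolvents, and [pb_factor] divides [T Q_t^{-1}]
    by [K]. *)
Definition unit_approx_cofactor t s : alg :=
  bscale (s ^+ 2) * (1 + (1 - bscale (t ^+ 2)) * qb (0, t)) * pb (0, s).

Lemma unit_approx_factor t s : 0 < t -> 0 < s ->
  K * unit_approx_cofactor t s = unit_approx t s.
Proof.
move=> t0 s0; have tr := imag_reg t0; have sr := imag_reg s0.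
have e1 := pb_factor T_fun T_lin T_00 (imag_reg ltr01) tr.
have e2 : pb (0, t) * pb (0, s) = (1 - bscale (t ^+ 2) * qb (0, t)) * qb (0, s).
  apply: (Tmul_unique T_fun (TmulMl (pb (0, t)) (Tmul_qp T_fun T_lin T_00 sr))).
  exact: TmulM (Tmul_pt T_fun T_lin T_00 tr).
transitivity (bscale (s ^+ 2) * (pb (0, t) * pb (0, s))).
  by rewrite e1 /unit_approx_cofactor; ring.
by rewrite e2 /unit_approx; ring.
Qed.

Let tq_le t : 0 < t -> opnorm_le (bscale (t ^+ 2) * qb (0, t)) c0.
Proof.
move=> t0; have -> : c0 = t ^+ 2 * (c0 / t ^+ 2) by field; rewrite gt_eqF.
apply: opnorm_balgM; [exact: sqr_ge0| |exact: q_le].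
by apply: opnorm_scale; rewrite ger0_norm ?sqr_ge0.
Qed.

Let tq1_le t : 0 < t -> opnorm_le (1 - bscale (t ^+ 2) * qb (0, t)) (1 + c0).
Proof.
by move=> t0; apply: opnorm_balgD (opnorm_balg1 _) (opnorm_balgN _); exact: tq_le.
Qed.

Lemma unit_approx_le t s : 0 < t -> 0 < s -> opnorm_le (unit_approx t s) ((1 + c0) * c0).
Proof.
by move=> t0 s0; apply: opnorm_balgM; [rewrite addr_ge0|exact: tq1_le|exact: tq_le].
Qed.

Lemma unit_approx_cofactor_bounded t s m : 0 < t -> 0 < s ->
  exists b, opnorm_le (unit_approx_cofactor t s ^+ m) b.
Proof.
move=> t0 s0; have ct0 : 0 <= c0 / t ^+ 2 by rewrite divr_ge0// sqr_ge0.
have cs0 : 0 <= c0 / s by rewrite divr_ge0// ltW.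
have s20 : 0 <= s ^+ 2 by exact: sqr_ge0.
have t20 : 0 <= 1 + t ^+ 2 by rewrite addr_ge0// sqr_ge0.
exists ((s ^+ 2 * (1 + (1 + t ^+ 2) * (c0 / t ^+ 2)) * (c0 / s)) ^+ m).
apply: opnorm_balgX; first by rewrite mulr_ge0 // mulr_ge0 // addr_ge0 // mulr_ge0.
apply: opnorm_balgM; [by rewrite mulr_ge0 // addr_ge0 // mulr_ge0| |exact: p_le].
apply: opnorm_balgM => //; first by apply: opnorm_scale; rewrite ger0_norm.
apply: opnorm_balgD (opnorm_balg1 _) _; apply: opnorm_balgM => //; last exact: q_le.
apply: opnorm_balgD (opnorm_balg1 _) (opnorm_balgN _).
by apply: opnorm_scale; rewrite ger0_norm ?sqr_ge0.
Qed.

Lemma pb1_opnorm_le : opnorm_le K c0.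
Proof. by have := p_le ltr01; rewrite divr1. Qed.

Lemma qb1_opnorm_le : opnorm_le S c0.
Proof. by have := q_le ltr01; rewrite expr1n divr1. Qed.

(** [1 - X Y = (1 - X) + X (1 - Y)] together with [K_low] and [K_high]; the choice [t = 1 / s] makes
    both errors of order [1 / k]. *)
Lemma unit_approx_cvg : exists2 c, 0 <= c & forall k : nat,
  opnorm_le (K * (1 - unit_approx k.+1%:R^-1 k.+1%:R)) (c / k.+1%:R).
Proof.
exists (c0 * c0 + (1 + c0) * (1 + c0) * c0).
  by rewrite !(addr_ge0, mulr_ge0).
move=> k; have s0 : 0 < k.+1%:R :> R by [].
have t0 : 0 < k.+1%:R^-1 :> R by rewrite invr_gt0.
set s : R := k.+1%:R in s0 t0 *; set t := s^-1 in t0 *.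
have h1 : opnorm_le (K * (bscale (t ^+ 2) * qb (0, t))) (c0 * c0 / s).
  rewrite (K_low T_fun T_lin T_00 (imag_reg ltr01) (imag_reg t0)).
  have -> : c0 * c0 / s = t ^+ 2 * (c0 * (c0 / t)).
    by rewrite /t; field; rewrite gt_eqF.
  apply: opnorm_balgM; [exact: sqr_ge0| |].
    by apply: opnorm_scale; rewrite ger0_norm ?sqr_ge0.
  by apply: opnorm_balgM; [|exact: qb1_opnorm_le|exact: p_le].
have h2 : opnorm_le (K * (1 - bscale (s ^+ 2) * qb (0, s))) ((1 + c0) * (c0 / s)).
  rewrite (K_high T_fun T_lin T_00 (imag_reg ltr01) (imag_reg s0)).
  apply: opnorm_balgM; [by rewrite addr_ge0| |exact: p_le].
  exact: opnorm_balgD (opnorm_balg1 _) (opnorm_balgN qb1_opnorm_le).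
have -> : K * (1 - unit_approx t s) = K * (bscale (t ^+ 2) * qb (0, t)) +
    (1 - bscale (t ^+ 2) * qb (0, t)) * (K * (1 - bscale (s ^+ 2) * qb (0, s))).
  by rewrite /unit_approx; ring.
have -> : (c0 * c0 + (1 + c0) * (1 + c0) * c0) / s =
    c0 * c0 / s + (1 + c0) * ((1 + c0) * (c0 / s)) by ring.
apply: opnorm_balgD h1 _; apply: opnorm_balgM h2; first by rewrite addr_ge0.
exact: tq1_le.
Qed.

Lemma unit_approx_pow_cvg m : exists d : R, forall k : nat,
  opnorm_le (K ^+ m * (1 - unit_approx k.+1%:R^-1 k.+1%:R ^+ m)) (d / k.+1%:R).
Proof.
have [c cge0 Hc] := unit_approx_cvg.
elim: m => [|m [d Hd]].
  by exists 0 => k v; rewrite !expr0 subrr mulr0 balg0E normr0 mul0r mul0r.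
exists (c0 * d + c0 ^+ m * ((1 + c0) * c0) ^+ m * c) => k.
have s0 : 0 < k.+1%:R :> R by [].
have t0 : 0 < k.+1%:R^-1 :> R by rewrite invr_gt0.
set Y := unit_approx _ _.
have c10 : 0 <= (1 + c0) * c0 by rewrite mulr_ge0 ?addr_ge0.
(* Telescoping, with the spare factor [K] spent on the last difference [1 - Y]. *)
have -> : K ^+ m.+1 * (1 - Y ^+ m.+1) =
    K * (K ^+ m * (1 - Y ^+ m)) + K ^+ m * Y ^+ m * (K * (1 - Y)).
  by rewrite !exprS; ring.
rewrite mulrDl -!mulrA; apply: opnorm_balgD; first exact: opnorm_balgM c0_ge0 pb1_opnorm_le (Hd k).
rewrite [c0 ^+ m * _]mulrA [K ^+ m * _]mulrA; apply: opnorm_balgM (Hc k).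
  by rewrite mulr_ge0 ?exprn_ge0.
apply: opnorm_balgM; [by rewrite exprn_ge0|exact: opnorm_balgX pb1_opnorm_le|].
by apply: opnorm_balgX => //; exact: unit_approx_le.
Qed.

End approximate_unit.

(** * Operators given by improper integrals *)

Section integrals_of_algebra_elements.
Variables (R : realType) (n : nat) (E : normedModType R).
Local Notation V := (cliff_mod n E).
Variables (D : set (V -> V)) (X : R -> balg D) (U : R -> V -> V) (A : V -> V).
Hypothesis X_antider : op_antider X U.
Hypothesis U_total : op_total_incr U A.

(** Both sides are improper integrals of the same function, so they agree by uniqueness; the same
    argument gives [total_commute]. *)
Lemma total_linear : linear A.
Proof.
move=> k v w; have := op_antider_at (k *: v + w) X_antider => h1.
have h2 := antiderD (antiderZ k (op_antider_at v X_antider)) (op_antider_at w X_antider).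
have t2 := total_incrD (total_incrZ k (op_total_incr_at v U_total)) (op_total_incr_at w U_total).
apply: total_incr_unique h1 _ (op_total_incr_at _ U_total) t2.
by apply: antider_ext h2 => r _; rewrite balg_linear.
Qed.

Lemma total_commute C c v : commutant D C -> opnorm_le C c -> A (C v) = C (A v).
Proof.
move=> CP Cc; have h2 := antider_comp CP.1 Cc (op_antider_at v X_antider).
have t2 := total_incr_comp CP.1 Cc (op_total_incr_at v U_total).
apply: total_incr_unique (op_antider_at (C v) X_antider) _ (op_total_incr_at _ U_total) t2.
by apply: antider_ext h2 => r _; rewrite (balg_comm _ CP).
Qed.

(** One increment of [U] approximates [A] up to norm 1, and it is bounded because the integrand is
    bounded on a compact interval. *)
Lemma total_bounded : (forall a b : R, 0 < a ->
    exists2 M, 0 <= M & forall r, a <= r <= b -> opnorm_le (X r) M) ->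
  exists c, opnorm_le A c.
Proof.
move=> Xb; have [a0 [b0 [a00 b00 H]]] := U_total ltr01.
pose b := Num.max a0 b0; have ab : a0 <= b by rewrite le_max lexx.
have [M M0 HM] := Xb a0 b a00.
exists (M * (b - a0) + 1) => v.
have h1 : `|U b v - U a0 v| <= M * `|v| * (b - a0).
  by apply: (antider_lip (op_antider_at v X_antider) a00 ab) => r /HM; exact.
have b0b : b0 <= b by rewrite le_max lexx orbT.
have h2 := H a0 b a00 (lexx _) b0b v.
have -> : A v = (U b v - U a0 v) - (U b v - U a0 v - A v) by rewrite opprB addrC subrK.
apply: (le_trans (ler_normB _ _)); rewrite mulrDl mulrAC; exact: lerD.
Qed.

End integrals_of_algebra_elements.

(** * The calculus of regularized functions *)

Section calculus_operators.
Variables (R : realType) (n : nat) (E : normedModType R).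
Local Notation V := (cliff_mod n E).
Hypothesis V_reflexive : reflexive_space V.
Variables (T : set (V * V)) (omega phi : R) (J : clifford R n).
Hypothesis omega_itv : 0 < omega < pi / 2.
Hypothesis phi_itv : omega < phi < pi / 2.
Hypothesis T_closed : closed_operator T.
Hypothesis T_bisectorial : bisectorial omega T.
Hypothesis J_sphere : unit_sphere J.
Hypothesis T_fun : single_valued T.
Hypothesis T_lin : forall (k : R) u v u' v', T (u, v) -> T (u', v') ->
  T (k *: u + u', k *: v + v').
Hypothesis T_00 : T (0, 0).
Variable c0 : R.
Hypothesis c0_ge0 : 0 <= c0.
Hypothesis T_bounds : forall r psi, 0 < r -> `|cos psi| <= cos phi ->
  opnorm_le (Qinv T (polar r psi)) (c0 / r ^+ 2) /\ opnorm_le (TQinv T (polar r psi)) (c0 / r).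
Variable m : nat.

Local Notation alg := (balg (resolvent_ops T)).

Let phi_itv0 : 0 < phi < pi / 2.
Proof. by move: omega_itv phi_itv; lra. Qed.

(** The source of the right linearity of [e(T)] and [(ef)(T)]. *)
Lemma rmul_commutant a : commutant (resolvent_ops T) (fun v : V => rmul v a).
Proof.
have [_ T_rl _] := T_closed; have [_ _ TM] := T_rl.
apply: (commutant_inv T_fun); first exact (rmul_linear a).
by move=> u w; exact: TM.
Qed.

Definition weighted_ray (k : R -> R -> cplx R) (psi r : R) : alg :=
  im_ray T_fun T_lin T_00 psi (fun r => ray_weight m psi r * k psi r) r.

Definition weighted_rays (k : R -> R -> cplx R) (r : R) : alg :=
  weighted_ray k (pi - phi) r - weighted_ray k phi r.

(* [m] zeros at 0 and at infinity compensate a growth of order [a < m] *)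
Definition admissible (h : clifford R n -> clifford R n) (k : R -> R -> cplx R) : Prop :=
  exists C a : R, [/\ 0 <= C, 0 <= a, a < m%:R &
    forall psi, psi = phi \/ psi = pi - phi ->
    [/\ pos_ccontinuous (k psi),
      forall r, 0 < r -> h (jc J (polar r psi)) = jc J (ray_weight m psi r * k psi r) /\
        h (jc J (polar r (- psi))) = jc J (conjc (ray_weight m psi r * k psi r)) &
      forall r, 0 < r -> Num.sqrt (csq (k psi r)) <= C * (r `^ a + r `^ (- a))]].

Let weight_continuous h k psi : admissible h k -> psi = phi \/ psi = pi - phi ->
  pos_ccontinuous (fun r => ray_weight m psi r * k psi r).
Proof.
move=> [C [a [_ _ _ H]]] psiE; have [kc _ _] := H psi psiE.
exact: pos_ccontinuousM (ray_weight_continuous phi_itv0 m psiE) kc.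
Qed.

Lemma weighted_rays_bounded h k (a b : R) : admissible h k -> 0 < a ->
  exists2 M, 0 <= M & forall r, a <= r <= b -> opnorm_le (weighted_rays k r) M.
Proof.
move=> hk a0; have c20 : 0 <= 2 * c0 by rewrite mulr_ge0.
have RsB := Rs_bound omega_itv phi_itv T_bisectorial J_sphere T_fun T_lin T_00 c0_ge0 T_bounds.
have bnd psi : phi <= psi <= pi - phi -> psi = phi \/ psi = pi - phi ->
    exists2 M, 0 <= M & forall r, a <= r <= b -> opnorm_le (weighted_ray k psi r) M.
  move=> psiI psiE; have [c1 c2] := pos_ccontinuousM (pos_ccontinuous_cst (expi psi)) (weight_continuous hk psiE).
  have [M M0 HM] := ray_fun_bounded c20 RsB psiI c1 c2 b a0.
  by exists M => // r /HM [].
have i1 : phi <= phi <= pi - phi by move: phi_itv0; lra.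
have i2 : phi <= pi - phi <= pi - phi by move: phi_itv0; lra.
have [M1 M10 H1] := bnd phi i1 (or_introl erefl).
have [M2 M20 H2] := bnd (pi - phi) i2 (or_intror erefl).
exists (M2 + M1) => [|r rI]; first exact: addr_ge0.
by apply: opnorm_balgD; [exact: H2|apply: opnorm_balgN; exact: H1].
Qed.

Lemma omega_calculus_antider h k : admissible h k ->
  exists U, op_antider (fun r => weighted_rays k r : V -> V) U /\
    op_total_incr U (fun v => pi *: omega_calculus T J phi h v).
Proof.
move=> hk; have [C [a [C0 a0 am H]]] := hk.
have [_ h1 b1] := H phi (or_introl erefl); have [_ h2 b2] := H (pi - phi) (or_intror erefl).
have M0 : 0 <= (cos phi)^-1 ^+ m * C * 8.
  by rewrite !mulr_ge0// exprn_ge0// invr_ge0 ltW// (cos_phi_gt0 phi_itv0).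
have beta0 : 0 < m%:R - a by rewrite subr_gt0.
have w1 := weight_continuous hk (or_introl erefl).
have w2 := weight_continuous hk (or_intror erefl).
have le1 r (r0 : 0 < r) := weighted_le phi_itv0 (or_introl erefl) r0 a0 am C0 (b1 r r0).
have le2 r (r0 : 0 < r) := weighted_le phi_itv0 (or_intror erefl) r0 a0 am C0 (b2 r r0).
exact: (omega_calculus_total V_reflexive omega_itv phi_itv T_closed T_bisectorial J_sphere
  T_fun T_lin T_00 c0_ge0 T_bounds (fun r r0 => (h1 r r0).1) (fun r r0 => (h1 r r0).2)
  (fun r r0 => (h2 r r0).1) (fun r r0 => (h2 r r0).2) w1 w2 beta0 M0 le1 le2).
Qed.

Let pi_unscale (u v : V) : pi *: u = pi *: v -> u = v.
Proof.
have p0 : pi != 0 :> R by rewrite gt_eqF ?pi_gt0.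
by move=> /(congr1 (fun w => pi^-1 *: w)); rewrite !scalerA mulVf// !scale1r.
Qed.

Lemma omega_calculus_linear h k : admissible h k -> linear (omega_calculus T J phi h).
Proof.
move=> /omega_calculus_antider [U [aU tU]] l v w; apply: pi_unscale.
have /= -> := total_linear aU tU l v w.
by rewrite [RHS]scalerDr !scalerA [l * _]mulrC.
Qed.

Lemma omega_calculus_commute h k B c v : admissible h k ->
  commutant (resolvent_ops T) B -> opnorm_le B c ->
  omega_calculus T J phi h (B v) = B (omega_calculus T J phi h v).
Proof.
move=> /omega_calculus_antider [U [aU tU]] BP Bc; apply: pi_unscale.
have /= -> := total_commute aU tU v BP Bc.
by rewrite (linear_scaleE BP.1).
Qed.

Lemma omega_calculus_bounded h k : admissible h k ->
  exists c, opnorm_le (omega_calculus T J phi h) c.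
Proof.
move=> hk; have [U [aU tU]] := omega_calculus_antider hk.
have [c Hc] := total_bounded aU tU (fun a b a0 => weighted_rays_bounded b hk a0).
exists (pi^-1 * c) => v; have := Hc v; rewrite normrZ (gtr0_norm (pi_gt0 R)) -mulrA.
by rewrite ler_pdivlMl ?pi_gt0.
Qed.

(** The calculus only sees the values on the rays, where [e f] and [f e] agree since each C_J is
    commutative. *)
Lemma omega_calculus_unique h h' k : admissible h k -> admissible h' k ->
  omega_calculus T J phi h = omega_calculus T J phi h'.
Proof.
move=> /omega_calculus_antider [U [aU tU]] /omega_calculus_antider [W [aW tW]].
apply/funext => v; apply: pi_unscale.
exact: total_incr_unique (op_antider_at v aU) (op_antider_at v aW)
  (op_total_incr_at v tU) (op_total_incr_at v tW).
Qed.

Lemma omega_calculus_regularizer h v : (0 < m)%N -> admissible h (fun _ _ => 1) ->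
  omega_calculus T J phi h v = (pb T_fun T_lin T_00 (0, 1) ^+ m) v.
Proof.
move=> m0 /omega_calculus_antider [U [aU tU]]; apply: pi_unscale.
have c20 : 0 <= 2 * c0 by rewrite mulr_ge0.
have c02 : c0 <= 2 * c0 by lra.
have ireg := imag_regular omega_itv phi_itv T_bisectorial J_sphere.
have ib := imag_bounds omega_itv phi_itv T_bisectorial J_sphere T_fun T_lin T_00 T_bounds.
have sreg := sector_regular omega_itv phi_itv T_bisectorial J_sphere.
have RsR := Rs_resolvent omega_itv phi_itv T_bisectorial J_sphere T_fun T_lin T_00.
have RsB := Rs_bound omega_itv phi_itv T_bisectorial J_sphere T_fun T_lin T_00 c0_ge0 T_bounds.
have K1 := opnorm_leW c02 (pb1_opnorm_le (fun t t0 => (ib t t0).2)).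
have S1 := opnorm_leW c02 (qb1_opnorm_le (fun t t0 => (ib t t0).1)).
have KR z (zs : in_sector phi z) := KRz T_fun T_lin T_00 (ireg 1 ltr01) (sreg z zs).
have SR z (zs : in_sector phi z) := SRz T_fun T_lin T_00 (ireg 1 ltr01) (sreg z zs).
(* [power_integral] is indexed from exponent 1, hence [m.-1]. *)
have [W /(_ v) [aW tW]] := power_integral V_reflexive phi_itv0 c20 RsR KR SR RsB S1 K1 m.-1.
rewrite prednK// in aW tW.
apply: (total_incr_unique (op_antider_at v aU) _ (op_total_incr_at v tU) tW).
apply: antider_ext aW => r r0.
have ew psi : weighted_ray (fun _ _ => 1) psi r = power_ray (Rz T_fun T_lin T_00) m psi r.
  by rewrite /weighted_ray /im_ray /ray_fun mulr1.
by rewrite /weighted_rays balgDE balgNE !ew.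
Qed.

End calculus_operators.

Theorem theorem4p5 (R : realType) (n : nat) (n_gt0 : (0 < n)%N)
    (VR : completeNormedModType R) (V_reflexive : reflexive_space (cliff_mod n VR))
    (T : set (cliff_mod n VR * cliff_mod n VR))
    (omega : R) (omega_itv : 0 < omega < pi / 2)
    (T_closed : closed_operator T) (T_inj : op_injective T)
    (T_bisectorial : bisectorial omega T)
    (theta : R) (theta_itv : omega < theta < pi / 2)
    (f : clifford R n -> clifford R n) (C alpha : R)
    (f_poly : intrinsic_poly theta C alpha f)
    (m : nat) (m_gt0 : (0 < m)%N) (m_gt_alpha : alpha < m%:R)
    (* the angle and the imaginary unit of the integration path *)
    (phi : R) (phi_itv : omega < phi < theta)
    (J : clifford R n) (J_sphere : unit_sphere J) :
  let e := @regularizer R n m in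
  let eT := graph_of (omega_calculus T J phi e) in
  let efT := graph_of (omega_calculus T J phi (fun s => e s * f s)) in
  let feT := graph_of (omega_calculus T J phi (fun s => f s * e s)) in
  let fT := op_comp (op_inv eT) efT in
  closable (op_comp feT (op_inv eT)) /\
  is_op_closure (op_comp feT (op_inv eT)) fT.
Proof.
move=> e eT efT feT fT.
have T_fun : single_valued T by have [] := T_closed.
have T_rl : right_linear T by have [] := T_closed.
have T_lin := right_linear_lin T_rl.
have T_00 : T (0, 0) by have [] := T_rl.
have phi1 : omega < phi < pi / 2 by move: phi_itv theta_itv; lra.
have phit : 0 < phi < theta by move: phi_itv omega_itv; lra.
have theta0 : 0 < theta < pi / 2 by move: theta_itv omega_itv; lra.
have [c0 c0_ge0 T_bounds] := polar_resolvent_bounds omega_itv phi1 T_closed T_bisectorial J_sphere.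
have ireg := imag_regular omega_itv phi1 T_bisectorial J_sphere.
have ib := imag_bounds omega_itv phi1 T_bisectorial J_sphere T_fun T_lin T_00 T_bounds.
have q_le (t : R) (t0 : 0 < t) := (ib t t0).1.
have p_le (t : R) (t0 : 0 < t) := (ib t t0).2.
have [g gP] := intrinsic_rays theta0 phit f_poly.
have [_ C_ge0 alpha_ge0 _] := f_poly.
have e_adm : admissible phi J m e (fun _ _ => 1).
  (* The constant 1 has growth order 0, as [1 <= r^0 + r^0]. *)
  exists 1, 0; split=> // [|psi psiE]; first by rewrite ltr0n.
  split=> [|r r0|r r0]; first exact: pos_ccontinuous_cst.
    by rewrite mulr1; exact: regularizer_polar.
  rewrite /csq re1 im1 expr1n expr0n addr0 sqrtr1 oppr0 powRr0 mul1r; lra.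
have ef_adm : admissible phi J m (fun s => e s * f s) (fun psi r => g (polar r psi)).
  exists C, alpha; split=> // psi /gP [gc gE gle]; split=> // [r r0|r r0]; last exact: (gle J).
  have [e1 e2] := regularizer_polar m r psi J_sphere; have [g1 g2] := gE J r J_sphere r0.
  by rewrite /e e1 e2 g1 g2 conjcM !jcM.
have fe_adm : admissible phi J m (fun s => f s * e s) (fun psi r => g (polar r psi)).
  exists C, alpha; split=> // psi /gP [gc gE gle]; split=> // [r r0|r r0]; last exact: (gle J).
  have [e1 e2] := regularizer_polar m r psi J_sphere; have [g1 g2] := gE J r J_sphere r0.
  by rewrite /e e1 e2 g1 g2 conjcM ![ray_weight _ _ _ * _]mulrC ![conjc (ray_weight _ _ _) * _]mulrC !jcM.
have commute h k B c v := @omega_calculus_commute R n VR V_reflexive T omega phi J omega_itv phi1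
  T_closed T_bisectorial J_sphere T_fun T_lin T_00 c0 c0_ge0 T_bounds m h k B c v.
have bounded h k := @omega_calculus_bounded R n VR V_reflexive T omega phi J omega_itv phi1
  T_closed T_bisectorial J_sphere T_fun T_lin T_00 c0 c0_ge0 T_bounds m h k.
have lin h k := @omega_calculus_linear R n VR V_reflexive T omega phi J omega_itv phi1
  T_closed T_bisectorial J_sphere T_fun T_lin T_00 c0 c0_ge0 T_bounds m h k.
have feE : omega_calculus T J phi (fun s => f s * e s) = omega_calculus T J phi (fun s => e s * f s).
  exact: (omega_calculus_unique V_reflexive omega_itv phi1 T_closed T_bisectorial J_sphere
    T_fun T_lin T_00 c0_ge0 T_bounds fe_adm ef_adm).
have eE v : omega_calculus T J phi e v = (pb T_fun T_lin T_00 (0, 1) ^+ m) v.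
  exact: (omega_calculus_regularizer V_reflexive omega_itv phi1 T_closed T_bisectorial J_sphere
    T_fun T_lin T_00 c0_ge0 T_bounds v m_gt0 e_adm).
have rmulP := rmul_commutant T_closed T_fun.
(* [e(T) = K^m], and each factor [K] is injective. *)
have e_inj v : omega_calculus T J phi e v = 0 -> v = 0.
  rewrite eE; elim: (m) v => [|k IH] v; first by rewrite expr0 balg1E.
  by rewrite exprSr balgME => /IH; exact: pb1_injective.
have [cE HE] := bounded _ _ e_adm; have [cF HF] := bounded _ _ ef_adm.
pose s (k : nat) : R := k.+1%:R; pose t (k : nat) : R := (s k)^-1.
have s0 k : 0 < s k by [].
have t0 k : 0 < t k by rewrite invr_gt0.
(* [E B_k] is the [m]-th power of the approximate unit, as [E = K^m] and [K] times the cofactor is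
   that unit. *)
pose B k := unit_approx_cofactor T_fun T_lin T_00 (t k) (s k) ^+ m.
have EBE k v : omega_calculus T J phi e (B k v) = (unit_approx T_fun T_lin T_00 (t k) (s k) ^+ m) v.
  by rewrite eE -balgME -exprMn unit_approx_factor.
have B_bounded k : exists b, opnorm_le (B k) b.
  exact: unit_approx_cofactor_bounded c0_ge0 q_le p_le _ _ _ (t0 k) (s0 k).
have [d Hd] := unit_approx_pow_cvg ireg c0_ge0 q_le p_le m.
rewrite /feT feE; apply: (@left_quotient_is_closure R n VR _ _ cE cF _ _ HE HF _ _ _ e_inj
  (fun k => B k) (((1 + c0) * c0) ^+ m) d V_reflexive).
- exact: lin e_adm.
- exact: lin ef_adm.
- by move=> v a; have [c Hc] := rmul_bounded VR a; exact: commute e_adm (rmulP a) Hc.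
- by move=> v a; have [c Hc] := rmul_bounded VR a; exact: commute ef_adm (rmulP a) Hc.
(* As [K^m] belongs to the algebra it lies in the commutant of the resolvents, with which [(ef)(T)]
   commutes. *)
- move=> v; apply: (etrans (eE _)).
  apply: etrans (esym (commute _ _ _ cE v ef_adm (balg_commutant _) _)) _ => [w|].
    by rewrite -eE; exact: HE.
  exact: congr1 (esym (eE v)).
- by move=> k v; have [b Hb] := B_bounded k; exact: commute e_adm (balg_commutant _) Hb.
- by move=> k v; have [b Hb] := B_bounded k; exact: commute ef_adm (balg_commutant _) Hb.
- move=> k v; rewrite EBE; apply: opnorm_balgX; first by rewrite mulr_ge0 ?addr_ge0.
  exact: unit_approx_le.
- move=> k v; have := Hd k v; rewrite (linear_addE (lin _ _ e_adm)) (linear_oppE (lin _ _ e_adm)).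
  rewrite EBE !eE -normrN; congr (`|_| <= _).
  by rewrite balgME balgDE balgNE balg1E (linear_addE (balg_linear _)) (linear_oppE (balg_linear _)) opprB.
Qed.
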